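(* Let $n\ge 1$, let $M\subset\mathbb{B}_n$ be a subset, let $P=\{f\in L^2_a(\mathbb{B}_n): f|_M=0\}$ and $Q=P^{\perp}$ (orthogonal complement in $L^2_a(\mathbb{B}_n)$). Suppose there exists a positive, finite, regular Borel measure $\mu$ on $M$ and constants $C,c>0$ such that for all $f\in Q$, $$c\|f\|^2\le\int_M|f(w)|^2\,d\mu(w)\le C\|f\|^2,$$ where $\|\cdot\|$ is the norm of $L^2_a(\mathbb{B}_n)$. Then the submodule $P$ is essentially normal.
   Context: $\mathbb{B}_n$ is the open unit ball of $\mathbb{C}^n$, $v_n$ the normalized volume measure on $\mathbb{B}_n$, and $L^2_a(\mathbb{B}_n)$ the Bergman space of holomorphic functions on $\mathbb{B}_n$ square integrable with respect to $v_n$. For a closed subspace $P\subset L^2_a(\mathbb{B}_n)$ invariant under the multiplication operators $T_{z_i}f=z_if$ ($i=1,\dots,n$), write $S_i=T_{z_i}|_P$; $P$ is called essentially normal if all commutators $[S_i,S_j^*]$, $1\le i,j\le n$, are compact operators on $P$. *)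

(* Defs.v *)
From HB Require Import structures.
From mathcomp Require Import all_boot all_order all_algebra.
From mathcomp Require Import all_classical all_reals all_analysis.
From mathcomp Require Import complex.
Import Order.TTheory GRing.Theory Num.Theory.

Set Implicit Arguments.
Unset Strict Implicit.
Unset Printing Implicit Defensive.

Local Open Scope classical_set_scope.
Local Open Scope ring_scope.

Section Bergman.
Variables (R : realType) (n : nat).

Definition cpt := 'I_n -> R[i].
HB.instance Definition _ := Choice.on cpt.
HB.instance Definition _ := isPointed.Build cpt (fun _ => 0).

Definition abs2 (z : R[i]) : R := complex.Re z ^+ 2 + complex.Im z ^+ 2.

Definition cconj (z : R[i]) : R[i] := Complex (complex.Re z) (- complex.Im z).

Definition normsq (z : cpt) : R := \sum_(i < n) abs2 (z i).
Definition dist2 (z w : cpt) : R := normsq (fun i => z i - w i).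

Definition inB (z : cpt) : bool := normsq z < 1.
Definition ballB : set cpt := [set z | inB z].

Definition copen (U : set cpt) : Prop :=
  forall z, U z -> exists r : R, 0 < r /\ forall w, dist2 w z < r -> U w.

Definition ccompact (K : set cpt) : Prop :=
  forall (I : Type) (U : I -> set cpt), (forall i, copen (U i)) ->
    K `<=` (fun z => exists i, U i z) ->
    exists (m : nat) (e : 'I_m -> I), forall z, K z -> exists k, U (e k) z.

Definition cdiff (g : R[i] -> R[i]) (t : R[i]) : Prop :=
  exists L : R[i], forall eps : R, 0 < eps -> exists delta : R, 0 < delta /\
    forall h : R[i], h != 0 -> abs2 h < delta ->
      abs2 ((g (t + h) - g t) / h - L) < eps.

Definition holoB (f : cpt -> R[i]) : Prop :=
  (forall z, inB z -> forall eps : R, 0 < eps -> exists delta : R, 0 < delta /\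
      forall w, dist2 w z < delta -> abs2 (f w - f z) < eps) /\
  (forall z, inB z -> forall j : 'I_n,
      cdiff (fun t => f (fun i => if i == j then t else z i)) (z j)).

Fixpoint iint (k : nat) (F : (nat -> R) -> \bar R) (x : nat -> R) : \bar R :=
  match k with
  | 0 => F x
  | k'.+1 => (\int[@lebesgue_measure R]_(t in setT)
                 iint k' F (fun m => if m == k' then t else x m))%E
  end.

Definition pt_of (x : nat -> R) : cpt :=
  fun i => Complex (x (2 * i)%N) (x (2 * i + 1)%N).

(* Lebesgue integral over C^n = R^{2n} (as iterated integral, Fubini--Tonelli) *)
Definition lebC (F : cpt -> \bar R) : \bar R := iint (2 * n) (fun x => F (pt_of x)) (fun _ => 0).

Definition vol_ball : \bar R := lebC (fun z => if inB z then 1%E else 0%E).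

Definition vint (F : cpt -> \bar R) : \bar R :=
  (lebC (fun z => if inB z then F z else 0%E) * ((fine vol_ball)^-1)%:E)%E.

Definition bnorm2 (f : cpt -> R[i]) : \bar R := vint (fun z => (abs2 (f z))%:E).
Definition ip_re (f g : cpt -> R[i]) : \bar R :=
  vint (fun z => (complex.Re (f z * cconj (g z)))%:E).
Definition ip_im (f g : cpt -> R[i]) : \bar R :=
  vint (fun z => (complex.Im (f z * cconj (g z)))%:E).

Definition bergman (f : cpt -> R[i]) : Prop := holoB f /\ (bnorm2 f < +oo)%E.

Variable M : set cpt.

Definition inP (f : cpt -> R[i]) : Prop := bergman f /\ forall z, M z -> f z = 0.
Definition inQ (g : cpt -> R[i]) : Prop :=
  bergman g /\ forall f, inP f -> ip_re f g = 0%E /\ ip_im f g = 0%E.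

Definition mulz (j : 'I_n) (f : cpt -> R[i]) : cpt -> R[i] := fun z => z j * f z.

Definition adjointP (j : 'I_n) (A : (cpt -> R[i]) -> (cpt -> R[i])) : Prop :=
  forall f, inP f -> inP (A f) /\
    forall h, inP h -> ip_re (mulz j h) f = ip_re h (A f) /\
                       ip_im (mulz j h) f = ip_im h (A f).

Definition compactP (K : (cpt -> R[i]) -> (cpt -> R[i])) : Prop :=
  forall u : nat -> (cpt -> R[i]), (forall k, inP (u k)) ->
    (exists B : R, forall k, (bnorm2 (u k) <= B%:E)%E) ->
    exists phi : nat -> nat, (forall k, (phi k < phi k.+1)%N) /\
      exists g, inP g /\
        forall eps : R, 0 < eps -> exists N : nat, forall k, (N <= k)%N ->
          (bnorm2 (fun z => (K (u (phi k)) z - g z)%R) < eps%:E)%E.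

Definition ess_normalP : Prop :=
  forall i j : 'I_n, exists A, adjointP j A /\
    compactP (fun f z => mulz i (A f) z - A (mulz i f) z).

End Bergman.

Notation borelC R n := (g_sigma_algebraType (@copen R n)).

Definition regular_measure (R : realType) (n : nat)
    (mu : set (borelC R n) -> \bar R) : Prop :=
  forall A : set (borelC R n), measurable A ->
    mu A = ereal_inf [set mu U | U in [set U : set (borelC R n) | copen U /\ A `<=` U]] /\
    mu A = ereal_sup [set mu K | K in [set K : set (borelC R n) | ccompact K /\ K `<=` A]].

(* Main.v *)
(* With [A_j f] the projection onto [P] of [\bar z_j f], one has [S_j^* = A_j], and compactness of the
   commutators reduces to: [dist (\bar z_j d_k, P) -> 0] for every bounded sequence [d_k] in [P] that
   tends to [0] pointwise on the ball.  The Bergman projection [G_k] of [\bar z_j d_k] is a weighted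
   backward shift of Taylor coefficients, and [||\bar z_j d_k - G_k||^2] is at most
   [sum_a |a-th coefficient|^2 omega_a / (n + |a| + 1)], which tends to [0].  Writing [G_k = p_k + q_k]
   along [P + Q], the lower bound gives [c ||q_k||^2 <= int |q_k|^2 dmu = int |G_k|^2 dmu].
   To see that this is small, let [psi_s] be the monomial of a word [s] of length [m] and
   [chi_s = d_j psi_s].  Since [d_k] vanishes on [M], the upper bound applied to
   [psi_s G_k - chi_s d_k / m] and summation over [s] give
     [int |w|^(2m) |G_k|^2 dmu <= C sum_s ||psi_s G_k - chi_s d_k / m||^2],
   where [sum_s |\bar z_j psi_s - chi_s / m|^2 <= (1 - |z|^2)^2 + 1/m] makes the right-hand side small;
   on the region [|w|^(2m) < 1/2] the [G_k] tend to [0] uniformly.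
   The structure of the Bergman space comes from averages over finite tori: a discrete form of
   Goursat's theorem yields Taylor series on the ball, averaging over roots of unity and rotation
   invariance yield Parseval's identity, and completeness is replaced by Fatou's lemma together with
   the extraction of subsequences with convergent coefficients. *)

(* The reduction rests on [z_i A_j f - A_j (z_i f) = (\bar z_j z_i f - A_j (z_i f)) - z_i (\bar z_j
   f - A_j f)]: each bracket is a component orthogonal to [P], whose norm is a distance to [P], so
   one estimate serves both. The obstacle is that [\bar z_j d_k] vanishes on [M] but is not
   holomorphic, so the upper bound says nothing about it, while its holomorphic neighbour [G_k] has
   no evident reason to be small on [M]. The functions [chi_s / m] are the remedy. Differentiating
   [sum_s |psi_s|^2 = |z|^(2m)] gives [sum_s chi_s \bar psi_s = m \bar z_j |z|^(2m-2)]; near the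
   unit sphere this makes [chi_s / m] a holomorphic substitute for [\bar z_j psi_s], with summed
   squared error about [1/m]. So [psi_s G_k] and [chi_s d_k / m] are both close to
   [\bar z_j psi_s d_k], both are holomorphic, and the second vanishes on [M]. Words are taken
   instead of multi-indices so that no multinomial weights occur in these identities. *)
Require Import Defs.
From HB Require Import structures.
From mathcomp Require Import all_boot all_order all_algebra.
From mathcomp Require Import all_classical all_reals all_analysis.
From mathcomp Require Import measurable_realfun complex ring lra.
Import Order.TTheory GRing.Theory Num.Theory.
Import numFieldNormedType.Exports.
Set Implicit Arguments.
Unset Strict Implicit.
Unset Printing Implicit Defensive.
Local Open Scope classical_set_scope.
Local Open Scope ring_scope.

(** * Complex differentiability and Goursat's theorem *)

Notation cabs := Normc.normc.

(** * The modulus on [R[i]] *)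

Section ComplexModulus.
Context {R : realType}.
Implicit Types z w : R[i].

Lemma abs2E z : abs2 z = cabs z ^+ 2.
Proof. by case: z => a b; rewrite /abs2 /= sqr_sqrtr // addr_ge0 // sqr_ge0. Qed.

Lemma cabs_ge0 z : 0 <= cabs z.
Proof. by case: z => a b; exact: sqrtr_ge0. Qed.

Lemma cabsM z w : cabs (z * w) = cabs z * cabs w.
Proof. exact: Normc.normcM. Qed.

Lemma cabs0 : cabs (0 : R[i]) = 0.
Proof. exact: Normc.normc0. Qed.

Lemma cabs1 : cabs (1 : R[i]) = 1.
Proof. exact: Normc.normc1. Qed.

Lemma cabsV z : cabs z^-1 = (cabs z)^-1.
Proof. exact: Normc.normcV. Qed.

Lemma cabsX z k : cabs (z ^+ k) = cabs z ^+ k.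
Proof. by elim: k => [|k IH]; rewrite ?expr0 ?cabs1 // !exprS cabsM IH. Qed.

Lemma cabs_eq0 z : (cabs z == 0) = (z == 0).
Proof.
apply/eqP/eqP => [/Normc.eq0_normc //|->]; exact: cabs0.
Qed.

Lemma cabs_gt0 z : (0 < cabs z) = (z != 0).
Proof. by rewrite lt_neqAle cabs_ge0 andbT eq_sym cabs_eq0. Qed.

Lemma cabsN z : cabs (- z) = cabs z.
Proof. exact: normcN. Qed.

Lemma cabsB z w : cabs (z - w) = cabs (w - z).
Proof. by rewrite -cabsN opprB. Qed.

Lemma ler_cabsD z w : cabs (z + w) <= cabs z + cabs w.
Proof. exact: le_normcD. Qed.

Lemma ler_cabsB z w : cabs (z - w) <= cabs z + cabs w.
Proof. by rewrite (le_trans (ler_cabsD _ _)) // cabsN. Qed.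

Lemma ler_cabs_dist v z w : cabs (z - w) <= cabs (z - v) + cabs (v - w).
Proof. by rewrite (le_trans _ (ler_cabsD _ _)) // addrA subrK. Qed.

Lemma ler_cabs_sub z w : cabs z - cabs w <= cabs (z - w).
Proof. by rewrite lerBlDr -{1}(subrK w z) ler_cabsD. Qed.

Lemma ler_cabs_sum (I : Type) (r : seq I) (P : pred I) (F : I -> R[i]) :
  cabs (\sum_(i <- r | P i) F i) <= \sum_(i <- r | P i) cabs (F i).
Proof.
elim/big_ind2: _ => [|x y z t Hx Hz|//]; first by rewrite cabs0.
by rewrite (le_trans (ler_cabsD _ _)) ?lerD.
Qed.

Lemma cabs_prod (I : Type) (r : seq I) (P : pred I) (F : I -> R[i]) :
  cabs (\prod_(i <- r | P i) F i) = \prod_(i <- r | P i) cabs (F i).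
Proof. by elim/big_ind2: _ => [|x y z t <- <-|//]; rewrite ?cabs1 ?cabsM. Qed.

Lemma cabs_real (x : R) : cabs (x%:C)%C = `|x|.
Proof. by rewrite /= expr0n addr0 sqrtr_sqr. Qed.

Lemma cabs_nat k : cabs (k%:R : R[i]) = k%:R.
Proof. by rewrite -(rmorph_nat (real_complex R)) cabs_real normr_nat. Qed.

Lemma cabs_i : cabs ('i%C : R[i]) = 1.
Proof. by rewrite /= expr0n add0r expr1n sqrtr1. Qed.

Lemma normr_Re z : `|complex.Re z| <= cabs z.
Proof.
case: z => a b /=; rewrite -sqrtr_sqr ler_wsqrtr // lerDl sqr_ge0 //.
Qed.

Lemma normr_Im z : `|complex.Im z| <= cabs z.
Proof.
case: z => a b /=; rewrite -sqrtr_sqr ler_wsqrtr // lerDr sqr_ge0 //.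
Qed.

Lemma cabs_le_ReIm z : cabs z <= `|complex.Re z| + `|complex.Im z|.
Proof.
case: z => a b /=; rewrite -[leRHS]ger0_norm ?addr_ge0 // -sqrtr_sqr ler_wsqrtr //.
by rewrite sqrrD !real_normK ?num_real // lerD2r lerDl mulrn_wge0 // mulr_ge0.
Qed.

Lemma cabs_conj z : cabs (cconj z) = cabs z.
Proof. by case: z => a b; rewrite /= sqrrN. Qed.

Lemma cconjE z : cconj z = (z^*)%C.
Proof. by case: z. Qed.

Lemma abs2_ge0 z : 0 <= abs2 z.
Proof. by rewrite abs2E sqr_ge0. Qed.

Lemma abs2M z w : abs2 (z * w) = abs2 z * abs2 w.
Proof. by rewrite !abs2E cabsM exprMn. Qed.

Lemma abs2_lt z (e : R) : 0 < e -> (abs2 z < e ^+ 2) = (cabs z < e).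
Proof. by move=> e0; rewrite abs2E ltr_pXn2r // ?nnegrE ?cabs_ge0 // ltW. Qed.

End ComplexModulus.

Section ContinuityWrt.
Context {R : realType} {X : Type} (D : X -> R).
Implicit Types (p q : X) (G H : X -> R[i]).

(* [D] is meant to be the distance to [p]: the modulus in [R[i]], or [dist2] in [cpt R n]. *)
Definition cont_wrt G p := forall e : R, 0 < e -> exists2 d : R, 0 < d &
  forall q, D q < d -> cabs (G q - G p) < e.

Lemma cont_wrt_bounded G p : cont_wrt G p -> exists2 d : R, 0 < d &
  forall q, D q < d -> cabs (G q) <= cabs (G p) + 1.
Proof.
move=> /(_ 1 ltr01)[d d0 Hd]; exists d => // q /Hd h.
by rewrite -(subrK (G p) (G q)) (le_trans (ler_cabsD _ _)) // addrC lerD2l ltW.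
Qed.

Lemma cont_wrt_cst (z : R[i]) p : cont_wrt (fun=> z) p.
Proof. by move=> e e0; exists 1 => // q _; rewrite subrr cabs0. Qed.

Lemma cont_wrtD G H p : cont_wrt G p -> cont_wrt H p ->
  cont_wrt (fun q => G q + H q) p.
Proof.
move=> hG hH e e0; have e2 : 0 < e / 2 by rewrite divr_gt0.
have [d d0 Hd] := hG _ e2; have [d' d'0 Hd'] := hH _ e2.
exists (Num.min d d') => [|q]; rewrite lt_min ?d0 // => /andP[/Hd h /Hd' h'].
rewrite opprD addrACA (le_lt_trans (ler_cabsD _ _)) //.
by rewrite (splitr e) ltrD.
Qed.

Lemma cont_wrtM G H p : cont_wrt G p -> cont_wrt H p ->
  cont_wrt (fun q => G q * H q) p.
Proof.
move=> hG hH e e0.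
have [d1 d10 Hd1] := cont_wrt_bounded hH.
set a := cabs (H p) + 1; set b := cabs (G p) + 1.
have a0 : 0 < a by rewrite ltr_wpDl ?cabs_ge0.
have b0 : 0 < b by rewrite ltr_wpDl ?cabs_ge0.
have [d d0 Hd] := hG _ (divr_gt0 (divr_gt0 e0 (ltr0n R 2)) a0).
have [d' d'0 Hd'] := hH _ (divr_gt0 (divr_gt0 e0 (ltr0n R 2)) b0).
exists (Num.min d1 (Num.min d d')) => [|q]; rewrite !lt_min ?d0 ?d10 //.
move=> /and3P[/Hd1 h1 /Hd h /Hd' h'].
have -> : G q * H q - G p * H p = (G q - G p) * H q + G p * (H q - H p) by ring.
rewrite (le_lt_trans (ler_cabsD _ _)) // !cabsM (splitr e) ltr_leD //.
  rewrite (le_lt_trans (ler_wpM2l (cabs_ge0 _) h1)) //.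
  by rewrite -ltr_pdivlMr.
rewrite (@le_trans _ _ (b * cabs (H q - H p))) //.
  by rewrite ler_wpM2r ?cabs_ge0 // lerDl.
by rewrite mulrC -ler_pdivlMr // ltW.
Qed.

End ContinuityWrt.

(** * Complex differentiability through slope functions *)

Section ComplexDifferentiability.
Context {R : realType}.
Implicit Types (p q z w : R[i]) (G H : R[i] -> R[i]).

Definition ccont_at G p := cont_wrt (fun q => cabs (q - p)) G p.

(* Caratheodory's form of complex differentiability *)
Definition cd G p := exists2 S : R[i] -> R[i],
  forall q, G q - G p = S q * (q - p) & ccont_at S p.

Lemma ccont_at_bounded G p : ccont_at G p -> exists2 d : R, 0 < d &
  forall q, cabs (q - p) < d -> cabs (G q) <= cabs (G p) + 1.
Proof. exact: cont_wrt_bounded. Qed.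

Lemma ccont_at_cst z p : ccont_at (fun=> z) p.
Proof. exact: cont_wrt_cst. Qed.

Lemma ccont_at_id p : ccont_at id p.
Proof. by move=> e e0; exists e. Qed.

Lemma ccont_atD G H p : ccont_at G p -> ccont_at H p ->
  ccont_at (fun q => G q + H q) p.
Proof. exact: cont_wrtD. Qed.

Lemma ccont_atM G H p : ccont_at G p -> ccont_at H p ->
  ccont_at (fun q => G q * H q) p.
Proof. exact: cont_wrtM. Qed.

Lemma ccont_atV G p : G p != 0 -> ccont_at G p ->
  ccont_at (fun q => (G q)^-1) p.
Proof.
move=> Gp0 hG e e0; have Gp : 0 < cabs (G p) by rewrite cabs_gt0.
have [d d0 Hd] := hG _ (divr_gt0 Gp (ltr0n R 2)).
have e1 : 0 < e * (cabs (G p) / 2 * cabs (G p)) by rewrite !mulr_gt0.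
have [d' d'0 Hd'] := hG _ e1.
exists (Num.min d d') => [|q]; rewrite lt_min ?d0 // => /andP[/Hd h /Hd' h'].
have hq : cabs (G p) / 2 < cabs (G q).
  have := ler_cabs_sub (G p) (G q); rewrite cabsB; lra.
have Gq0 : G q != 0 by rewrite -cabs_gt0 (lt_trans _ hq) // divr_gt0.
have -> : (G q)^-1 - (G p)^-1 = (G p - G q) * ((G q)^-1 * (G p)^-1).
  by field; rewrite Gq0 Gp0.
rewrite !cabsM !cabsV cabsB -invfM ltr_pdivrMr; last by rewrite mulr_gt0 // cabs_gt0.
rewrite (lt_le_trans h') // ler_wpM2l ?(ltW e0) // ler_wpM2r ?cabs_ge0 //.
exact: ltW.
Qed.

Lemma ccont_at_comp G H p : ccont_at G p -> ccont_at H (G p) ->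
  ccont_at (fun q => H (G q)) p.
Proof.
move=> hG hH e /hH[d /hG[d' d'0 Hd'] Hd].
by exists d' => // q /Hd'/Hd.
Qed.

Lemma cd_cont G p : cd G p -> ccont_at G p.
Proof.
move=> [S SE Sc] e e0.
have [d d0 Hd] := ccont_at_bounded Sc.
have a0 : 0 < cabs (S p) + 1 by rewrite ltr_wpDl ?cabs_ge0.
exists (Num.min d (e / (cabs (S p) + 1))) => [|q].
  by rewrite lt_min d0 divr_gt0.
rewrite lt_min => /andP[/Hd h]; rewrite ltr_pdivlMr // => h'.
rewrite SE cabsM (le_lt_trans _ h') // mulrC ler_wpM2l ?cabs_ge0 //.
Qed.

Lemma cd_cst z p : cd (fun=> z) p.
Proof. by exists (fun=> 0) => [q|]; [rewrite subrr mul0r|exact: ccont_at_cst]. Qed.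

Lemma cd_id p : cd id p.
Proof. by exists (fun=> 1) => [q|]; [rewrite mul1r|exact: ccont_at_cst]. Qed.

Lemma cdD G H p : cd G p -> cd H p -> cd (fun q => G q + H q) p.
Proof.
move=> [S SE Sc] [T TE Tc]; exists (fun q => S q + T q); last exact: ccont_atD.
by move=> q; rewrite opprD addrACA SE TE mulrDl.
Qed.

Lemma cdM G H p : cd G p -> cd H p -> cd (fun q => G q * H q) p.
Proof.
move=> hG hH; move: (hG) (hH) => [S SE Sc] [T TE Tc].
exists (fun q => S q * H q + G p * T q).
  move=> q; rewrite mulrDl mulrAC -SE -mulrA -TE; ring.
apply: ccont_atD; apply: ccont_atM => //; first exact: cd_cont.
exact: ccont_at_cst.
Qed.

Lemma cdV G p : G p != 0 -> cd G p -> cd (fun q => (G q)^-1) p.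
Proof.
move=> Gp0 hG; move: (hG) => [S SE Sc].
(* A slope is required at every [q], also where [G q = 0]. The raw difference quotient serves there;
   near [p] only the other branch occurs. *)
exists (fun q => if G q == 0 then ((G q)^-1 - (G p)^-1) / (q - p)
                 else - S q * ((G q)^-1 * (G p)^-1)).
  move=> q; case: (eqVneq (G q) 0) => Gq0.
    rewrite divfK // subr_eq0; apply: contraNneq Gp0 => <-; exact/eqP.
  rewrite mulrAC mulNr -SE; field; exact/andP.
have hc : ccont_at (fun q => - S q * ((G q)^-1 * (G p)^-1)) p.
  have hV := ccont_atV Gp0 (cd_cont hG).
  have hN : ccont_at (fun q => -1 * S q) p.
    apply: ccont_atM => //; exact: ccont_at_cst.
  have := ccont_atM hN (ccont_atM hV (ccont_at_cst (G p)^-1 p)).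
  by under [fun q => _]eq_fun do rewrite mulN1r.
move=> e e0; have [d d0 Hd] := hc _ e0.
have Gp : 0 < cabs (G p) by rewrite cabs_gt0.
have [d' d'0 Hd'] := cd_cont hG Gp.
exists (Num.min d d') => [|q]; rewrite lt_min ?d0 // => /andP[/Hd h /Hd' h'].
rewrite (negbTE Gp0); case: (eqVneq (G q) 0) => Gq0 //.
by move: h'; rewrite Gq0 sub0r cabsN ltxx.
Qed.

Lemma cd_comp G H p : cd G p -> cd H (G p) -> cd (fun q => H (G q)) p.
Proof.
move=> hG [T TE Tc]; move: (hG) => [S SE Sc].
exists (fun q => T (G q) * S q); first by move=> q; rewrite TE SE mulrA.
apply: ccont_atM => //; apply: ccont_at_comp => //; exact: cd_cont.
Qed.

Lemma cd_slope G p q : q != p -> cd G q -> cd (fun z => (G z - G p) / (z - p)) q.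
Proof.
move=> qp hG; apply: cdM.
  apply: cdD => //; exact: cd_cst.
apply: cdV; first by rewrite subr_eq0.
apply: cdD; [exact: cd_id|exact: cd_cst].
Qed.

(** Boundedness near [p] is all that Goursat's theorem with an exceptional point asks of the
    difference quotient. *)
Lemma cd_slope_bounded G p : cd G p -> exists2 d : R, 0 < d &
  exists K : R, forall q, cabs (q - p) < d -> cabs ((G q - G p) / (q - p)) <= K.
Proof.
move=> [S SE /ccont_at_bounded[d d0 Hd]]; exists d => //.
exists (cabs (S p) + 1) => q /Hd h.
have [->|qp] := eqVneq q p.
  by rewrite subrr mul0r cabs0 addr_ge0 ?cabs_ge0.
by rewrite SE mulfK // subr_eq0.
Qed.

Lemma cdiffE g z : cdiff g z <-> cd g z.
Proof.
split=> [[L HL]|[S SE Sc]].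
  exists (fun q => if q == z then L else (g q - g z) / (q - z)).
    move=> q; case: eqVneq => [->|qz]; first by rewrite !subrr mulr0.
    by rewrite divfK // subr_eq0.
  move=> e e0; have [d [d0 Hd]] := HL _ (exprn_gt0 2 e0).
  exists (Num.sqrt d) => [|q]; first by rewrite sqrtr_gt0.
  move=> hq; rewrite eqxx; case: eqVneq => [|qz]; first by rewrite subrr cabs0.
  have := Hd (q - z); rewrite subr_eq0 abs2_lt // [z + _]addrC subrK; apply => //.
  by rewrite -(sqr_sqrtr (ltW d0)) abs2_lt // sqrtr_gt0.
exists (S z) => e e0.
have [d d0 Hd] := Sc (Num.sqrt e) ltac:(by rewrite sqrtr_gt0).
exists (d ^+ 2); split=> [|h h0]; first exact: exprn_gt0.
rewrite abs2_lt // => hd.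
rewrite -(sqr_sqrtr (ltW e0)) abs2_lt ?sqrtr_gt0 // SE [z + h]addrC addrK mulfK //.
by apply: Hd; rewrite addrK.
Qed.

End ComplexDifferentiability.

(** * Goursat's theorem for Riemann sums over rectangles *)

Section DiscreteGoursat.
Context {R : realType}.
Implicit Types (p q a b d : R[i]) (G H : R[i] -> R[i]) (x y w h : R).

(* The left-endpoint Riemann sum, with [2 ^ m] nodes, of the integral of [G] over the segment from [p] to [p + d]. *)
Definition seg_sum m G p d : R[i] :=
  d / (2 ^ m)%:R * \sum_(l < 2 ^ m) G (p + l%:R / (2 ^ m)%:R * d).

(** Opposite sides are subtracted, not run backwards: reversing a left-endpoint sum would produce a
    right-endpoint one, and inner edges would no longer cancel exactly in [bd_sumS]. *)
Definition bd_sum m G p a b : R[i] :=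
  seg_sum m G p a + seg_sum m G (p + a) b - seg_sum m G (p + b) a - seg_sum m G p b.

Let pow2_neq0 m : (2 ^ m)%:R != 0 :> R[i].
Proof. by rewrite pnatr_eq0 expn_eq0. Qed.

(** With a power of two as number of nodes, the nodes of the two halves are exactly those of the
    whole segment, so no error term appears. *)
Lemma seg_sumS m G p d :
  seg_sum m.+1 G p d = seg_sum m G p (d / 2) + seg_sum m G (p + d / 2) (d / 2).
Proof.
rewrite /seg_sum -(big_mkord xpredT (fun l => G (p + l%:R / (2 ^ m.+1)%:R * d))).
rewrite expnS mul2n -addnn (big_cat_nat (n := 2 ^ m)) ?leq_addr //=.
rewrite -[X in _ * (_ + \big[_/_]_(X <= _ < _ | _) _)]add0n big_addn addnK !big_mkord.
have e2 : (2 ^ m + 2 ^ m)%:R = 2 * (2 ^ m)%:R :> R[i] by rewrite natrD; ring.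
rewrite e2 mulrDr; congr (_ + _); congr (_ * _).
- by field; exact: pow2_neq0.
- by apply: eq_bigr => l _; congr (G _); field; exact: pow2_neq0.
- by field; exact: pow2_neq0.
by apply: eq_bigr => l _; congr (G _); rewrite natrD; field; exact: pow2_neq0.
Qed.

Lemma bd_sumS m G p a b : bd_sum m.+1 G p a b =
  bd_sum m G p (a / 2) (b / 2) + bd_sum m G (p + a / 2) (a / 2) (b / 2) +
  bd_sum m G (p + b / 2) (a / 2) (b / 2) +
  bd_sum m G (p + a / 2 + b / 2) (a / 2) (b / 2).
Proof.
rewrite /bd_sum !seg_sumS.
have -> : p + a / 2 + a / 2 = p + a by field.
have -> : p + a / 2 + b / 2 + a / 2 = p + a + b / 2 by field.
have -> : p + b / 2 + b / 2 = p + b by field.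
have -> : p + a / 2 + b / 2 + b / 2 = p + b + a / 2 by field.
have -> : p + b / 2 + a / 2 = p + a / 2 + b / 2 by ring.
ring.
Qed.

Lemma seg_sumD m G H p d :
  seg_sum m (fun q => G q + H q) p d = seg_sum m G p d + seg_sum m H p d.
Proof. by rewrite /seg_sum big_split mulrDr. Qed.

Lemma bd_sumD m G H p a b :
  bd_sum m (fun q => G q + H q) p a b = bd_sum m G p a b + bd_sum m H p a b.
Proof. by rewrite /bd_sum !seg_sumD; ring. Qed.

(** Translating the segment of direction [d] by [y] adds [d * B * y], which is symmetric in [d] and
    [y]; the two pairs of opposite sides therefore cancel, and this at every level [m]. *)
Lemma bd_sum_affine m p a b (A B c : R[i]) :
  bd_sum m (fun q => A + B * (q - c)) p a b = 0.
Proof.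
have shift (x y d : R[i]) : seg_sum m (fun q => A + B * (q - c)) (x + y) d =
    seg_sum m (fun q => A + B * (q - c)) x d + d * B * y.
  rewrite /seg_sum (eq_bigr (fun l : 'I_(2 ^ m) =>
    (A + B * (x + l%:R / (2 ^ m)%:R * d - c)) + B * y)); last by move=> l _; ring.
  rewrite big_split /= sumr_const card_ord mulrDr -[B * y *+ _]mulr_natr.
  by congr (_ + _); field; exact: pow2_neq0.
rewrite /bd_sum !shift; ring.
Qed.

Lemma seg_sum_le m G p d (M : R) :
  (forall t : R, 0 <= t <= 1 -> cabs (G (p + t%:C%C * d)) <= M) ->
  cabs (seg_sum m G p d) <= cabs d * M.
Proof.
move=> hM; rewrite /seg_sum !cabsM -mulrA ler_wpM2l ?cabs_ge0 // cabsV cabs_nat.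
rewrite mulrC ler_pdivrMr ?ltr0n ?expn_gt0 //.
rewrite (le_trans (ler_cabs_sum _ _ _)) // (@le_trans _ _ (\sum_(l < 2 ^ m) M)) //.
  apply: ler_sum => l _.
  have -> : l%:R / (2 ^ m)%:R = (l%:R / (2 ^ m)%:R : R)%:C%C :> R[i].
    by rewrite rmorphM fmorphV !rmorph_nat.
  apply: hM; rewrite divr_ge0 //= ler_pdivrMr ?ltr0n ?expn_gt0 // mul1r ler_nat.
  exact: ltnW.
by rewrite sumr_const card_ord mulr_natr.
Qed.

Definition rect (x y w h : R) q := [&& x <= complex.Re q, complex.Re q <= x + w,
  y <= complex.Im q & complex.Im q <= y + h].

Local Notation rsum m G x y w h := (bd_sum m G (Complex x y) (Complex w 0) (Complex 0 h)).

Lemma rsumS m G (x y w h : R) : rsum m.+1 G x y w h =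
  rsum m G x y (w / 2) (h / 2) + rsum m G (x + w / 2) y (w / 2) (h / 2) +
  rsum m G x (y + h / 2) (w / 2) (h / 2) +
  rsum m G (x + w / 2) (y + h / 2) (w / 2) (h / 2).
Proof.
have e2 : 2^-1 = Complex 2^-1 0 :> R[i].
  by rewrite -[RHS]/((2^-1)%:C%C) fmorphV rmorph_nat.
rewrite bd_sumS e2.
have E1 : Complex w 0 * Complex 2^-1 0 = Complex (w / 2) 0.
  by apply/eqP; rewrite eq_complex /=; apply/andP; split; apply/eqP; ring.
have E2 : Complex 0 h * Complex 2^-1 0 = Complex 0 (h / 2).
  by apply/eqP; rewrite eq_complex /=; apply/andP; split; apply/eqP; ring.
have A1 (u v s : R) : Complex u v + Complex s 0 = Complex (u + s) v.
  by rewrite -[LHS]/(Complex _ _) addr0.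
have A2 (u v s : R) : Complex u v + Complex 0 s = Complex u (v + s).
  by rewrite -[LHS]/(Complex _ _) addr0.
by rewrite E1 E2 !A1 !A2.
Qed.

Lemma rsum_le m G (x y w h M : R) : 0 <= w -> 0 <= h ->
  (forall q, rect x y w h q -> cabs (G q) <= M) ->
  cabs (rsum m G x y w h) <= 2 * (w + h) * M.
Proof.
move=> w0 h0 hM.
have cw : cabs (Complex w 0) = w by rewrite [LHS]cabs_real ger0_norm.
have ch : cabs (Complex 0 h) = h by rewrite /= expr0n add0r sqrtr_sqr ger0_norm.
have H (x' y' w' h' : R) : x <= x' -> 0 <= w' -> x' + w' <= x + w ->
    y <= y' -> 0 <= h' -> y' + h' <= y + h ->
    cabs (seg_sum m G (Complex x' y') (Complex w' h')) <= cabs (Complex w' h') * M.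
  move=> h1 h2 h3 h4 h5 h6; apply: seg_sum_le => t /andP[t0 t1]; apply: hM.
  have b1 := mulr_ge0 t0 h2; have b2 := mulr_ge0 t0 h5.
  have b3 := ler_wpM2r h2 t1; have b4 := ler_wpM2r h5 t1.
  by rewrite /rect /= !mul0r subr0 !addr0; apply/and4P; split; lra.
have A1 (u v s : R) : Complex u v + Complex s 0 = Complex (u + s) v.
  by rewrite -[LHS]/(Complex _ _) addr0.
have A2 (u v s : R) : Complex u v + Complex 0 s = Complex u (v + s).
  by rewrite -[LHS]/(Complex _ _) addr0.
rewrite /bd_sum A1 A2.
have H1 := H x y w 0 (lexx _) w0 (lexx _) (lexx _) (lexx _).
have H2 := H (x + w) y 0 h ltac:(lra) (lexx _) ltac:(lra) (lexx _) h0 (lexx _).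
have H3 := H x (y + h) w 0 (lexx _) w0 (lexx _) ltac:(lra) (lexx _) ltac:(lra).
have H4 := H x y 0 h (lexx _) (lexx _) ltac:(lra) (lexx _) h0 (lexx _).
move: (H1 ltac:(lra)) H2 H3 H4; rewrite !cw !ch => H1' H2 H3 H4.
rewrite (le_trans (ler_cabsB _ _)) // (le_trans (lerD (ler_cabsB _ _) (lexx _))) //.
rewrite (le_trans (lerD (lerD (ler_cabsD _ _) (lexx _)) (lexx _))) //.
lra.
Qed.

(** The limsup over [m] of the modulus of the boundary sums is at most [c]. No integral is formed,
    so no limit has to exist. *)
Definition rsum_limsup G (x y w h c : R) := forall e : R, 0 < e ->
  exists m0, forall m, (m0 <= m)%N -> cabs (rsum m G x y w h) <= c + e.

Lemma rsum_limsupW G x y w h c c' : c <= c' ->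
  rsum_limsup G x y w h c -> rsum_limsup G x y w h c'.
Proof.
move=> cc' H e /H[m0 Hm0]; exists m0 => m /Hm0/le_trans; apply.
by rewrite lerD2r.
Qed.

Lemma rsum_limsup_quarters G x y w h c1 c2 c3 c4 :
  rsum_limsup G x y (w / 2) (h / 2) c1 ->
  rsum_limsup G (x + w / 2) y (w / 2) (h / 2) c2 ->
  rsum_limsup G x (y + h / 2) (w / 2) (h / 2) c3 ->
  rsum_limsup G (x + w / 2) (y + h / 2) (w / 2) (h / 2) c4 ->
  rsum_limsup G x y w h (c1 + c2 + c3 + c4).
Proof.
move=> H1 H2 H3 H4 e e0; have e4 : 0 < e / 4 by rewrite divr_gt0.
have [m1 {}H1] := H1 _ e4; have [m2 {}H2] := H2 _ e4.
have [m3 {}H3] := H3 _ e4; have [m4 {}H4] := H4 _ e4.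
exists (maxn (maxn m1 m2) (maxn m3 m4)).+1 => -[//|m].
rewrite ltnS !geq_max -andbA => /and4P[/H1 {}H1 /H2 {}H2 /H3 {}H3 /H4 {}H4].
rewrite rsumS (le_trans (ler_cabsD _ _)) // (le_trans (lerD (ler_cabsD _ _) (lexx _))) //.
rewrite (le_trans (lerD (lerD (ler_cabsD _ _) (lexx _)) (lexx _))) //.
lra.
Qed.

(** The condition makes the intervals from [u k] to [u k + w / 2 ^+ k] decrease; the supremum of the
    left ends lies in all of them. *)
Lemma nested_intervals (u : nat -> R) (w : R) : 0 <= w ->
  (forall k, u k <= u k.+1 <= u k + w / 2 ^+ k.+1) ->
  exists l, forall k, u k <= l <= u k + w / 2 ^+ k.
Proof.
move=> w0 H.
have mono : {homo u : i j / (i <= j)%N >-> i <= j}.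
  by apply: homo_leq => [//|x y z|k]; [exact: le_trans|have /andP[] := H k].
have H2 k j : u (k + j)%N + w / 2 ^+ (k + j) <= u k + w / 2 ^+ k.
  elim: j => [|j IH]; first by rewrite addn0.
  rewrite (le_trans _ IH) // addnS; have /andP[_ h] := H (k + j)%N.
  rewrite (le_trans (lerD h (lexx _))) // -addrA lerD2l.
  by rewrite exprS invfM; lra.
have ub k : ubound (range u) (u k + w / 2 ^+ k).
  move=> _ [j _ <-]; have [kj|jk] := leqP k j.
    rewrite -(subnKC kj) (le_trans _ (H2 k (j - k)%N)) // lerDl.
    by rewrite divr_ge0 // exprn_ge0.
  by rewrite (le_trans (mono _ _ (ltnW jk))) // lerDl divr_ge0 // exprn_ge0.
exists (sup (range u)) => k; apply/andP; split.
  apply: ub_le_sup; last by exists k.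
  by exists (u 0%N + w / 2 ^+ 0); exact: ub.
by apply: ge_sup; [exists (u 0%N), 0%N|exact: ub].
Qed.

Lemma divXS (c v : R) k : v / c ^+ k.+1 = v / c ^+ k / c.
Proof. by rewrite exprSr invfM mulrA. Qed.

Lemma archi_pow2 (c d : R) : 0 < d -> exists k, c / 2 ^+ k < d.
Proof.
move=> d0; exists (Num.bound (c / d)).
by rewrite ltr_pdivrMr ?exprn_gt0 // mulrC -ltr_pdivrMr // upper_nthrootP.
Qed.

(** Bisection by contradiction: a rectangle whose sums do not fall below [e] has a quarter whose
    sums do not fall below [e / 4]. At the limit point the affine part contributes nothing, and the
    rest is at most perimeter times diameter times the oscillation of the slope. *)
Lemma goursat G x y w h : 0 < w -> 0 < h -> (forall q, rect x y w h q -> cd G q) ->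
  rsum_limsup G x y w h 0.
Proof.
move=> w0 h0 hG e e0; apply: contrapT => bad0.
pose bad (x y w h e : R) := ~ exists m0, forall m, (m0 <= m)%N ->
  cabs (rsum m G x y w h) <= e.
pose sub (x w x' : R) := x' = x \/ x' = x + w / 2.
have step (x' y' w' h' e' : R) : bad x' y' w' h' e' -> exists s : R * R,
    [/\ sub x' w' s.1, sub y' h' s.2 & bad s.1 s.2 (w' / 2) (h' / 2) (e' / 4)].
  move=> hbad; apply: contrapT => H; apply: hbad.
  have good (s1 s2 : R) : sub x' w' s1 -> sub y' h' s2 -> exists m0, forall m, (m0 <= m)%N ->
      cabs (rsum m G s1 s2 (w' / 2) (h' / 2)) <= e' / 4.
    by move=> a1 a2; apply: contrapT => hb; apply: H; exists (s1, s2).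
  have [m1 H1] := good x' y' (or_introl erefl) (or_introl erefl).
  have [m2 H2] := good _ y' (or_intror erefl) (or_introl erefl).
  have [m3 H3] := good x' _ (or_introl erefl) (or_intror erefl).
  have [m4 H4] := good _ _ (or_intror erefl) (or_intror erefl).
  exists (maxn (maxn m1 m2) (maxn m3 m4)).+1 => -[//|m].
  rewrite ltnS !geq_max -andbA => /and4P[/H1 {}H1 /H2 {}H2 /H3 {}H3 /H4 {}H4].
  rewrite rsumS (le_trans (ler_cabsD _ _)) // (le_trans (lerD (ler_cabsD _ _) (lexx _))) //.
  rewrite (le_trans (lerD (lerD (ler_cabsD _ _) (lexx _)) (lexx _))) //.
  lra.
(* By [step] the default [s] is never reached along bad rectangles. *)
pose nxt k (s : R * R) := if pselect (exists s' : R * R,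
    [/\ sub s.1 (w / 2 ^+ k) s'.1, sub s.2 (h / 2 ^+ k) s'.2
     & bad s'.1 s'.2 (w / 2 ^+ k / 2) (h / 2 ^+ k / 2) (e / 4 ^+ k / 4)])
  is left ex then projT1 (cid ex) else s.
pose P := fix P k := if k is k'.+1 then nxt k' (P k') else (x, y).
have Pbad k : bad (P k).1 (P k).2 (w / 2 ^+ k) (h / 2 ^+ k) (e / 4 ^+ k).
  elim: k => [|k IH]; first by rewrite !expr0 !divr1 /=; move: bad0; rewrite add0r.
  rewrite /= /nxt; case: pselect => [ex|]; last by case; exact: step.
  case: (cid ex) => s' [_ _] /=.
  by rewrite !divXS.
have Psub k : sub (P k).1 (w / 2 ^+ k) (P k.+1).1 /\ sub (P k).2 (h / 2 ^+ k) (P k.+1).2.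
  rewrite /= /nxt; case: pselect => [ex|]; last by case; exact: step.
  by case: (cid ex) => s' [].
have subP (v u u' : R) k : 0 < v -> sub u (v / 2 ^+ k) u' -> u <= u' <= u + v / 2 ^+ k.+1.
  move=> v0 su; have : 0 < v / 2 ^+ k.+1 by rewrite divr_gt0 // exprn_gt0.
  case: su => -> pos; first by rewrite lexx lerDl ltW.
  by rewrite -divXS lexx lerDl ltW.
have [xs Hxs] := @nested_intervals (fun k => (P k).1) w (ltW w0)
  (fun k => subP _ _ _ _ w0 (proj1 (Psub k))).
have [ys Hys] := @nested_intervals (fun k => (P k).2) h (ltW h0)
  (fun k => subP _ _ _ _ h0 (proj2 (Psub k))).
have hp : rect x y w h (Complex xs ys).
  have := Hxs 0%N; have := Hys 0%N; rewrite /rect /= expr0 !divr1.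
  by move=> /andP[-> ->] /andP[-> ->].
have [S SE Sc] := hG _ hp; set p := Complex xs ys in hp SE Sc.
have wh : 0 < w + h by rewrite addr_gt0.
(* At level [k] the perimeter is [2 (w + h) / 2 ^+ k] and the diameter at most [(w + h) / 2 ^+ k];
   this bound on the oscillation makes the product exactly [e / 4 ^+ k]. *)
have eta0 : 0 < e / (2 * (w + h) ^+ 2) by rewrite divr_gt0 // mulr_gt0 // exprn_gt0.
have [d d0 Hd] := Sc _ eta0.
have [k hk] := archi_pow2 (w + h) d0.
apply: (Pbad k); exists 0%N => m _.
set wk := w / 2 ^+ k; set hk' := h / 2 ^+ k.
have two0 : 0 < 2 ^+ k :> R by rewrite exprn_gt0.
have wk0 : 0 <= wk by rewrite divr_ge0 // ltW.
have hk0 : 0 <= hk' by rewrite divr_ge0 // ltW.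
have -> : G = fun q => (G p + S p * (q - p)) + (S q - S p) * (q - p).
  by apply/funext => q; rewrite mulrBl -SE; ring.
rewrite bd_sumD bd_sum_affine add0r.
have := @rsum_le m (fun q => (S q - S p) * (q - p)) (P k).1 (P k).2 wk hk'
  (e / (2 * (w + h) ^+ 2) * (wk + hk')) wk0 hk0.
move=> H; rewrite (le_trans (H _)) //.
  move=> q /and4P[q1 q2 q3 q4].
  have hq : cabs (q - p) <= wk + hk'.
    rewrite (le_trans (cabs_le_ReIm _)) //.
    have /andP[a1 a2] := Hxs k; have /andP[a3 a4] := Hys k.
    rewrite raddfB raddfB /= lerD // ler_norml; apply/andP; split; rewrite /wk /hk' in q2 q4 *; lra.
  rewrite cabsM ler_pM ?cabs_ge0 //; apply/ltW/Hd/(le_lt_trans hq).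
  by rewrite /wk /hk' -mulrDl.
have -> : wk + hk' = (w + h) / 2 ^+ k by rewrite -mulrDl.
have -> : 4 ^+ k = 2 ^+ k * 2 ^+ k :> R by rewrite -exprMn -natrM.
rewrite le_eqVlt; apply/orP; left; apply/eqP; field.
by rewrite !gt_eqF.
Qed.

(** It bounds the number of dyadic subintervals of a given level that contain [p]: two for an
    interior point, one for an end. By [node_wt_split] the total does not grow under bisection, so a
    product of two weights counts the dyadic rectangles around an exceptional point. *)
Definition node_wt (x w p : R) : R :=
  if x < p < x + w then 2 else if (p == x) || (p == x + w) then 1 else 0.

Lemma node_wt_ge0 (x w p : R) : 0 <= node_wt x w p.
Proof. by rewrite /node_wt; case: ifP => // _; case: ifP. Qed.

Lemma node_wt_ge1 (x w p : R) : 0 < w -> x <= p <= x + w -> 1 <= node_wt x w p.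
Proof.
move=> w0 /andP[]; rewrite /node_wt le_eqVlt => /predU1P[->|xp].
  by rewrite ltxx eqxx.
rewrite le_eqVlt => /predU1P[->|->]; last by rewrite xp ler1n.
by rewrite ltxx andbF eqxx orbT.
Qed.

Lemma node_wt_split (x w p : R) : 0 < w ->
  node_wt x (w / 2) p + node_wt (x + w / 2) (w / 2) p <= node_wt x w p.
Proof.
move=> w0; rewrite /node_wt.
have -> : x + w / 2 + w / 2 = x + w by rewrite -addrA -splitr.
case: (ltgtP x p) => h1; case: (ltgtP p (x + w / 2)) => h2; case: (ltgtP p (x + w)) => h3 /=; lra.
Qed.

(** After [k] bisections only the rectangles that contain [p] contribute. The weights bound their
    number, and each contributes at most its perimeter [2 (w + h) / 2 ^+ k] times [K]. *)
Lemma goursat_except_bounded G p (K : R) k x y w h : 0 < w -> 0 < h -> 0 <= K ->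
  (forall q, rect x y w h q -> q != p -> cd G q) ->
  (rect x y w h p -> forall q, rect x y w h q -> cabs (G q) <= K) ->
  rsum_limsup G x y w h
    (node_wt x w (complex.Re p) * node_wt y h (complex.Im p) * (2 * K * (w + h)) / 2 ^+ k).
Proof.
move=> + + K0; elim: k x y w h => [|k IH] x y w h w0 h0 hG hK.
  have whK : 0 <= 2 * K * (w + h) by rewrite mulr_ge0 ?mulr_ge0 // addr_ge0 // ltW.
  rewrite expr0 divr1; have [pin|pout] := boolP (rect x y w h p).
    move=> e e0; exists 0%N => m _.
    rewrite (le_trans (rsum_le _ (ltW w0) (ltW h0) (hK pin))) //.
    move: pin => /and4P[p1 p2 p3 p4].
    have b1 : 1 <= node_wt x w (complex.Re p) by rewrite node_wt_ge1 // p1 p2.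
    have b2 : 1 <= node_wt y h (complex.Im p) by rewrite node_wt_ge1 // p3 p4.
    rewrite ler_wpDr ?(ltW e0) //.
    have -> : 2 * (w + h) * K = 1 * (2 * K * (w + h)) by ring.
    rewrite ler_wpM2r //.
    by have := ler_pM ler01 ler01 b1 b2; rewrite mulr1.
  apply: (@rsum_limsupW _ _ _ _ _ 0).
    by rewrite mulr_ge0 // mulr_ge0 // node_wt_ge0.
  apply: goursat => // q qin; apply: hG => //.
  by apply: contraNneq pout => <-.
have w2 : 0 < w / 2 by rewrite divr_gt0.
have h2 : 0 < h / 2 by rewrite divr_gt0.
have sub (x' y' : R) : x' = x \/ x' = x + w / 2 -> y' = y \/ y' = y + h / 2 ->
    forall q, rect x' y' (w / 2) (h / 2) q -> rect x y w h q.
  move=> [] -> [] -> q /and4P[q1 q2 q3 q4]; rewrite /rect; apply/and4P; split; lra.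
have H (x' y' : R) : x' = x \/ x' = x + w / 2 -> y' = y \/ y' = y + h / 2 -> _ :=
  fun hx hy => IH x' y' _ _ w2 h2 (fun q qin => hG q (sub _ _ hx hy q qin))
    (fun pin q qin => hK (sub _ _ hx hy p pin) q (sub _ _ hx hy q qin)).
have := rsum_limsup_quarters (H _ _ (or_introl erefl) (or_introl erefl))
  (H _ _ (or_intror erefl) (or_introl erefl)) (H _ _ (or_introl erefl) (or_intror erefl))
  (H _ _ (or_intror erefl) (or_intror erefl)).
apply: rsum_limsupW.
have := node_wt_split x (complex.Re p) w0; have := node_wt_split y (complex.Im p) h0.
have := node_wt_ge0 x (w / 2) (complex.Re p).
have := node_wt_ge0 (x + w / 2) (w / 2) (complex.Re p).
have := node_wt_ge0 y (h / 2) (complex.Im p).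
have := node_wt_ge0 (y + h / 2) (h / 2) (complex.Im p).
set a := node_wt x (w / 2) _; set b := node_wt (x + _) _ _.
set c := node_wt y (h / 2) _; set d := node_wt (y + _) _ _.
set A := node_wt x w _; set B := node_wt y h _ => d0 c0 b0 a0 h1 h3.
have -> : a * c * (2 * K * (w / 2 + h / 2)) / 2 ^+ k +
    b * c * (2 * K * (w / 2 + h / 2)) / 2 ^+ k +
    a * d * (2 * K * (w / 2 + h / 2)) / 2 ^+ k +
    b * d * (2 * K * (w / 2 + h / 2)) / 2 ^+ k =
    (a + b) * (c + d) * (2 * K * (w + h)) / 2 ^+ k.+1.
  by rewrite exprS; field; rewrite expf_eq0 pnatr_eq0 andbF.
rewrite ler_wpM2r ?invr_ge0 ?exprn_ge0 // ler_wpM2r //.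
  by rewrite mulr_ge0 ?mulr_ge0 // addr_ge0 // ltW.
by rewrite ler_pM ?addr_ge0.
Qed.

(** Two successive subdivisions: [j] cuts bring every rectangle around [p] into the region where the
    bound [K] holds, and then the number [k] of further cuts is free to grow. *)
Lemma goursat_except G p (d K : R) x y w h : 0 < d ->
  (forall q, cabs (q - p) < d -> cabs (G q) <= K) -> 0 < w -> 0 < h ->
  (forall q, rect x y w h q -> q != p -> cd G q) -> rsum_limsup G x y w h 0.
Proof.
move=> d0 hK.
have K0 : 0 <= K by rewrite (le_trans _ (hK p _)) ?cabs_ge0 // subrr cabs0.
have [j hj] := archi_pow2 (w + h) d0.
elim: j x y w h hj => [|j IH] x y w h hj w0 h0 hG.
  rewrite expr0 divr1 in hj.
  have small k := @goursat_except_bounded G p K k x y w h w0 h0 K0 hG.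
  move=> e e0; have e2 : 0 < e / 2 by rewrite divr_gt0.
  have [k hk] := archi_pow2 (node_wt x w (complex.Re p) * node_wt y h (complex.Im p) *
    (2 * K * (w + h))) e2.
  have [|m0 Hm0] := small k _ _ e2.
    move=> /and4P[p1 p2 p3 p4] q /and4P[q1 q2 q3 q4]; apply: hK.
    rewrite (le_lt_trans (cabs_le_ReIm _)) // (le_lt_trans _ hj) //.
    rewrite raddfB raddfB /= lerD // ler_norml; apply/andP; split; lra.
  exists m0 => m /Hm0/le_trans; apply; lra.
have w2 : 0 < w / 2 by rewrite divr_gt0.
have h2 : 0 < h / 2 by rewrite divr_gt0.
have hj' : (w / 2 + h / 2) / 2 ^+ j < d.
  by rewrite -mulrDl mulrAC -divXS.
have H (x' y' : R) : x' = x \/ x' = x + w / 2 -> y' = y \/ y' = y + h / 2 ->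
    rsum_limsup G x' y' (w / 2) (h / 2) 0.
  move=> hx hy; apply: IH => // q qin; apply: hG; move: qin.
  case: hx hy => [] -> [] -> /and4P[q1 q2 q3 q4]; rewrite /rect; apply/and4P; split; lra.
have := rsum_limsup_quarters (H _ _ (or_introl erefl) (or_introl erefl))
  (H _ _ (or_intror erefl) (or_introl erefl)) (H _ _ (or_introl erefl) (or_intror erefl))
  (H _ _ (or_intror erefl) (or_intror erefl)).
by rewrite !addr0.
Qed.

End DiscreteGoursat.

(** * Circle means *)

Section ComplexExponential.
Context {R : realType}.
Implicit Types (p q z w : R[i]) (x y t : R).

Definition cexp z : R[i] :=
  Complex (expR (complex.Re z) * cos (complex.Im z)) (expR (complex.Re z) * sin (complex.Im z)).

Lemma cexpD z w : cexp (z + w) = cexp z * cexp w.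
Proof.
case: z => a b; case: w => c d; rewrite /cexp /= expRD cosD sinD.
by apply/eqP; rewrite eq_complex /=; apply/andP; split; apply/eqP; ring.
Qed.

Lemma cexp0 : cexp 0 = 1.
Proof. by rewrite /cexp /= expR0 cos0 sin0 mulr1 mulr0. Qed.

Lemma cabs_cexp z : cabs (cexp z) = expR (complex.Re z).
Proof.
rewrite /cexp /= !exprMn -mulrDr cos2Dsin2 mulr1 sqrtr_sqr ger0_norm // expR_ge0.
Qed.

Lemma cexp_neq0 z : cexp z != 0.
Proof. by rewrite -cabs_gt0 cabs_cexp expR_gt0. Qed.

Lemma is_derive0_linear (f : R -> R) (D e : R) : is_derive (0 : R) (1 : R) f D -> 0 < e ->
  exists2 d : R, 0 < d & forall x, `|x| < d -> `|f x - f 0 - D * x| <= e * `|x|.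
Proof.
move=> [fd fD] e0.
have H : (fun h => h^-1 *: (f (h *: 1 + 0) - f 0)) @ 0^' --> D.
  by rewrite -fD; exact: fd.
move/cvgrPdist_le : H => /(_ _ e0); rewrite near_withinE => /nbhs_ballP[d /= d0 Hd].
exists d => // x xd; have [->|x0] := eqVneq x 0.
  by rewrite subrr mulr0 subrr normr0 mulr0.
have := Hd x; rewrite /ball /= sub0r normrN => /(_ xd x0).
rewrite addr0 /GRing.scale /= mulr1 => h.
have -> : f x - f 0 - D * x = - ((D - x^-1 * (f x - f 0)) * x).
  by field.
by rewrite normrN normrM ler_wpM2r.
Qed.

Lemma cexp0_linear (e : R) : 0 < e -> exists2 d : R, 0 < d &
  forall z, cabs z < d -> cabs (cexp z - 1 - z) <= e * cabs z.
Proof.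
(* The four error terms below add up to at most [9 * e' * r]; the bound by 1 keeps [expR a] below
   3. *)
move=> e0; pose e' := Num.min (e / 16) 1.
have e'0 : 0 < e' by rewrite lt_min ltr01 andbT divr_gt0.
have [e'1 e'2] : e' <= e / 16 /\ e' <= 1 by rewrite /e' !ge_min !lexx orbT.
clearbody e'.
have [d1 d10 H1] := is_derive0_linear (is_derive_expR 0) e'0.
have [d2 d20 H2] := is_derive0_linear (is_derive_cos 0) e'0.
have [d3 d30 H3] := is_derive0_linear (is_derive_sin 0) e'0.
exists (Num.min e' (Num.min d1 (Num.min d2 d3))); first by rewrite !lt_min e'0 d10 d20.
move=> z; rewrite !lt_min => /and4P[ze z1 z2 z3].
have := H1 _ (le_lt_trans (normr_Re z) z1); rewrite expR0 mul1r.
have := H2 _ (le_lt_trans (normr_Im z) z2); rewrite cos0 sin0 oppr0 mul0r subr0.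
have := H3 _ (le_lt_trans (normr_Im z) z3); rewrite sin0 cos0 mul1r subr0.
have := normr_Re z; have := normr_Im z.
have z0 := cabs_ge0 z.
have H0 := cabs_le_ReIm (cexp z - 1 - z).
case: z {z1 z2 z3} ze z0 H0 => a b; move: (cabs (Complex a b)) => r ze r0 /= H0 hb ha h3 h2 h1.
apply: (le_trans H0).
have -> : expR a * cos b - 1 - a = (expR a - 1 - a) + expR a * (cos b - 1) by ring.
have -> : expR a * sin b - 0 - b = expR a * (sin b - b) + (expR a - 1) * b by ring.
have ea : `|expR a - 1| <= 2 * r.
  rewrite -[expR a - 1](subrK a) (le_trans (ler_normD _ _)) //.
  have := ler_pM (ltW e'0) (normr_ge0 a) e'2 ha; lra.
have ea4 : `|expR a| <= 3.
  rewrite -[expR a](subrK 1) (le_trans (ler_normD _ _)) // normr1; lra.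
have b1 : e' * `|a| <= e' * r by rewrite ler_wpM2l // ltW.
have b2 : `|expR a * (cos b - 1)| <= 3 * (e' * r).
  by rewrite normrM ler_pM // (le_trans h2) // ler_wpM2l // ltW.
have b3 : `|expR a * (sin b - b)| <= 3 * (e' * r).
  by rewrite normrM ler_pM // (le_trans h3) // ler_wpM2l // ltW.
have b4 : `|(expR a - 1) * b| <= 2 * r * e'.
  by rewrite normrM ler_pM // (le_trans hb) // ltW.
have b5 : e' * r <= e / 16 * r by rewrite ler_wpM2r.
have er0 : 0 <= e * r by rewrite mulr_ge0 // ltW.
rewrite (le_trans (lerD (ler_normD _ _) (ler_normD _ _))) //.
lra.
Qed.

Lemma cd_cexp p : cd cexp p.
Proof.
exists (fun q => cexp p * (if q == p then 1 else (cexp (q - p) - 1) / (q - p))).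
  move=> q; rewrite -mulrA; case: eqVneq => [->|qp]; first by rewrite !subrr mulr0 mulr0.
  by rewrite divfK ?subr_eq0 // mulrBr mulr1 -cexpD [p + _]addrC subrK.
apply: ccont_atM; first exact: ccont_at_cst.
move=> e e0; have [d d0 Hd] := cexp0_linear (divr_gt0 e0 (ltr0n R 2)).
exists d => // q /Hd h; rewrite eqxx; case: eqVneq => [_|qp].
  by rewrite subrr cabs0.
have qp0 : q - p != 0 by rewrite subr_eq0.
have -> : (cexp (q - p) - 1) / (q - p) - 1 = (cexp (q - p) - 1 - (q - p)) / (q - p).
  by rewrite [RHS]mulrBl divff.
rewrite cabsM cabsV ltr_pdivrMr ?cabs_gt0 // (le_lt_trans h) //.
rewrite ltr_pM2r ?cabs_gt0 //; lra.
Qed.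

Lemma cexp_period z : cexp (z + Complex 0 (pi *+ 2)) = cexp z.
Proof. by rewrite cexpD [cexp (Complex _ _)]/cexp /= expR0 cos2pi sin2pi mulr1 mulr0 mulr1. Qed.

Lemma cos_eq1 t : - (pi *+ 2) < t -> t < pi *+ 2 -> cos t = 1 -> t = 0.
Proof.
wlog t0 : t / 0 <= t.
  move=> H t1 t2 ct; have [/H|t0] := leP 0 t; first exact.
  by apply: oppr_inj; rewrite oppr0; apply: H; rewrite ?cosN //; lra.
move=> _ t2 ct; apply/eqP; rewrite eq_le t0 andbT leNgt; apply/negP => t1.
have : 0 < sin (t / 2) by apply: sin_gt0_pi; rewrite mulr2n in t2; apply/andP; split; lra.
move: ct; have -> : cos t = cos ((t / 2) *+ 2) by congr cos; rewrite mulr2n -splitr.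
rewrite cos_mulr2n cos2sin2 => ct.
have /eqP : sin (t / 2) ^+ 2 = 0 by rewrite mulr2n in ct; lra.
by rewrite sqrf_eq0 => /eqP ->; rewrite ltxx.
Qed.

Lemma cexp_inj_strip z w : `|complex.Im z - complex.Im w| < pi *+ 2 ->
  cexp z = cexp w -> z = w.
Proof.
have im_eq : complex.Im (z - w) = complex.Im z - complex.Im w by rewrite raddfB.
rewrite -im_eq ltr_norml => /andP[h1 h2] e.
have : cexp (z - w) = 1 by rewrite -(mulfK (cexp_neq0 w) (cexp (z - w))) -cexpD subrK e divff // cexp_neq0.
move=> e1; have := congr1 (@Normc.normc R) e1; rewrite cabs_cexp cabs1 -expR0 => /expR_inj re0.
have := congr1 (@complex.Re _) e1; rewrite /cexp /= re0 expR0 mul1r.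
move=> /(cos_eq1 h1 h2); rewrite im_eq; move: re0; rewrite raddfB.
case: z w {e e1 h1 h2 im_eq} => a b [c d] /= /eqP; rewrite subr_eq0 => /eqP -> /eqP; rewrite subr_eq0 => /eqP ->.
by [].
Qed.

Lemma cexp_surj z : z != 0 ->
  exists t, [/\ 0 <= t, t < pi *+ 2 & cexp (Complex (ln (cabs z)) t) = z].
Proof.
move=> z0; have z1 : 0 < cabs z by rewrite cabs_gt0.
pose a := complex.Re z / cabs z; pose b := complex.Im z / cabs z.
have ab : a ^+ 2 + b ^+ 2 = 1.
  have := abs2E z; rewrite /abs2 => h.
  by rewrite !expr_div_n -mulrDl h divff // expf_neq0 // gt_eqF.
have a1 : -1 <= a <= 1.
  have : a ^+ 2 <= 1 by rewrite -ab lerDl sqr_ge0.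
  by rewrite -[a ^+ 2]real_normK ?num_real // expr_le1 // ler_norml.
have main t : cos t = a -> sin t = b -> cexp (Complex (ln (cabs z)) t) = z.
  move=> ct st; rewrite /cexp /= lnK ?posrE // ct st /a /b.
  have -> : cabs z * (complex.Re z / cabs z) = complex.Re z by rewrite mulrC divfK // gt_eqF.
  have -> : cabs z * (complex.Im z / cabs z) = complex.Im z by rewrite mulrC divfK // gt_eqF.
  by case: (z).
have sb : Num.sqrt (1 - a ^+ 2) = `|b| by rewrite -ab addrC addKr sqrtr_sqr.
have p0 := @pi_gt0 R; have ac0 := acos_ge0 a1; have acp := acos_lepi a1.
have [b0|b0] := leP 0 b.
  exists (acos a); split=> //; first by rewrite mulr2n; lra.
  by apply: main; rewrite ?acosK ?in_itv //= sin_acos // sb ger0_norm.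
exists (pi *+ 2 - acos a).
have ac1 : 0 < acos a.
  rewrite lt_neqAle ac0 andbT; apply/eqP => h.
  have := sin_acos a1; rewrite -h sin0 sb => /esym/eqP; rewrite normr_eq0 => /eqP bb.
  by rewrite bb ltxx in b0.
split; [rewrite mulr2n; lra|lra|].
apply: main; first by rewrite [pi *+ 2 - _]addrC cosD2pi cosN acosK ?in_itv.
by rewrite [pi *+ 2 - _]addrC sinD2pi sinN sin_acos // sb ltr0_norm // opprK.
Qed.

End ComplexExponential.

(** * Means over roots of unity *)

Section CircleMeans.
Context {R : realType}.
Implicit Types (p q z w l : R[i]) (x y t r : R) (phi g : R[i] -> R[i]).

Definition zeta N : R[i] := cexp (Complex 0 (pi *+ 2 / N%:R)).

(** The discrete form of the integral of [phi l / l] over the circle of radius [r], divided by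
    [2 pi i]. *)
Definition cmean N r phi : R[i] := N%:R^-1 * \sum_(k < N) phi (r%:C%C * zeta N ^+ k).

Lemma cexpMn z k : cexp (z *+ k) = cexp z ^+ k.
Proof. by elim: k => [|k IH]; rewrite ?mulr0n ?cexp0 // mulrS cexpD IH exprS. Qed.

Lemma cabs_zeta N : cabs (zeta N) = 1.
Proof. by rewrite cabs_cexp /= expR0. Qed.

Lemma zeta_neq0 N : zeta N != 0.
Proof. exact: cexp_neq0. Qed.

Lemma zetaX N k : zeta N ^+ k = cexp (Complex 0 (k%:R * (pi *+ 2 / N%:R))).
Proof.
rewrite -cexpMn; congr cexp; apply/eqP; rewrite eq_complex !raddfMn /= mul0rn eqxx /=.
by rewrite mulr_natl.
Qed.

Lemma zetaXN N : (0 < N)%N -> zeta N ^+ N = 1.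
Proof.
move=> N0; rewrite zetaX mulrC divfK ?pnatr_eq0 -?lt0n //.
by rewrite -[Complex _ _]add0r cexp_period cexp0.
Qed.

Lemma zetaX_neq1 N k : (0 < k < N)%N -> zeta N ^+ k != 1.
Proof.
move=> /andP[k0 kN]; have N0 : (0 < N)%N by exact: leq_ltn_trans kN.
have NR : 0 < N%:R :> R by rewrite ltr0n.
rewrite zetaX -cexp0; apply/eqP => /cexp_inj_strip; rewrite /= subr0.
have p2 : 0 < pi *+ 2 :> R by rewrite pmulrn_lgt0 // pi_gt0.
have pos : 0 < k%:R * (pi *+ 2 / N%:R) :> R by rewrite mulr_gt0 ?ltr0n // divr_gt0.
rewrite gtr0_norm // mulrA ltr_pdivrMr // mulrC ltr_pM2l // ltr_nat => /(_ kN).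
by move=> /(congr1 (@complex.Im R)) /= h; rewrite mulrCA mulrA h ltxx in pos.
Qed.

Lemma sum_zetaX N k : (0 < k < N)%N -> \sum_(i < N) zeta N ^+ (k * i) = 0.
Proof.
move=> kN; have N0 : (0 < N)%N by case/andP: kN => _; exact: leq_ltn_trans.
have /eqP := subrX1 (zeta N ^+ k) N.
rewrite -exprM mulnC exprM zetaXN // expr1n subrr eq_sym mulf_eq0 subr_eq0.
rewrite (negbTE (zetaX_neq1 kN)) /= => /eqP h.
by rewrite -[RHS]h; apply: eq_bigr => i _; rewrite exprM.
Qed.

Lemma cabs_circle N r k : 0 < r -> cabs (r%:C%C * zeta N ^+ k) = r.
Proof. by move=> r0; rewrite cabsM cabs_real cabsX cabs_zeta expr1n mulr1 gtr0_norm. Qed.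

Lemma cmean_le N r phi (B : R) : (0 < N)%N -> 0 < r ->
  (forall l, cabs l = r -> cabs (phi l) <= B) -> cabs (cmean N r phi) <= B.
Proof.
move=> N0 r0 hB; rewrite /cmean cabsM cabsV cabs_nat mulrC ler_pdivrMr ?ltr0n //.
rewrite (le_trans (ler_cabs_sum _ _ _)) // (@le_trans _ _ (\sum_(i < N) B)) //.
  by apply: ler_sum => i _; apply: hB; rewrite cabs_circle.
by rewrite sumr_const card_ord mulr_natr.
Qed.

Lemma cmeanD N r phi psi :
  cmean N r (fun l => phi l + psi l) = cmean N r phi + cmean N r psi.
Proof. by rewrite /cmean big_split mulrDr. Qed.

Lemma cmeanZ N r c phi : cmean N r (fun l => c * phi l) = c * cmean N r phi.
Proof. by rewrite /cmean -mulr_sumr mulrCA. Qed.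

Lemma cmean_sum N r (I : Type) (s : seq I) (P : pred I) (F : I -> R[i] -> R[i]) :
  cmean N r (fun l => \sum_(i <- s | P i) F i l) = \sum_(i <- s | P i) cmean N r (F i).
Proof. by rewrite /cmean exchange_big mulr_sumr. Qed.

Lemma eq_cmean N r phi psi : 0 < r -> (forall l, cabs l = r -> phi l = psi l) ->
  cmean N r phi = cmean N r psi.
Proof.
move=> r0 H; rewrite /cmean; congr (_ * _); apply: eq_bigr => i _.
by apply: H; rewrite cabs_circle.
Qed.

Lemma cmean_expV N r k : (0 < r) -> (k < N)%N ->
  cmean N r (fun l => l ^- k) = (k == 0%N)%:R.
Proof.
move=> r0 kN; have N0 : (0 < N)%N by exact: leq_ltn_trans kN.
have NR : N%:R != 0 :> R[i] by rewrite pnatr_eq0 -lt0n.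
rewrite /cmean; case: k kN => [|k] kN.
  rewrite (eq_bigr (fun=> 1)) ?sumr_const ?card_ord ?mulVf // => i _.
  by rewrite expr0 invr1.
(* Modulo [N] the exponent [- k.+1] is [N - k.+1], which lies in the range where sums over roots of
   unity vanish. *)
have NkN : (0 < N - k.+1 < N)%N by rewrite subn_gt0 kN ltn_subrL.
rewrite (eq_bigr (fun i : 'I_N => (r%:C%C ^- k.+1) * zeta N ^+ ((N - k.+1) * i))).
  by rewrite -mulr_sumr sum_zetaX // !mulr0.
move=> i _; rewrite exprMn invfM; congr (_ * _).
apply: (@mulfI _ ((zeta N ^+ i) ^+ k.+1)); first by rewrite !expf_neq0 // zeta_neq0.
rewrite divff; last by rewrite !expf_neq0 // zeta_neq0.
rewrite -exprM mulnC -exprD -mulnDl subnKC; last exact: ltnW.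
by rewrite exprM zetaXN // expr1n.
Qed.

(** In the logarithmic coordinate the annulus becomes a rectangle of height [2 pi]: circle means are
    Riemann sums over its vertical sides, and the horizontal sides agree by periodicity. Goursat's
    theorem then compares the two radii; [l0] is the possible exceptional point. *)
Lemma cmean_radius phi l0 (r1 r2 d K : R) : 0 < r1 -> r1 < r2 -> 0 < d ->
  (l0 != 0 -> forall l, cabs (l - l0) < d -> cabs (phi l) <= K) ->
  (forall l, r1 <= cabs l <= r2 -> l != l0 -> cd phi l) ->
  forall e : R, 0 < e -> exists m0, forall m, (m0 <= m)%N ->
    cabs (cmean (2 ^ m) r2 phi - cmean (2 ^ m) r1 phi) <= e.
Proof.
move=> r10 r12 d0 hK hcd.
have r20 : 0 < r2 by exact: lt_trans r12.
pose G q := phi (cexp q).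
set x := ln r1; set w := ln r2 - ln r1.
have w0 : 0 < w by rewrite subr_gt0 ltr_ln ?posrE.
have pi0 := @pi_gt0 R.
have Gcd q : x <= complex.Re q <= x + w -> cexp q != l0 -> cd G q.
  move=> /andP[h1 h2] qn; apply: cd_comp; first exact: cd_cexp.
  apply: hcd => //; rewrite cabs_cexp.
  have E1 : expR x = r1 by rewrite lnK ?posrE.
  have E2 : expR (x + w) = r2 by rewrite /x /w addrC subrK lnK ?posrE.
  by rewrite -E1 -E2 !ler_expR h1.
(* The rectangle is cut into two of height [pi]: each contains at most one logarithm of [l0],
   whereas the whole may contain two, on its bottom and top sides. *)
have half (y : R) : y = 0 \/ y = pi -> rsum_limsup G x y w pi 0.
  move=> hy; have [p hp] : exists p, forall q, rect x y w pi q -> q != p ->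
      cexp q != l0.
    have [l00|/cexp_surj[t [t0 t2 tE]]] := eqVneq l0 0.
      by exists 0 => q _ _; rewrite l00 cexp_neq0.
    pose p t' := Complex (ln (cabs l0)) t'.
    have pE q t' : cexp (p t') = l0 -> `|complex.Im q - t'| < pi *+ 2 -> q != p t' -> cexp q != l0.
      move=> e hq; apply: contra_neq => e'; apply: cexp_inj_strip => //.
      by rewrite e'.
    rewrite mulr2n in t2 pE.
    have [t00|tn0] := eqVneq t 0; last first.
      have t00 : 0 < t by rewrite lt_neqAle eq_sym tn0.
      exists (p t) => q /and4P[_ _ q1 q2]; apply: pE => //.
      by rewrite ltr_norml; case: hy q1 q2 => ->; rewrite ?add0r => q1 q2; apply/andP; split; lra.
    case: hy => ->.
      exists (p t) => q /and4P[_ _ q1 q2]; apply: pE => //.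
      by rewrite ltr_norml t00; rewrite add0r in q2; apply/andP; split; lra.
    (* If [l0] has argument 0, its logarithm in the upper half lies on the top side. *)
    exists (p (pi + pi)) => q /and4P[_ _ q1 q2]; apply: pE => //.
      rewrite -tE -[RHS]cexp_period t00 mulr2n; congr cexp.
      by apply/eqP; rewrite eq_complex /= addr0 add0r !eqxx.
    by rewrite ltr_norml; apply/andP; split; lra.
  have [pl|pl] := eqVneq (cexp p) l0.
    have l00 : l0 != 0 by rewrite -pl cexp_neq0.
    have [d' d'0 Hd'] := cd_cont (cd_cexp p) d0.
    apply: (@goursat_except _ G p d' K) => //.
      by move=> q /Hd'; rewrite pl; exact: hK.
    move=> q /[dup] /hp h /and4P[q1 q2 _ _] qp; apply: Gcd; rewrite ?q1 // h //.
  apply: goursat => // q /[dup] /hp h /and4P[q1 q2 _ _].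
  apply: Gcd; first by rewrite q1.
  by have [->//|/h] := eqVneq q p.
have meanE r m : 0 < r -> seg_sum m.+1 G (Complex (ln r) 0) (Complex 0 (pi *+ 2)) =
    Complex 0 (pi *+ 2) * cmean (2 ^ m.+1) r phi.
  move=> r0; rewrite /seg_sum /cmean mulrA; congr (_ * _); apply: eq_bigr => k _.
  congr phi; rewrite zetaX cexpD; congr (_ * _).
    by rewrite /cexp /= lnK ?posrE // cos0 sin0 mulr1 mulr0.
  congr cexp.
  have -> : k%:R / (2 ^ m.+1)%:R = (k%:R / (2 ^ m.+1)%:R : R)%:C%C :> R[i].
    by rewrite rmorphM fmorphV !rmorph_nat.
  by apply/eqP; rewrite eq_complex /= !mul0r !mulr0 subr0 addr0 eqxx /=; apply/eqP; ring.
have per m : seg_sum m G (Complex x (pi + pi)) (Complex w 0) = seg_sum m G (Complex x 0) (Complex w 0).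
  rewrite /seg_sum; congr (_ * _); apply: eq_bigr => k _; rewrite /G -[in RHS]cexp_period.
  congr (phi (cexp _)); rewrite [RHS]addrAC; congr (_ + _).
  by rewrite -[RHS]/(Complex _ _) addr0 add0r [in RHS]mulr2n.
have A1 (u v s : R) : Complex u v + Complex s 0 = Complex (u + s) v.
  by rewrite -[LHS]/(Complex _ _) addr0.
have A2 (u v s : R) : Complex u v + Complex 0 s = Complex u (v + s).
  by rewrite -[LHS]/(Complex _ _) addr0.
have half2 : Complex 0 (pi *+ 2) / 2 = Complex 0 pi :> R[i].
  have -> : 2^-1 = Complex 2^-1 0 :> R[i].
    by rewrite -[RHS]/((2^-1)%:C%C) fmorphV rmorph_nat.
  by apply/eqP; rewrite eq_complex /= mulr2n !mul0r mulr0 subr0 add0r eqxx /=; apply/eqP; field.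
have key m : bd_sum m G (Complex x 0) (Complex w 0) (Complex 0 pi) +
    bd_sum m G (Complex x pi) (Complex w 0) (Complex 0 pi) =
    Complex 0 (pi *+ 2) * (cmean (2 ^ m.+1) r2 phi - cmean (2 ^ m.+1) r1 phi).
  rewrite mulrBr -!meanE // !seg_sumS half2 /bd_sum !A1 !A2 !add0r per.
  have -> : x + w = ln r2 by rewrite /w addrC subrK.
  by rewrite /x; ring.
move=> e e0.
have [m1 H1] := half 0 (or_introl erefl) _ e0.
have [m2 H2] := half pi (or_intror erefl) _ e0.
exists (maxn m1 m2).+1 => -[//|m]; rewrite ltnS geq_max => /andP[/H1 {}H1 /H2 {}H2].
have : cabs (Complex 0 (pi *+ 2) * (cmean (2 ^ m.+1) r2 phi - cmean (2 ^ m.+1) r1 phi)) <= 2 * e.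
  by rewrite -key (le_trans (ler_cabsD _ _)) //; lra.
have -> : Complex 0 (pi *+ 2) = (pi *+ 2)%:C%C * 'i%C :> R[i].
  by apply/eqP; rewrite eq_complex /= !mul0r !mulr0 subr0 addr0 mulr1 !eqxx.
have P2 : pi *+ 2 = pi + pi :> R by rewrite [LHS]mulr2n.
rewrite !cabsM cabs_real cabs_i mulr1 P2 gtr0_norm; last exact: addr_gt0.
have := @pi_ge2 R; have := cabs_ge0 (cmean (2 ^ m.+1) r2 phi - cmean (2 ^ m.+1) r1 phi).
move: (cabs _) => c c0 p2 h.
have : c * (2 + 2) <= c * (pi + pi) by rewrite ler_wpM2l // lerD.
lra.
Qed.

End CircleMeans.

(** * Taylor series *)

Section Diagonal.
Context {R : realType}.

Definition ccvg (u : nat -> R[i]) (l : R[i]) :=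
  forall e : R, 0 < e -> exists N, forall i, (N <= i)%N -> cabs (u i - l) < e.

Lemma increasing_seq_ge (f : nat -> nat) i : increasing_seq f -> (i <= f i)%N.
Proof.
move=> fi; elim: i => [//|i IH]; rewrite (leq_ltn_trans IH) //.
by move/increasing_seqP : fi => /(_ i).
Qed.

Lemma increasing_seq_lt (f : nat -> nat) i j : increasing_seq f -> (i < j)%N -> (f i < f j)%N.
Proof.
move=> fi ij; have -> : (f i < f j)%N = ~~ (f j <= f i)%O by rewrite ltnNge.
by rewrite fi -ltnNge.
Qed.

Lemma cvgn_ex (u : nat -> R) : cvgn u -> exists l, forall e : R, 0 < e ->
  exists N, forall i, (N <= i)%N -> `|u i - l| < e.
Proof.
move=> /cvg_ex[l /cvgrPdist_lt ul]; exists l => e /ul[N _ HN]; exists N => i Ni.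
by rewrite distrC; exact: HN.
Qed.

Lemma bolzano_weierstrass_complex (u : nat -> R[i]) (B : R) :
  (forall i, cabs (u i) <= B) ->
  exists2 f : nat -> nat, increasing_seq f & exists l, ccvg (u \o f) l.
Proof.
move=> uB.
have bnd (v : nat -> R) : (forall i, `|v i| <= B) -> bounded_fun v.
  move=> vB; exists B; split; first exact: num_real.
  by move=> M BM i _ /=; rewrite (le_trans (vB i)) // ltW.
have [f fi /cvgn_ex[a Ha]] := bolzano_weierstrass (bnd (fun i => complex.Re (u i))
  (fun i => le_trans (normr_Re _) (uB i))).
have [g gi /cvgn_ex[b Hb]] := bolzano_weierstrass (bnd (fun i => complex.Im (u (f i)))
  (fun i => le_trans (normr_Im _) (uB (f i)))).
exists (f \o g).
  by move=> i j /=; rewrite fi; exact: gi.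
exists (Complex a b) => e e0; have e2 : 0 < e / 2 by rewrite divr_gt0.
have [N1 H1] := Ha _ e2; have [N2 H2] := Hb _ e2.
exists (maxn N1 N2) => i; rewrite geq_max => /andP[i1 i2].
rewrite (le_lt_trans (cabs_le_ReIm _)) // !raddfB /= (splitr e) ltrD //.
  by apply: H1; rewrite (leq_trans i1) // increasing_seq_ge.
exact: H2.
Qed.

(** Cantor's diagonal: [F k] composes the extractions made for the first [k] coordinates, and from
    index [k.+1] on, the values [F i i] lie in the range of [F k.+1], at indices at least [i]. *)
Lemma diagonal_extraction (u : nat -> nat -> R[i]) (B : nat -> R) :
  (forall i k, cabs (u i k) <= B k) ->
  exists phi : nat -> nat, (forall i, (phi i < phi i.+1)%N) /\
    exists l : nat -> R[i], forall k, ccvg (fun i => u (phi i) k) (l k).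
Proof.
move=> uB.
have step (F : nat -> nat) k : exists g : nat -> nat,
    increasing_seq g /\ exists l, ccvg (fun i => u (F (g i)) k) l.
  have [g gi gl] := @bolzano_weierstrass_complex (fun i => u (F i) k) (B k) (fun i => uB _ _).
  by exists g.
pose G F k := projT1 (cid (step F k)).
have GP F k : increasing_seq (G F k) /\ exists l, ccvg (fun i => u (F (G F k i)) k) l.
  by rewrite /G; case: cid.
pose F := fix F k : nat -> nat := if k is k'.+1 then fun i => F k' (G (F k') k' i) else id.
have Gmono k i j : (i < j)%N -> (G (F k) k i < G (F k) k j)%N.
  by have [Gi _] := GP (F k) k; exact: increasing_seq_lt.
have Fmono k i j : (i < j)%N -> (F k i < F k j)%N.
  elim: k i j => [//|k IH] i j ij /=; exact/IH/Gmono.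
exists (fun i => F i i); split.
  move=> i /=; apply: Fmono; rewrite (leq_trans (ltnSn i)) //.
  by apply: increasing_seq_ge; have [] := GP (F i) i.
exists (fun k => projT1 (cid (GP (F k) k).2)) => k; case: cid => l /= Hl e e0.
have [N HN] := Hl e e0; exists (maxn N k.+1) => i; rewrite geq_max => /andP[Ni ki].
have [h [hi ->]] : exists h, (i <= h)%N /\ F i i = F k.+1 h.
  have H j a : exists h, (a <= h)%N /\ F (k.+1 + j)%N a = F k.+1 h.
    elim: j a => [|j IH] a; first by exists a; rewrite addn0.
    rewrite addnS /=; have [h [ah hE]] := IH (G (F (k.+1 + j)%N) (k.+1 + j)%N a).
    exists h; split; last exact: hE.
    rewrite (leq_trans _ ah) //.
    by apply: increasing_seq_ge; have [] := GP (F (k.+1 + j)%N) (k.+1 + j)%N.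
  by have := H (i - k.+1)%N i; rewrite subnKC.
by apply: HN; exact: leq_trans hi.
Qed.

Lemma ccvg_le (u : nat -> R[i]) l (B : R) : (forall i, cabs (u i) <= B) -> ccvg u l ->
  cabs l <= B.
Proof.
move=> uB ul; apply/ler_addgt0Pr => e /ul[N /(_ N (leqnn N))]; rewrite cabsB => /ltW h.
by rewrite -(subrK (u N) l) addrC (le_trans (ler_cabsD _ _)) // lerD.
Qed.

Lemma ccvgD u v l l' : ccvg u l -> ccvg v l' -> ccvg (fun i => u i + v i) (l + l').
Proof.
move=> ul vl e e0; have e2 : 0 < e / 2 by rewrite divr_gt0.
have [N1 H1] := ul _ e2; have [N2 H2] := vl _ e2.
exists (maxn N1 N2) => i; rewrite geq_max => /andP[/H1 h1 /H2 h2].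
by rewrite opprD addrACA (le_lt_trans (ler_cabsD _ _)) // (splitr e) ltrD.
Qed.

Lemma ccvg_cst l : ccvg (fun=> l) l.
Proof. by move=> e e0; exists 0%N => i _; rewrite subrr cabs0. Qed.

Lemma ccvgZ u l c : ccvg u l -> ccvg (fun i => c * u i) (c * l).
Proof.
move=> ul e e0; have c0 : 0 < cabs c + 1 by rewrite ltr_wpDl // cabs_ge0.
have [N HN] := ul _ (divr_gt0 e0 c0); exists N => i /HN.
rewrite ltr_pdivlMr // mulrC -mulrBr cabsM; apply: le_lt_trans.
by rewrite ler_wpM2r ?cabs_ge0 // lerDl.
Qed.

Lemma ccvg_sum (I : Type) (s : seq I) (P : pred I) (F : I -> nat -> R[i]) (l : I -> R[i]) :
  (forall i, ccvg (F i) (l i)) ->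
  ccvg (fun k => \sum_(i <- s | P i) F i k) (\sum_(i <- s | P i) l i).
Proof.
move=> H; elim: s => [|i s IH].
  rewrite big_nil; under [fun k => _]eq_fun do rewrite big_nil; exact: ccvg_cst.
rewrite big_cons; under [fun k => _]eq_fun do rewrite big_cons.
by case: (P i) => //; exact: ccvgD.
Qed.

End Diagonal.

(** * Taylor series in one variable *)

Section Taylor1.
Context {R : realType}.
Implicit Types (g : R[i] -> R[i]) (l z : R[i]) (r rho B : R).

(** Cauchy's formula with [g l0] subtracted. Because of the factor [l], the function tends to 0 at
    the origin, so its mean over a small circle is small; [cmean_radius] carries this to radius
    [r]. *)
Lemma cauchy_mean g r rho l0 : 0 < r -> r < rho ->
  (forall l, cabs l < rho -> cd g l) -> cabs l0 < r ->
  forall e : R, 0 < e -> exists m0, forall m, (m0 <= m)%N ->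
    cabs (cmean (2 ^ m) r (fun l => l * ((g l - g l0) / (l - l0)))) <= e.
Proof.
move=> r0 rrho hg l0r e e0; set phi := fun l => _.
have e2 : 0 < e / 2 by rewrite divr_gt0.
have cd0 l : cabs l < rho -> l != l0 -> cd phi l.
  by move=> hl ll0; apply: cdM; [exact: cd_id|apply: cd_slope => //; exact: hg].
have rho0 : 0 < rho by exact: lt_trans rrho.
have [d d0 Hd] : exists2 d : R, 0 < d & forall l, l != 0 -> cabs l < d -> cabs (phi l) <= e / 2.
  have [l00|l00] := eqVneq l0 0.
    have [d d0 Hd] := cd_cont (hg 0 ltac:(by rewrite cabs0)) e2.
    exists d => // l ln0 ld; rewrite /phi l00 subr0 mulrCA divff // mulr1.
    by apply/ltW/Hd; rewrite subr0.
  have [d d0 Hd] := cd_cont (cd0 0 ltac:(by rewrite cabs0) ltac:(by rewrite eq_sym)) e2.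
  exists d => // l _ ld; have := Hd l; rewrite subr0 => /(_ ld).
  by rewrite {2}/phi mul0r subr0 => /ltW.
pose r1 := Num.min (d / 2) (r / 2).
have r10 : 0 < r1 by rewrite lt_min !divr_gt0.
have r1d : r1 < d by rewrite gt_min; apply/orP; left; lra.
have r1r : r1 < r by rewrite gt_min; apply/orP; right; lra.
have [d' d'0 [K HK]] := cd_slope_bounded (hg l0 (lt_trans l0r rrho)).
have [||m0 Hm0] := @cmean_radius _ phi l0 r1 r d' ((cabs l0 + d') * `|K|) r10 r1r d'0 _ _ _ e2.
- move=> _ l hl; rewrite /phi cabsM ler_pM ?cabs_ge0 //.
    by rewrite -(subrK l0 l) addrC (le_trans (ler_cabsD _ _)) // lerD2l ltW.
  by rewrite (le_trans (HK _ hl)) // ler_norm.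
- by move=> l /andP[_ lr] ll0; apply: cd0 => //; exact: le_lt_trans rrho.
exists m0 => m /Hm0 h.
rewrite -(subrK (cmean (2 ^ m) r1 phi) (cmean (2 ^ m) r phi)) (le_trans (ler_cabsD _ _)) //.
rewrite (splitr e) lerD //; apply: cmean_le => //; first by rewrite expn_gt0.
by move=> l lr; apply: Hd; rewrite ?lr // -cabs_gt0 lr.
Qed.

Lemma geometric_kernel l l0 K : l != 0 -> l != l0 ->
  l / (l - l0) = \sum_(k < K) (l0 / l) ^+ k + (l0 / l) ^+ K * (l / (l - l0)).
Proof.
move=> ln0 ll0; have d0 : l - l0 != 0 by rewrite subr_eq0.
set S := \sum_(k < K) _.
have e1 : 1 - (l0 / l) ^+ K = (l - l0) / l * S.
  by rewrite -opprB subrX1 -mulNr opprB; congr (_ * _); field.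
have {1}-> : S = (1 - (l0 / l) ^+ K) * (l / (l - l0)).
  by rewrite e1; field; rewrite d0.
by rewrite mulrBl mul1r subrK.
Qed.

(** The coefficients are limits, along one common subsequence, of discrete Cauchy integrals.
    Compactness thus replaces a proof that these integrals converge. *)
Lemma taylor1 g r rho B : 0 < r -> r < rho ->
  (forall l, cabs l < rho -> cd g l) -> (forall l, cabs l <= r -> cabs (g l) <= B) ->
  exists A : nat -> R[i], (forall k, cabs (A k) <= B / r ^+ k) /\
    forall l0, cabs l0 < r -> forall K,
      cabs (\sum_(k < K) A k * l0 ^+ k - g l0) <=
        2 * B * (cabs l0 / r) ^+ K * (r / (r - cabs l0)).
Proof.
move=> r0 rrho hg gB.
pose u i k := cmean (2 ^ i) r (fun l => g l * l ^- k).
have B0 : 0 <= B by rewrite (le_trans _ (gB 0 _)) ?cabs_ge0 // cabs0 ltW.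
have uB i k : cabs (u i k) <= B / r ^+ k.
  apply: cmean_le => //; first by rewrite expn_gt0.
  move=> l lr; rewrite cabsM cabsV cabsX lr ler_wpM2r //.
    by rewrite invr_ge0 exprn_ge0 // ltW.
  by rewrite gB // lr.
have [phi [phimono [A HA]]] := diagonal_extraction uB.
have phige i : (i <= phi i)%N by elim: i => [//|i IH]; rewrite (leq_ltn_trans IH).
exists A; split; first by move=> k; exact: ccvg_le (HA k).
move=> l0 l0r K.
have rl0 : 0 < r - cabs l0 by rewrite subr_gt0.
(* The term [- g l0] comes from the constant term of the kernel, which is missing for [K = 0]; there
   the bound on [g l0] alone suffices. *)
case: K => [|K].
  rewrite big_ord0 sub0r cabsN expr0 mulr1 (le_trans (gB _ (ltW l0r))) //.
  rewrite -[leLHS]mulr1 ler_pM //; first by rewrite ler_peMl // ler1n.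
  by rewrite ler_pdivlMr // mul1r lerBlDr lerDl cabs_ge0.
apply/ler_addgt0Pr => e e0; have e2 : 0 < e / 2 by rewrite divr_gt0.
have [m0 Hm0] := cauchy_mean r0 rrho hg l0r e2.
have [N HN] := @ccvg_sum R _ (index_enum 'I_K.+1) xpredT (fun k i => l0 ^+ k * u (phi i) k)
  (fun k => l0 ^+ k * A k) (fun k => ccvgZ _ (HA k)) _ e2.
pose i := maxn (maxn N m0) K.+1; pose m := phi i.
(* Means of [l ^- k] are computed exactly only for [k] below the number of nodes. *)
have mK : (K.+1 <= 2 ^ m)%N.
  by rewrite (leq_trans _ (ltnW (ltn_expl m (leqnn 2)))) // (leq_trans _ (phige i)) // leq_maxr.
have {}Hm0 := Hm0 m ltac:(by rewrite (leq_trans _ (phige i)) // /i -maxnA maxnCA leq_maxl).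
have {}HN := HN i ltac:(by rewrite /i -maxnA leq_maxl).
pose E l := (g l - g l0) * ((l0 / l) ^+ K.+1 * (l / (l - l0))).
have meanE : cmean (2 ^ m) r (fun l => l * ((g l - g l0) / (l - l0))) =
    \sum_(k < K.+1) l0 ^+ k * u m k - g l0 + cmean (2 ^ m) r E.
  rewrite (@eq_cmean _ _ _ _ (fun l => (\sum_(k < K.+1) l0 ^+ k * (g l * l ^- k) +
    - g l0 * \sum_(k < K.+1) l0 ^+ k * l ^- k) + E l)) //.
    rewrite !cmeanD cmeanZ !cmean_sum; congr (_ + _ + _).
      by apply: eq_bigr => k _; rewrite cmeanZ.
    rewrite mulNr (eq_bigr (fun k : 'I_K.+1 => l0 ^+ k * (k == 0%N :> nat)%:R)); last first.
      by move=> k _; rewrite cmeanZ cmean_expV // (leq_trans (ltn_ord k)).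
    rewrite big_ord_recl /= mulr1 expr0 big1 ?addr0 ?mulr1 // => k _.
    by rewrite mulr0.
  move=> l lr.
  have ln0 : l != 0 by rewrite -cabs_gt0 lr.
  have ll0 : l != l0 by apply: contraTneq l0r => <-; rewrite lr ltxx.
  rewrite mulrCA (geometric_kernel K.+1 ln0 ll0) /E mulrDr; congr (_ + _).
  have -> : \sum_(k < K.+1) l0 ^+ k * (g l * l ^- k) = g l * \sum_(k < K.+1) l0 ^+ k * l ^- k.
    by rewrite mulr_sumr; apply: eq_bigr => k _; rewrite mulrCA.
  rewrite -mulrDl; congr (_ * _).
  by apply: eq_bigr => k _; rewrite exprMn exprVn.
have Ele : cabs (cmean (2 ^ m) r E) <= 2 * B * (cabs l0 / r) ^+ K.+1 * (r / (r - cabs l0)).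
  apply: cmean_le => //; first by rewrite expn_gt0.
  move=> l lr; rewrite /E !cabsM cabsX !cabsM !cabsV lr mulrA ler_pM //.
  - by rewrite mulr_ge0 ?cabs_ge0 // exprn_ge0 // divr_ge0 ?cabs_ge0 // ltW.
  - by rewrite divr_ge0 ?cabs_ge0 // ltW.
  - rewrite ler_wpM2r //; first by rewrite exprn_ge0 // divr_ge0 ?cabs_ge0 // ltW.
    rewrite (le_trans (ler_cabsB _ _)) //.
    by rewrite -[2]/(1 + 1) mulrDl mul1r lerD // gB // ?lr // ltW.
  - rewrite ler_wpM2l ?(ltW r0) // lef_pV2 ?posrE //.
      by rewrite (le_trans _ (ler_cabs_sub _ _)) // lr.
    by rewrite (lt_le_trans rl0) // (le_trans _ (ler_cabs_sub _ _)) // lr.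
have -> : \sum_(k < K.+1) A k * l0 ^+ k - g l0 =
    - (\sum_(k < K.+1) l0 ^+ k * u m k - \sum_(k < K.+1) l0 ^+ k * A k) +
    (cmean (2 ^ m) r (fun l => l * ((g l - g l0) / (l - l0))) - cmean (2 ^ m) r E).
  rewrite meanE; under eq_bigr do rewrite mulrC.
  by ring.
rewrite (le_trans (ler_cabsD _ _)) // cabsN (le_trans (lerD (lexx _) (ler_cabsB _ _))) //.
by rewrite (le_trans (lerD (ltW HN) (lerD Hm0 Ele))) // addrA -splitr addrC.
Qed.

End Taylor1.

(** * Geometric decay, and the truncated Cauchy kernel *)

Section GeometricDecay.
Context {R : realType}.

(** Each of the [N] terms of [\sum_(k < N) q ^+ k] is at least [q ^+ N]. *)
Lemma natr_geometric_le (q : R) N : 0 <= q -> q < 1 -> N%:R * q ^+ N <= (1 - q)^-1.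
Proof.
move=> q0 q1; have d0 : 0 < 1 - q by rewrite subr_gt0.
rewrite -[leRHS]mul1r ler_pdivlMr // (@le_trans _ _ ((\sum_(k < N) q ^+ k) * (1 - q))) //.
  rewrite ler_wpM2r ?(ltW d0) // -[N in N%:R]card_ord -sumr_const mulr_suml.
  apply: ler_sum => k _; rewrite mul1r.
  by rewrite ler_wiXn2l ?(ltW q1) // ltnW.
by rewrite mulrC -opprB mulNr -subrX1 opprB gerBl exprn_ge0.
Qed.

(** With [s] the square root of [q], one factor [s ^+ N] absorbs one power of [N] and the other goes
    into the induction. *)
Lemma exprn_geometric_bounded (q : R) a : 0 <= q -> q < 1 ->
  exists C, forall N, N%:R ^+ a * q ^+ N <= C.
Proof.
elim: a q => [|a IH] q q0 q1.
  by exists 1 => N; rewrite expr0 mul1r exprn_ile1 // ltW.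
pose s := Num.sqrt q.
have s0 : 0 <= s by exact: sqrtr_ge0.
have s1 : s < 1 by rewrite -sqrtr1 ltr_sqrt.
have [C HC] := IH s s0 s1; exists ((1 - s)^-1 * C) => N.
have -> : q ^+ N = s ^+ N * s ^+ N by rewrite -exprMn -expr2 sqr_sqrtr.
rewrite exprS mulrACA ler_pM ?mulr_ge0 ?exprn_ge0 //.
exact: natr_geometric_le.
Qed.

Lemma geometric_small (q C e : R) : 0 <= q -> q < 1 -> 0 < e -> exists N0, forall N,
  (N0 <= N)%N -> C * q ^+ N < e.
Proof.
move=> q0 q1 e0.
have /cvgrPdist_lt/(_ _ e0)[N0 _ H] : C * q ^+ n @[n --> \oo] --> (0 : R).
  by rewrite -(mulr0 C); apply: cvgMl_tmp; apply: cvg_expr; rewrite ger0_norm.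
exists N0 => N /H; rewrite sub0r normrN; exact: le_lt_trans (ler_norm _).
Qed.

Lemma exprn_geometric_small (q C e : R) a : 0 <= q -> q < 1 -> 0 < e ->
  exists N0, forall N, (N0 <= N)%N -> C * (N%:R ^+ a * q ^+ N) < e.
Proof.
move=> q0 q1 e0; pose s := Num.sqrt q.
have s0 : 0 <= s by exact: sqrtr_ge0.
have s1 : s < 1 by rewrite -sqrtr1 ltr_sqrt.
have [D HD] := exprn_geometric_bounded a s0 s1.
have [N0 H] := geometric_small (`|C| * D) s0 s1 e0; exists N0 => N /H; apply: le_lt_trans.
have -> : q ^+ N = s ^+ N * s ^+ N by rewrite -exprMn -expr2 sqr_sqrtr.
rewrite mulrA mulrA ler_wpM2r ?exprn_ge0 // -mulrA.
rewrite (le_trans (ler_norm _)) // normrM ler_wpM2l // ger0_norm //.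
by rewrite mulr_ge0 ?exprn_ge0.
Qed.

Lemma cmean_exp N (r : R) k : (k < N)%N -> cmean N r (fun l => l ^+ k) = (k == 0%N)%:R.
Proof.
move=> kN; have N0 : (0 < N)%N by exact: leq_ltn_trans kN.
have NR : N%:R != 0 :> R[i] by rewrite pnatr_eq0 -lt0n.
rewrite /cmean; case: k kN => [|k] kN.
  by rewrite (eq_bigr (fun=> 1)) ?sumr_const ?card_ord ?mulVf.
rewrite (eq_bigr (fun i : 'I_N => (r%:C%C ^+ k.+1) * zeta N ^+ (k.+1 * i))).
  by rewrite -mulr_sumr sum_zetaX // !mulr0.
by move=> i _; rewrite exprMn -exprM mulnC.
Qed.

Lemma cmean_exp_expV N (r : R) k j : 0 < r -> (k < N)%N -> (j < N)%N ->
  cmean N r (fun l => l ^+ k * l ^- j) = (k == j)%:R.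
Proof.
move=> r0 kN jN; have [kj|jlek] := ltnP k j.
  rewrite (@eq_cmean _ _ _ _ (fun l => l ^- (j - k))) ?cmean_expV //.
  - by rewrite subn_eq0 leqNgt kj ltn_eqF.
  - by rewrite (leq_ltn_trans _ jN) // leq_subr.
  move=> l lr; have l0 : l != 0 by rewrite -cabs_gt0 lr.
  by rewrite -{1}(subnK (ltnW kj)) exprD invfM mulrCA divff ?mulr1 // expf_neq0.
rewrite (@eq_cmean _ _ _ _ (fun l => l ^+ (k - j))) ?cmean_exp //.
- by rewrite subn_eq0 eqn_leq jlek andbT.
- by rewrite (leq_ltn_trans _ kN) // leq_subr.
move=> l lr; have l0 : l != 0 by rewrite -cabs_gt0 lr.
by rewrite -{1}(subnK jlek) exprD mulfK // expf_neq0.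
Qed.

Lemma cmean_kernel_exp N (r : R) (t : R[i]) k : 0 < r -> (k < N)%N ->
  cmean N r (fun l => l ^+ k * \sum_(j < N) (t / l) ^+ j) = t ^+ k.
Proof.
move=> r0 kN.
rewrite (@eq_cmean _ _ _ _ (fun l => \sum_(j < N) t ^+ j * (l ^+ k * l ^- j))) //; last first.
  move=> l _; rewrite mulr_sumr; apply: eq_bigr => j _.
  by rewrite exprMn exprVn mulrCA.
rewrite cmean_sum (bigD1 (Ordinal kN)) //= big1 ?addr0 => [|j jk].
  by rewrite cmeanZ cmean_exp_expV // eqxx mulr1.
rewrite cmeanZ cmean_exp_expV //; case: eqP => [e|]; last by rewrite mulr0.
by move: jk; rewrite -val_eqE /= -e eqxx.
Qed.

(** The truncated kernel reproduces polynomials of degree below [N] exactly; applied to the Taylor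
    polynomial of [g] it leaves only the remainder, multiplied by at most [N]. The error is explicit
    in [N] and needs no subsequence, which allows iteration over the coordinates. *)
Lemma cmean_kernel g (r rho B s : R) N t : 0 < s -> s < 1 -> 0 < r -> r < rho ->
  (forall l, cabs l < rho -> cd g l) -> (forall l, cabs l <= r -> cabs (g l) <= B) ->
  (0 < N)%N -> cabs t <= s * r ->
  cabs (cmean N (s * r) (fun l => g l * \sum_(k < N) (t / l) ^+ k) - g t) <=
    (N%:R + 1) * (2 * B * s ^+ N * (1 - s)^-1).
Proof.
move=> s0 s1 r0 rrho hg gB N0 tr.
have [A [_ HA]] := taylor1 r0 rrho hg gB.
have B0 : 0 <= B by rewrite (le_trans _ (gB 0 _)) ?cabs_ge0 // cabs0 ltW.
have sr0 : 0 < s * r by rewrite mulr_gt0.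
pose P l := \sum_(k < N) A k * l ^+ k.
set eps := 2 * B * s ^+ N * (1 - s)^-1.
have s10 : 0 < 1 - s by rewrite subr_gt0.
have close l : cabs l <= s * r -> cabs (P l - g l) <= eps.
  move=> lr; have lr' : cabs l < r by rewrite (le_lt_trans lr) // gtr_pMl.
  have d0 : 0 < r - cabs l by rewrite subr_gt0.
  have lr0 : 0 <= cabs l / r by rewrite divr_ge0 ?cabs_ge0 // ltW.
  have lrs : (cabs l / r) ^+ N <= s ^+ N.
    by rewrite lerXn2r ?nnegrE ?(ltW s0) // ler_pdivrMr.
  rewrite (le_trans (HA l lr' N)) // /eps ler_pM //.
  - by rewrite !mulr_ge0 // exprn_ge0.
  - by rewrite divr_ge0 // ltW.
  - by rewrite ler_wpM2l // mulr_ge0.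
  rewrite ler_pdivrMr // mulrC ler_pdivlMr //; nra.
have -> : cmean N (s * r) (fun l => g l * \sum_(k < N) (t / l) ^+ k) - g t =
    cmean N (s * r) (fun l => (g l - P l) * \sum_(k < N) (t / l) ^+ k) + (P t - g t).
  have <- : cmean N (s * r) (fun l => P l * \sum_(k < N) (t / l) ^+ k) = P t.
    rewrite (@eq_cmean _ _ _ _ (fun l => \sum_(k < N) A k * (l ^+ k * \sum_(k < N) (t / l) ^+ k))) //.
      by rewrite cmean_sum; apply: eq_bigr => k _; rewrite cmeanZ cmean_kernel_exp.
    by move=> l _; rewrite mulr_suml; apply: eq_bigr => k _; rewrite mulrA.
  rewrite addrA -cmeanD; congr (_ - _); apply: eq_cmean => // l _.
  by rewrite mulrBl subrK.
rewrite (le_trans (ler_cabsD _ _)) // mulrDl mul1r lerD ?close //.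
apply: cmean_le => // l lr; rewrite cabsM mulrC ler_pM ?cabs_ge0 //.
  rewrite (le_trans (ler_cabs_sum _ _ _)) // -[X in _ <= X%:R]card_ord -sumr_const.
  apply: ler_sum => k _; rewrite cabsX exprn_ile1 ?cabs_ge0 // cabsM cabsV lr.
  by rewrite ler_pdivrMr // mul1r.
by rewrite cabsB close // lr.
Qed.

End GeometricDecay.

(** * Multi-indices and sums over boxes *)

Section MultiIndex.
Context {R : realType} {n : nat}.

Definition mindex := {ffun 'I_n -> nat}.
Implicit Types (a b : mindex) (z w : cpt R n).

Definition mdeg a := (\sum_i a i)%N.
Definition mpow z a : R[i] := \prod_i z i ^+ a i.
(** Truncation by a cube and not by degree: sums over a cube factor into one-variable sums, as do
    means over tori. *)
Definition box N : seq mindex :=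
  [seq [ffun i => val (b i)] | b : {ffun 'I_n -> 'I_N} <- enum {: {ffun 'I_n -> 'I_N}}].

Lemma mem_box N a : (a \in box N) = [forall i, (a i < N)%N].
Proof.
apply/mapP/forallP => [[b _ ->] i|H]; first by rewrite ffunE ltn_ord.
exists [ffun i => Ordinal (H i)]; first by rewrite mem_enum.
by apply/ffunP => i; rewrite !ffunE.
Qed.

Lemma box_uniq N : uniq (box N).
Proof.
rewrite map_inj_uniq ?enum_uniq // => b c /ffunP H; apply/ffunP => i.
by apply: val_inj; have := H i; rewrite !ffunE.
Qed.

Lemma sum_box (V : nmodType) N (F : mindex -> V) : \sum_(a <- box N) F a =
  \sum_(b : {ffun 'I_n -> 'I_N}) F [ffun i => val (b i)].
Proof. by rewrite big_map big_enum. Qed.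

Lemma sum_box_le (V : nmodType) K N (F : mindex -> V) : (K <= N)%N ->
  \sum_(a <- box N | a \in box K) F a = \sum_(a <- box K) F a.
Proof.
move=> KN; rewrite -big_filter; apply: perm_big.
apply: uniq_perm; rewrite ?filter_uniq ?box_uniq // => a.
rewrite mem_filter; case: (boolP (a \in box K)) => //= /[!mem_box] /forallP H.
by apply/forallP => i; exact: leq_trans KN.
Qed.

Lemma sum_box_geometric N (q : R) :
  \sum_(a <- box N) q ^+ mdeg a = (\sum_(k < N) q ^+ k) ^+ n.
Proof.
rewrite sum_box -[X in _ ^+ X]card_ord -prodr_const bigA_distr_bigA /=.
apply: eq_bigr => b _; rewrite /mdeg -prodrXr; apply: eq_bigr => i _; by rewrite ffunE.
Qed.

(** The sum of [q ^+ mdeg a] over all multi-indices outside [box K]. *)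
Definition gtail (q : R) K := (1 - q) ^- n * (1 - (1 - q ^+ K) ^+ n).

Lemma sum_box_tail (c : mindex -> R[i]) (C q : R) K N : 0 <= q -> q < 1 -> 0 <= C ->
  (forall a, cabs (c a) <= C * q ^+ mdeg a) -> (K <= N)%N ->
  cabs (\sum_(a <- box N) c a - \sum_(a <- box K) c a) <= C * gtail q K.
Proof.
move=> q0 q1 C0 hc KN; have d0 : 0 < 1 - q by rewrite subr_gt0.
rewrite -(sum_box_le c KN) (bigID (fun a => a \in box K)) /= addrAC subrr add0r.
rewrite (le_trans (ler_cabs_sum _ _ _)) //.
rewrite (le_trans (ler_sum _ (fun a _ => hc a))) // -mulr_sumr ler_wpM2l //.
have -> : \sum_(a <- box N | a \notin box K) q ^+ mdeg a =
    (\sum_(k < N) q ^+ k) ^+ n - (\sum_(k < K) q ^+ k) ^+ n.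
  rewrite -!sum_box_geometric -(sum_box_le _ KN).
  by rewrite [in RHS](bigID (fun a => a \in box K)) /= addrAC subrr add0r.
have geo m : \sum_(k < m) q ^+ k = (1 - q ^+ m) / (1 - q).
  apply: (mulIf (lt0r_neq0 d0)); rewrite divfK ?lt0r_neq0 //.
  by rewrite -opprB mulrN mulrC -subrX1 opprB.
rewrite /gtail mulrBr mulr1 !geo lerB //.
  rewrite -exprVn lerXn2r ?nnegrE ?mulr_ge0 ?invr_ge0 ?(ltW d0) ?subr_ge0 ?exprn_ile1 ?(ltW q1) //.
  by rewrite ler_piMl ?invr_ge0 ?(ltW d0) // gerBl exprn_ge0.
by rewrite expr_div_n mulrC.
Qed.

Lemma gtail_small (q C e : R) : 0 <= q -> q < 1 -> 0 < e -> exists K0, forall K,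
  (K0 <= K)%N -> C * gtail q K < e.
Proof.
move=> q0 q1 e0.
have [K0 H] := geometric_small (`|C| * (1 - q) ^- n * n%:R) q0 q1 e0.
exists K0 => K /H; apply: le_lt_trans; rewrite /gtail.
have d0 : 0 <= (1 - q) ^- n by rewrite invr_ge0 exprn_ge0 // subr_ge0 ltW.
have b1 : 1 - (1 - q ^+ K) ^+ n <= n%:R * q ^+ K.
  have x1 : q ^+ K <= 1 by rewrite exprn_ile1 // ltW.
  have x0 : 0 <= q ^+ K by rewrite exprn_ge0.
  elim: n {d0 H} => [|m IH]; first by rewrite expr0 subrr mul0r.
  have y0 : 0 <= (1 - q ^+ K) ^+ m by rewrite exprn_ge0 // subr_ge0.
  have y1 : (1 - q ^+ K) ^+ m <= 1 by rewrite exprn_ile1 ?subr_ge0 // gerBl.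
  have xy : q ^+ K * (1 - q ^+ K) ^+ m <= q ^+ K by rewrite ler_piMr.
  by rewrite exprS mulrBl mul1r -natr1; lra.
have b0 : 0 <= 1 - (1 - q ^+ K) ^+ n.
  by rewrite subr_ge0 exprn_ile1 // ?subr_ge0 ?gerBl ?exprn_ge0 // exprn_ile1 // ltW.
rewrite -!mulrA (le_trans (ler_norm _)) // normrM ler_wpM2l // ger0_norm ?mulr_ge0 //.
by rewrite ler_wpM2l.
Qed.

End MultiIndex.
Arguments mindex : clear implicits.

(** * Taylor series in several variables *)

Section TaylorN.
Context {R : realType} {n : nat}.
Implicit Types (a b : mindex n) (z w t : cpt R n) (f : cpt R n -> R[i]) (rho : 'I_n -> R).

Definition upd z (j : 'I_n) (u : R[i]) : cpt R n := fun i => if i == j then u else z i.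

Definition torus N rho (l : {ffun 'I_n -> 'I_N}) : cpt R n :=
  fun i => (rho i)%:C%C * zeta N ^+ l i.

(** The discrete Cauchy integral for a Taylor coefficient; by [torus_coef_mpow] it is exact on
    monomials with exponents below [N]. *)
Definition torus_coef N rho f a : R[i] :=
  (N ^ n)%:R^-1 * \sum_(l : {ffun 'I_n -> 'I_N}) f (torus rho l) / mpow (torus rho l) a.

(** Exchanging [k] with [l j] is an involution of the pairs [(l, k)]; after it the summand no longer
    depends on the second component. *)
Lemma sum_ffun_update (V : nmodType) N (j : 'I_n) (G : {ffun 'I_n -> 'I_N} -> V) :
  \sum_(l : {ffun 'I_n -> 'I_N}) \sum_(k < N) G [ffun i => if i == j then k else l i] = (\sum_(l : {ffun 'I_n -> 'I_N}) G l) *+ N.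
Proof.
pose h (p : {ffun 'I_n -> 'I_N} * 'I_N) :=
  ([ffun i => if i == j then p.2 else p.1 i], p.1 j).
have hK : involutive h.
  move=> [l k]; rewrite /h /=; congr (_, _); last by rewrite ffunE eqxx.
  by apply/ffunP => i; rewrite !ffunE; case: eqP => // ->.
rewrite pair_big /= (reindex_inj (inv_inj hK)) /=.
rewrite (eq_bigr (fun p => G p.1)).
  rewrite -(pair_big xpredT xpredT (fun l k => G l)) /= -sumrMnl.
  by apply: eq_bigr => l _; rewrite sumr_const card_ord.
move=> [l k] _ /=; congr G; apply/ffunP => i; rewrite !ffunE /=.
by case: eqP => // ->.
Qed.

Lemma cabs_torus N rho (l : {ffun 'I_n -> 'I_N}) i : 0 < rho i ->
  cabs (torus rho l i) = rho i.
Proof. exact: cabs_circle. Qed.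

Let dir N (x : R[i]) : R[i] := \sum_(k < N) x ^+ k.

Let mix j t N rho (l : {ffun 'I_n -> 'I_N}) : cpt R n :=
  fun i => if (i < j)%N then torus rho l i else t i.

(** It interpolates between [f t] at [j = 0] and the discrete Taylor polynomial at [j = n]: the
    coordinates below [j] are replaced by their discrete Cauchy integrals. *)
Let hyb N rho f t j : R[i] := (N ^ n)%:R^-1 * \sum_(l : {ffun 'I_n -> 'I_N})
  f (mix j t rho l) * \prod_(i < n | (i < j)%N) dir N (t i / torus rho l i).

(** Passing one more coordinate to its Cauchy mean costs the error of [cmean_kernel], multiplied by
    the kernels of the earlier coordinates, which together are at most [N ^+ n]. *)
Lemma hybrid_step N rho (s : R) (rad rad2 : 'I_n -> R) f B t (j : 'I_n) : (0 < N)%N ->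
  0 < s -> s < 1 -> (forall i, 0 < rad i) -> (forall i, rad i < rad2 i) ->
  (forall i, rho i = s * rad i) ->
  (forall z, (forall i, cabs (z i) <= rad i) -> cabs (f z) <= B) ->
  (forall z, (forall i, cabs (z i) <= rad i) -> forall j u, cabs u < rad2 j ->
     cd (fun u => f (upd z j u)) u) ->
  (forall i, cabs (t i) <= rho i) ->
  cabs (hyb N rho f t j.+1 - hyb N rho f t j) <=
    N%:R ^+ n * ((N%:R + 1) * (2 * B * s ^+ N * (1 - s)^-1)).
Proof.
move=> N0 s0 s1 rad0 radlt rhoE fB fcd trho.
have NR : N%:R != 0 :> R[i] by rewrite pnatr_eq0 -lt0n.
have rho0 i : 0 < rho i by rewrite rhoE mulr_gt0.
have rhorad i : rho i <= rad i by rewrite rhoE ger_pMl // ltW.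
have mixle j' l i : cabs (mix j' t rho (N := N) l i) <= rad i.
  rewrite /mix; case: ifP => _; first by rewrite cabs_torus.
  exact: le_trans (trho i) _.
set eps := (N%:R + 1) * _.
pose g l u := f (upd (mix j t rho (N := N) l) j u).
pose D (l : {ffun 'I_n -> 'I_N}) := \prod_(i < n | (i < j)%N) dir N (t i / torus rho l i).
have stepE : hyb N rho f t j.+1 - hyb N rho f t j = (N ^ n)%:R^-1 * \sum_l
    (D l * (cmean N (s * rad j) (fun u => g l u * \sum_(k < N) (t j / u) ^+ k) - g l (t j))).
  rewrite -mulrBr; congr (_ * _).
  under [RHS]eq_bigr do rewrite mulrBr; rewrite sumrB; congr (_ - _); last first.
    apply: eq_bigr => l _; rewrite mulrC; congr (_ * f _); apply/funext => i.
    by rewrite /upd /mix; case: eqP => // ->; rewrite ltnn.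
  apply: (mulIf NR); rewrite mulr_natr -(sum_ffun_update j) mulr_suml.
  apply: eq_bigr => l _; rewrite -mulrA /cmean mulrAC mulVf // mul1r mulr_sumr.
  apply: eq_bigr => k _; rewrite -rhoE (bigD1 j) //= mulrA mulrAC mulrCA mulrA.
  congr (_ * _); last by rewrite /torus ffunE eqxx.
  congr (_ * _).
    rewrite /g; congr f; apply/funext => i; rewrite /upd /mix ltnS leq_eqVlt.
    have -> : (i == j :> nat) = (i == j) by [].
    by rewrite /torus ffunE; case: eqP => [->|].
  rewrite /D; apply: eq_big => [i|i].
    by rewrite ltnS andbC ltn_neqAle.
  by move=> /andP[_ ij]; rewrite /torus ffunE (negbTE ij).
rewrite stepE cabsM cabsV cabs_nat mulrC ler_pdivrMr ?ltr0n ?expn_gt0 ?N0 //.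
rewrite (le_trans (ler_cabs_sum _ _ _)) //.
rewrite (@le_trans _ _ (\sum_(l : {ffun 'I_n -> 'I_N}) N%:R ^+ n * eps)) //; last first.
  by rewrite sumr_const card_ffun !card_ord mulr_natr.
apply: ler_sum => l _; rewrite cabsM ler_pM ?cabs_ge0 //.
  rewrite cabs_prod (@le_trans _ _ (\prod_(i < n | (i < j)%N) N%:R)) //.
    apply: ler_prod => i _; rewrite cabs_ge0 /=.
    rewrite (le_trans (ler_cabs_sum _ _ _)) // -[X in _ <= X%:R]card_ord -sumr_const.
    apply: ler_sum => k _; rewrite cabsX exprn_ile1 ?cabs_ge0 // cabsM cabsV cabs_torus //.
    by rewrite ler_pdivrMr // mul1r.
  rewrite prodr_const ler_weXn2l ?ler1n //.
  by rewrite (leq_trans (max_card _)) // card_ord.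
apply: (cmean_kernel s0 s1 (rad0 j) (radlt j)) => //.
- by move=> u uj; apply: fcd.
- move=> u uj; apply: fB => i; rewrite /upd; case: eqP => [->//|_]; exact: mixle.
- by rewrite -rhoE.
Qed.

Lemma hybrid0 N rho f t : (0 < N)%N -> hyb N rho f t 0 = f t.
Proof.
move=> N0; rewrite /hyb (eq_bigr (fun=> f t)).
  rewrite sumr_const card_ffun !card_ord -[f t *+ _]mulr_natl mulrA mulVf ?mul1r //.
  by rewrite pnatr_eq0 -lt0n expn_gt0 N0.
by move=> l _; rewrite big_pred0 // mulr1.
Qed.

Lemma hybridn N rho f t : hyb N rho f t n = \sum_(a <- box N) torus_coef N rho f a * mpow t a.
Proof.
rewrite /hyb /torus_coef sum_box.
under [RHS]eq_bigr do rewrite -mulrA mulr_suml.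
rewrite -mulr_sumr exchange_big; congr (_ * _); apply: eq_bigr => l _ /=.
have -> : mix n t rho l = torus rho l by apply/funext => i; rewrite /mix ltn_ord.
have -> : \prod_(i < n | (i < n)%N) dir N (t i / torus rho l i) =
    \prod_(i < n) dir N (t i / torus rho l i) by apply: eq_bigl => i; rewrite ltn_ord.
rewrite /dir bigA_distr_bigA mulr_sumr; apply: eq_bigr => b _ /=.
rewrite -mulrA; congr (_ * _); rewrite /mpow -prodfV -big_split /=.
by apply: eq_bigr => i _; rewrite ffunE exprMn exprVn mulrC.
Qed.

(** The coefficients are limit points of [torus_coef], taken for all multi-indices at once through
    [pickle]. The [n] hybrid steps lose a power of [N], which [s ^+ N] beats. *)
Lemma taylorn rho (s : R) (rad rad2 : 'I_n -> R) f B :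
  0 < s -> s < 1 -> (forall i, 0 < rad i) -> (forall i, rad i < rad2 i) ->
  (forall i, rho i = s * rad i) ->
  (forall z, (forall i, cabs (z i) <= rad i) -> cabs (f z) <= B) ->
  (forall z, (forall i, cabs (z i) <= rad i) -> forall j u, cabs u < rad2 j ->
     cd (fun u => f (upd z j u)) u) ->
  exists A : mindex n -> R[i], (forall a, cabs (A a) <= B / \prod_i rho i ^+ a i) /\
    forall z (y : R), y < 1 -> 0 <= y -> (forall i, cabs (z i) <= y * rho i) ->
      forall K, cabs (\sum_(a <- box K) A a * mpow z a - f z) <= B * gtail (n := n) y K.
Proof.
move=> s0 s1 rad0 radlt rhoE fB fcd.
have rho0 i : 0 < rho i by rewrite rhoE mulr_gt0.
have rhorad i : rho i <= rad i by rewrite rhoE ger_pMl // ltW.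
have prho0 a : 0 < \prod_i rho i ^+ a i by apply: prodr_gt0 => i _; rewrite exprn_gt0.
have B0 : 0 <= B.
  rewrite (le_trans _ (fB (fun=> 0) _)) ?cabs_ge0 // => i; rewrite cabs0.
  exact: ltW.
have coefB N a : (0 < N)%N -> cabs (torus_coef N rho f a) <= B / \prod_i rho i ^+ a i.
  move=> N0; rewrite /torus_coef cabsM cabsV cabs_nat mulrC ler_pdivrMr ?ltr0n ?expn_gt0 ?N0 //.
  rewrite (le_trans (ler_cabs_sum _ _ _)) //.
  rewrite (@le_trans _ _ (\sum_(l : {ffun 'I_n -> 'I_N}) (B / \prod_i rho i ^+ a i))) //.
    apply: ler_sum => l _; rewrite cabsM cabsV /mpow cabs_prod.
    under eq_bigr do rewrite cabsX cabs_torus //.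
    rewrite ler_wpM2r ?invr_ge0 ?(ltW (prho0 a)) //; apply: fB => i.
    by rewrite cabs_torus.
  by rewrite sumr_const card_ffun !card_ord mulr_natr.
pose u i k := if unpickle k is Some a then torus_coef i.+1 rho f a else 0.
pose bd k := if unpickle k is Some a then B / \prod_i rho i ^+ (a : mindex n) i else 0.
have [phi [phimono [L HL]]] : exists phi : nat -> nat, (forall i, (phi i < phi i.+1)%N) /\
    exists l : nat -> R[i], forall k, ccvg (fun i => u (phi i) k) (l k).
  apply: (@diagonal_extraction _ u bd) => i k; rewrite /u /bd.
  by case: unpickle => [a|]; [exact: coefB|rewrite cabs0].
have phige i : (i <= phi i)%N by elim: i => [//|i IH]; rewrite (leq_ltn_trans IH).
pose A a := L (pickle a).
have HA a : ccvg (fun i => torus_coef (phi i).+1 rho f a) (A a).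
  by have := HL (pickle a); rewrite /u pickleK.
exists A; split; first by move=> a; apply: ccvg_le (HA a) => i; exact: coefB.
move=> z y y1 y0 zy K.
have zrho i : cabs (z i) <= rho i by rewrite (le_trans (zy i)) // ler_piMl ?(ltW (rho0 i)) // ltW.
have powz a : cabs (mpow z a) / \prod_i rho i ^+ a i <= y ^+ mdeg a.
  rewrite /mpow cabs_prod /mdeg -prodrXr ler_pdivrMr // -big_split /=.
  apply: ler_prod => i _; rewrite cabs_ge0 /= cabsX -exprMn lerXn2r ?nnegrE ?cabs_ge0 //.
  by rewrite mulr_ge0 // ltW.
apply/ler_addgt0Pr => e e0; have e2 : 0 < e / 2 by rewrite divr_gt0.
have [N1 HN1] := @ccvg_sum R _ (box K) xpredT
  (fun a i => mpow z a * torus_coef (phi i).+1 rho f a) (fun a => mpow z a * A a)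
  (fun a => ccvgZ (mpow z a) (HA a)) _ e2.
(* The powers of 2 only serve to bound [N ^+ n * (N + 1)] by [(2 * N) ^+ n.+1]. *)
have [N2 HN2] := @exprn_geometric_small R s (n%:R * 2 ^+ n * 2 * (2 * B * (1 - s)^-1)) _
  n.+1 (ltW s0) s1 e2.
pose i := maxn (maxn N1 N2) K; pose N := (phi i).+1.
have iN : (i <= N)%N by rewrite (leq_trans (phige i)) // leqW.
have {}HN1 := HN1 i ltac:(by rewrite /i -maxnA leq_maxl).
have {}HN2 := HN2 N ltac:(by rewrite (leq_trans _ iN) // /i -maxnA maxnCA leq_maxl).
have KN : (K <= N)%N by rewrite (leq_trans _ iN) // leq_maxr.
have tailN : cabs (\sum_(a <- box N) torus_coef N rho f a * mpow z a -
    \sum_(a <- box K) torus_coef N rho f a * mpow z a) <= B * gtail (n := n) y K.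
  apply: sum_box_tail => // a; rewrite cabsM.
  apply: (@le_trans _ _ (B / \prod_i rho i ^+ a i * cabs (mpow z a))).
    by rewrite ler_wpM2r ?cabs_ge0 // coefB.
  by rewrite mulrAC -mulrA ler_wpM2l.
have close : cabs (\sum_(a <- box N) torus_coef N rho f a * mpow z a - f z) <= e / 2.
  rewrite -hybridn -(@hybrid0 N rho f z) //.
  pose eps := N%:R ^+ n * ((N%:R + 1) * (2 * B * s ^+ N * (1 - s)^-1)).
  have H j : (j <= n)%N -> cabs (hyb N rho f z j - hyb N rho f z 0) <= j%:R * eps.
    elim: j => [|j IH] jn; first by rewrite subrr cabs0 mul0r.
    rewrite (le_trans (ler_cabs_dist (hyb N rho f z j) _ _)) // -natr1 mulrDl addrC lerD ?IH ?mul1r //.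
      exact: ltnW.
    exact: (@hybrid_step N rho s rad rad2 f B z (Ordinal jn)).
  rewrite (le_trans (H n (leqnn n))) // (le_trans _ (ltW HN2)) //.
  rewrite /eps.
  have -> : n%:R * 2 ^+ n * 2 * (2 * B * (1 - s)^-1) * (N%:R ^+ n.+1 * s ^+ N) =
     n%:R * ((2 * N%:R) ^+ n * ((2 * N%:R) * (2 * B * s ^+ N * (1 - s)^-1))) :> R.
    by rewrite exprMn exprS; ring.
  have c0 : 0 <= 2 * B * s ^+ N * (1 - s)^-1.
    by rewrite !mulr_ge0 ?exprn_ge0 ?invr_ge0 ?subr_ge0 ?(ltW s0) ?(ltW s1).
  have N2N : N%:R <= 2 * N%:R :> R by rewrite ler_peMl // ler1n.
  rewrite ler_wpM2l // ler_pM ?exprn_ge0 //.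
  - by rewrite mulr_ge0 // addr_ge0.
  - by rewrite lerXn2r ?nnegrE // mulr_ge0.
  - by rewrite ler_wpM2r // mulr_natl mulr2n lerD2l ler1n.
have -> : \sum_(a <- box K) A a * mpow z a - f z =
   - (\sum_(a <- box K) mpow z a * torus_coef N rho f a - \sum_(a <- box K) mpow z a * A a)
   - (\sum_(a <- box N) torus_coef N rho f a * mpow z a -
      \sum_(a <- box K) torus_coef N rho f a * mpow z a)
   + (\sum_(a <- box N) torus_coef N rho f a * mpow z a - f z).
  under [X in - (X - _)]eq_bigr do rewrite mulrC.
  under [X in - (_ - X)]eq_bigr do rewrite mulrC.
  ring.
rewrite (le_trans (ler_cabsD _ _)) // (le_trans (lerD (ler_cabsB _ _) (lexx _))) // cabsN.
by have := ltW HN1; move: tailN close => /=; rewrite -/N; lra.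
Qed.

End TaylorN.

(** * Power series of holomorphic functions on the ball *)

Section PowerSeriesOnBall.
Context {R : realType} {n : nat}.
Implicit Types (a b : mindex n) (z w : cpt R n) (f : cpt R n -> R[i]) (rho : 'I_n -> R).

Definition psum (c : mindex n -> R[i]) K z : R[i] := \sum_(a <- box K) c a * mpow z a.

Lemma normsqE z : normsq z = \sum_(i < n) cabs (z i) ^+ 2.
Proof. by apply: eq_bigr => i _; rewrite abs2E. Qed.

Lemma cabs_le_normsq z i : cabs (z i) ^+ 2 <= normsq z.
Proof.
rewrite normsqE (bigD1 i) //= lerDl; apply: sumr_ge0 => j _; exact: sqr_ge0.
Qed.

Lemma normsq_le_sum z rho : (forall i, cabs (z i) <= rho i) ->
  normsq z <= \sum_(i < n) rho i ^+ 2.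
Proof.
move=> H; rewrite normsqE; apply: ler_sum => i _.
by rewrite lerXn2r ?nnegrE ?cabs_ge0 // (le_trans _ (H i)) // cabs_ge0.
Qed.

Lemma torus_coef_mpow N rho a b : (forall i, 0 < rho i) -> a \in box N -> b \in box N ->
  torus_coef N rho (fun z => mpow z b) a = (a == b)%:R.
Proof.
rewrite !mem_box => rho0 /forallP aN /forallP bN.
rewrite /torus_coef -[n in (N ^ n)%N]card_ord.
have -> : (N ^ #|'I_n|)%:R^-1 = \prod_(i < n) (N%:R^-1) :> R[i].
  by rewrite prodr_const natrX exprVn.
have -> : \sum_(l : {ffun 'I_n -> 'I_N}) mpow (torus rho l) b / mpow (torus rho l) a =
    \prod_(i < n) \sum_(k < N) ((rho i)%:C%C * zeta N ^+ k) ^+ b i * ((rho i)%:C%C * zeta N ^+ k) ^- a i.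
  rewrite bigA_distr_bigA /=; apply: eq_bigr => l _.
  by rewrite /mpow -prodfV -big_split.
rewrite -big_split /= (eq_bigr (fun i => (b i == a i)%:R)); last first.
  by move=> i _; rewrite -(cmean_exp_expV (rho0 i) (bN i) (aN i)).
have [->|ab] := eqVneq a b; first by rewrite big1 // => i _; rewrite eqxx.
have [i ai] : exists i, a i != b i.
  apply/existsP; apply: contraNT ab => /existsPn H; apply/eqP/ffunP => i.
  by have := H i; rewrite negbK => /eqP.
by rewrite (bigD1 i) //= eq_sym (negbTE ai) mul0r.
Qed.

Lemma torus_coef_le N rho f a (B : R) : (0 < N)%N -> (forall i, 0 < rho i) ->
  (forall z, (forall i, cabs (z i) = rho i) -> cabs (f z) <= B) ->
  cabs (torus_coef N rho f a) <= B / \prod_i rho i ^+ a i.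
Proof.
move=> N0 rho0 fB.
have prho0 : 0 < \prod_i rho i ^+ a i by apply: prodr_gt0 => i _; rewrite exprn_gt0.
rewrite /torus_coef cabsM cabsV cabs_nat mulrC ler_pdivrMr ?ltr0n ?expn_gt0 ?N0 //.
rewrite (le_trans (ler_cabs_sum _ _ _)) //.
rewrite (@le_trans _ _ (\sum_(l : {ffun 'I_n -> 'I_N}) (B / \prod_i rho i ^+ a i))) //.
  apply: ler_sum => l _; rewrite cabsM cabsV /mpow cabs_prod.
  under eq_bigr do rewrite cabsX cabs_torus //.
  rewrite ler_wpM2r ?invr_ge0 ?(ltW prho0) //; apply: fB => i.
  by rewrite cabs_torus.
by rewrite sumr_const card_ffun !card_ord mulr_natr.
Qed.

Lemma torus_coef_psum N rho c a : (forall i, 0 < rho i) -> a \in box N ->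
  torus_coef N rho (psum c N) a = c a.
Proof.
move=> rho0 aN.
have -> : torus_coef N rho (psum c N) a =
    \sum_(b <- box N) c b * torus_coef N rho (fun z => mpow z b) a.
  rewrite /torus_coef /psum; under [RHS]eq_bigr do rewrite mulrCA mulr_sumr.
  rewrite -mulr_sumr exchange_big; congr (_ * _); apply: eq_bigr => l _ /=.
  by rewrite mulr_suml; apply: eq_bigr => b _; rewrite mulrA.
rewrite (bigD1_seq a) ?box_uniq //= torus_coef_mpow // eqxx mulr1.
rewrite big1_seq ?addr0 // => b /andP[ba bN].
by rewrite torus_coef_mpow // eq_sym (negbTE ba) mulr0.
Qed.

Lemma mindex_in_box a : exists N0, forall N, (N0 <= N)%N -> (0 < N)%N -> a \in box N.
Proof.
exists (\max_i a i).+1 => N aN _; rewrite mem_box; apply/forallP => i.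
by rewrite (leq_trans _ aN) // ltnS leq_bigmax.
Qed.

(** For large [N] the discrete coefficient recovers [c a] exactly from the partial sum, and it is
    bounded by the supremum of that sum on the torus, which tends to 0. *)
Lemma power_series_unique rho (c : mindex n -> R[i]) (C : R) :
  (forall i, 0 < rho i) -> (forall z, (forall i, cabs (z i) = rho i) ->
  forall K, cabs (psum c K z) <= C * gtail (n := n) 2^-1 K) -> forall a, c a = 0.
Proof.
move=> rho0 H a; apply/eqP; rewrite -cabs_eq0 eq_le cabs_ge0 andbT.
apply/ler_addgt0Pr => e e0; rewrite add0r.
have prho0 : 0 < \prod_i rho i ^+ a i by apply: prodr_gt0 => i _; rewrite exprn_gt0.
have [N0 HN0] := mindex_in_box a.
have [N1 HN1] := @gtail_small R n 2^-1 (C / \prod_i rho i ^+ a i) e ltac:(by rewrite invr_ge0)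
  ltac:(by rewrite invf_lt1 // ltr1n) e0.
pose N := (maxn N0 N1).+1.
have aN : a \in box N by apply: HN0 => //; rewrite leqW // leq_maxl.
rewrite -(torus_coef_psum c rho0 aN).
rewrite (le_trans (@torus_coef_le N rho (psum c N) a _ _ rho0 (fun z hz => H z hz N))) //.
by rewrite mulrAC ltW // HN1 // leqW // leq_maxr.
Qed.

Lemma holoB_cd f z (j : 'I_n) : holoB f -> inB z -> cd (fun u => f (upd z j u)) (z j).
Proof. by move=> [_ H] zB; apply/cdiffE; exact: H. Qed.

Lemma holoB_cd_upd f z (j : 'I_n) u : holoB f -> inB (upd z j u) ->
  cd (fun u => f (upd z j u)) u.
Proof.
move=> hf uB; have := @holoB_cd f _ j hf uB; rewrite [X in cd _ X]/upd eqxx.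
congr (cd _ _); apply/funext => v; congr f; apply/funext => i.
by rewrite /upd; case: eqP.
Qed.

(** Continuity is given pointwise only, so compactness is needed: points with [|f|] unbounded would
    accumulate at a point of the ball and contradict continuity there. *)
Lemma holoB_bounded f rad : holoB f -> (forall i, 0 <= rad i) -> \sum_(i < n) rad i ^+ 2 < 1 ->
  exists B, forall z, (forall i, cabs (z i) <= rad i) -> cabs (f z) <= B.
Proof.
move=> [fc _] rad0 rad1; apply: contrapT => /forallNP unb.
have /choice[zs Hz] : forall k : nat, exists z, (forall i, cabs (z i) <= rad i) /\ k%:R < cabs (f z).
  move=> k; have /existsNP[z /not_implyP[hz]] := unb k%:R.
  by move=> /negP; rewrite -ltNge => h; exists z.
pose u k j := if insub j is Some i then zs k i else 0.
pose bd j := if insub j is Some i then rad i else 0.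
have [|phi [phimono [l Hl]]] := @diagonal_extraction _ u bd.
  by move=> k j; rewrite /u /bd; case: insubP => [i _ _|_]; [exact: (Hz k).1|rewrite cabs0].
have phige i : (i <= phi i)%N by elim: i => [//|i IH]; rewrite (leq_ltn_trans IH).
pose w : cpt R n := fun i => l i.
have Hw i : ccvg (fun k => zs (phi k) i) (w i) by have := Hl i; rewrite /u valK.
have wB : inB w.
  rewrite /inB (le_lt_trans _ rad1) //; apply: normsq_le_sum => i.
  by apply: ccvg_le (Hw i) => k; exact: (Hz _).1.
have [d [d0 Hd]] := fc w wB 1 ltr01.
have /choice[N HN] : forall i : 'I_n, exists N, forall k, (N <= k)%N ->
    cabs (zs (phi k) i - w i) ^+ 2 < d / n.+1%:R.
  move=> i; have dn : 0 < d / n.+1%:R by rewrite divr_gt0.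
  have [N HN] := Hw i _ (ltac:(by rewrite sqrtr_gt0) : 0 < Num.sqrt (d / n.+1%:R)).
  exists N => k /HN h; rewrite -[ltRHS]sqr_sqrtr ?(ltW dn) // ltrXn2r ?nnegrE ?cabs_ge0 //.
have [M HM] : exists M : nat, cabs (f w) + 1 < M%:R.
  by exists (Num.bound (cabs (f w) + 1)); apply: archi_boundP; rewrite addr_ge0 ?cabs_ge0.
pose k := maxn M (\max_i N i).
have dk : dist2 (zs (phi k)) w < d.
  rewrite /dist2 normsqE (@le_lt_trans _ _ (\sum_(i < n) d / n.+1%:R)) //.
    apply: ler_sum => i _; apply/ltW/HN; rewrite /k leq_max; apply/orP; right.
    exact: leq_bigmax.
  rewrite sumr_const card_ord -[X in X < _]mulr_natr mulrAC ltr_pdivrMr // ltr_pM2l //.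
  by rewrite ltr_nat.
have := Hd _ dk; rewrite -[X in _ < X](expr1n _ 2) abs2_lt // => h.
have [_ h2] := Hz (phi k).
have h3 : M%:R <= (phi k)%:R :> R by rewrite ler_nat (leq_trans _ (phige k)) // leq_maxl.
have := ler_cabs_sub (f (zs (phi k))) (f w); lra.
Qed.

(** The polydiscs are centred at 0: one with radii [r2] slightly above the [|z i|] still lies in the
    ball. Three contractions by [th] follow, for the sampling disc, the kernel of [taylorn] and the
    geometric ratio [y]. *)
Lemma local_power_series f z : holoB f -> inB z ->
  exists A : mindex n -> R[i], exists B y : R, exists r : 'I_n -> R,
    [/\ 2^-1 <= y, y < 1, (forall i, 0 < r i), (forall i, cabs (z i) <= r i) &
     (forall a, cabs (A a) <= B / \prod_i (r i / y) ^+ a i) /\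
     forall w (y' : R), 0 <= y' -> y' <= y -> (forall i, cabs (w i) <= y' / y * r i) ->
       forall K, cabs (psum A K w - f w) <= B * gtail (n := n) y' K].
Proof.
(* The [n] enlargements by [eta] together stay below the room [1 - normsq z]. *)
move=> hf zB; pose eta := (1 - normsq z) / (2 * n.+1%:R).
have eta0 : 0 < eta by rewrite divr_gt0 ?subr_gt0 // mulr_gt0.
pose r2 (i : 'I_n) := Num.sqrt (cabs (z i) ^+ 2 + eta).
have r2pos i : 0 < r2 i by rewrite sqrtr_gt0 ltr_wpDl ?sqr_ge0.
have r2sq i : r2 i ^+ 2 = cabs (z i) ^+ 2 + eta.
  by rewrite sqr_sqrtr // addr_ge0 ?sqr_ge0 // ltW.
have r2sum : \sum_(i < n) r2 i ^+ 2 < 1.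
  rewrite (eq_bigr (fun i => cabs (z i) ^+ 2 + eta)) // big_split /= -normsqE.
  rewrite sumr_const card_ord -[eta *+ n]mulr_natr -ltrBrDl.
  have h : n%:R <= n.+1%:R :> R by rewrite ler_nat.
  have h0 : 0 < 1 - normsq z by rewrite subr_gt0.
  rewrite /eta mulrAC ltr_pdivrMr ?mulr_gt0 // ltr_pM2l //.
  have := ltr0Sn R n; lra.
(* Chosen so that [1 - 6 * x = (1 + eta)^-1], whence [th ^+ 6 >= (1 + eta)^-1]; as [|z i| <= 1],
   this gives [|z i| <= th ^+ 3 * r2 i]. *)
pose x := eta / (6 * (1 + eta)); pose th := 1 - x.
have e1 : 0 < 1 + eta by rewrite addr_gt0.
have x0 : 0 < x by rewrite divr_gt0 // mulr_gt0.
have x1 : x < 1 by rewrite ltr_pdivrMr ?mulr_gt0 //; lra.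
have th0 : 0 < th by rewrite subr_gt0.
have th1 : th < 1 by rewrite gtrBl.
have th6 : (1 + eta)^-1 <= th ^+ 6.
  have h : 1 - 6 * x <= th ^+ 6.
    have y1 : 1 - 2 * x <= th ^+ 2 by rewrite /th; have := sqr_ge0 x; nra.
    have [h|h] := leP (1 - 6 * x) 0; first by rewrite (le_trans h) // exprn_ge0 // ltW.
    have y2 : 0 <= 1 - 2 * x by lra.
    have y3 : (1 - 2 * x) ^+ 3 <= (th ^+ 2) ^+ 3.
      by rewrite lerXn2r ?nnegrE ?exprn_ge0 // ltW.
    rewrite -exprM in y3; rewrite (le_trans _ y3) //.
    have -> : (1 - 2 * x) ^+ 3 = 1 - 6 * x + 4 * (x ^+ 2 * (3 - 2 * x)) by ring.
    have h3 : 0 <= 3 - 2 * x by lra.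
    have h4 : 0 <= x ^+ 2 * (3 - 2 * x) by rewrite mulr_ge0 // sqr_ge0.
    lra.
  rewrite (le_trans _ h) // /x.
  have -> : 1 - 6 * (eta / (6 * (1 + eta))) = (1 + eta)^-1 by field; rewrite gt_eqF.
  by [].
have zr i : cabs (z i) <= th ^+ 3 * r2 i.
  have p0 : 0 <= th ^+ 3 * r2 i by rewrite mulr_ge0 ?exprn_ge0 // ltW.
  rewrite -(@ler_pXn2r _ 2) ?nnegrE ?cabs_ge0 //.
  rewrite exprMn -exprM r2sq.
  have h1 : cabs (z i) ^+ 2 <= 1 by rewrite (le_trans (cabs_le_normsq z i)) // ltW.
  have h2 : cabs (z i) ^+ 2 <= (1 + eta)^-1 * (cabs (z i) ^+ 2 + eta).
    by rewrite mulrC ler_pdivlMr // mulrDr mulr1 lerD2l ler_piMl // ltW.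
  rewrite (le_trans h2) // ler_wpM2r //.
  by rewrite addr_ge0 ?sqr_ge0 // ltW.
have sub (t : R) i : t < 1 -> t * r2 i < r2 i by move=> t1; rewrite gtr_pMl.
have [B HB] := @holoB_bounded f r2 hf (fun i => ltW (r2pos i)) r2sum.
have rad1 i : th * r2 i < r2 i by exact: sub.
have [||||A [HA1 HA2]] := @taylorn R n (fun i => th * (th * r2 i)) th (fun i => th * r2 i)
  r2 f B th0 th1 _ rad1 _ _ _.
- by move=> i; rewrite mulr_gt0.
- by [].
- by move=> w hw; apply: HB => i; rewrite (le_trans (hw i)) // ltW.
- move=> w hw j u hu; apply: holoB_cd_upd => //.
  rewrite /inB (le_lt_trans _ r2sum) //; apply: normsq_le_sum => i.
  rewrite /upd; case: eqP => [->|_]; first exact: ltW.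
  by rewrite (le_trans (hw i)) // ltW.
exists A, B, th, (fun i => th ^+ 3 * r2 i); split => //.
- by rewrite /th /x; rewrite lerBrDr -lerBrDl ler_pdivrMr ?mulr_gt0 //; lra.
- by move=> i; rewrite mulr_gt0 // exprn_gt0.
split=> [a|w y' y0 y'th hw K].
  rewrite (le_trans (HA1 a)) // le_eqVlt; apply/orP; left; apply/eqP; congr (_ / _).
  by apply: eq_bigr => i _; congr (_ ^+ _); field; rewrite gt_eqF.
apply: HA2 => //; first exact: le_lt_trans th1.
move=> i; rewrite (le_trans (hw i)) // le_eqVlt; apply/orP; left; apply/eqP.
by field; rewrite gt_eqF.
Qed.

Lemma positive_lower_bound (I : finType) (r : I -> R) : (forall i, 0 < r i) ->
  exists2 d : R, 0 < d & forall i, d <= r i.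
Proof.
move=> r0; exists (\big[Num.min/1]_i r i).
  by elim/big_ind: _ => // x y x0 y0; rewrite lt_min x0.
by move=> i; rewrite (bigD1 i) //= ge_min lexx.
Qed.

(** All local expansions have centre 0, so each agrees with the one found at the origin by
    uniqueness on a small torus. One family of coefficients therefore serves the whole ball. *)
Lemma holoB_power_series f : holoB f ->
  exists A : mindex n -> R[i], forall z, inB z -> exists C q : R, [/\ 0 <= q, q < 1 &
    forall w, (forall i, cabs (w i) <= cabs (z i)) ->
      forall K, cabs (psum A K w - f w) <= C * gtail (n := n) q K].
Proof.
move=> hf.
have B0 : inB ((fun=> 0) : cpt R n) by rewrite /inB normsqE big1 // => i _; rewrite cabs0 expr0n.
have [A [C [y [r [hy y1 r0 _ [_ HA]]]]]] := local_power_series hf B0.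
exists A => z zB.
have [A' [C' [y' [r' [hy' y1' r0' zr [_ HA']]]]]] := local_power_series hf zB.
have pos (t : R) : 2^-1 <= t -> 0 < t by apply: lt_le_trans; rewrite invr_gt0.
have [y0 y0'] := (pos _ hy, pos _ hy').
have AE a : A' a - A a = 0.
  (* Both ratios [y] and [y'] are at least [2^-1], so on a small enough torus both expansions
     converge with the common ratio [2^-1]. *)
  have [d d0 dr] := @positive_lower_bound _ (fun i => 2^-1 / y * r i)
    (fun i => ltac:(by rewrite mulr_gt0 ?divr_gt0 ?invr_gt0)).
  have [d' d0' dr'] := @positive_lower_bound _ (fun i => 2^-1 / y' * r' i)
    (fun i => ltac:(by rewrite mulr_gt0 ?divr_gt0 ?invr_gt0)).
  apply: (@power_series_unique (fun=> Num.min d d') (fun a => A' a - A a) (C' + C)).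
    by move=> i; rewrite lt_min d0.
  move=> w hw K.
  have -> : psum (fun a => A' a - A a) K w = (psum A' K w - f w) - (psum A K w - f w).
    by rewrite opprB addrA subrK /psum -sumrB; apply: eq_bigr => b _; rewrite mulrBl.
  rewrite (le_trans (ler_cabsB _ _)) // mulrDl lerD //.
    apply: HA' => // i; rewrite hw (le_trans _ (dr' i)) // ge_min lexx orbT //.
  by apply: HA => // i; rewrite hw (le_trans _ (dr i)) // ge_min lexx.
exists C', y'; split=> [||w wz K]; rewrite ?(ltW y0') //.
have -> : psum A K w = psum A' K w.
  by apply: eq_bigr => b _; have /eqP := AE b; rewrite subr_eq0 => /eqP ->.
apply: HA' => //; first exact: ltW.
by move=> i; rewrite divff ?gt_eqF // mul1r (le_trans (wz i)).
Qed.

End PowerSeriesOnBall.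

(** * Integration over the ball *)

Section CylinderAlgebra.
Context {R : realType}.

(* The iterated integrals [iint] preserve measurability for the cylinder sigma-algebra on [nat -> R]. *)
Definition cylinders : set (set (nat -> R)) :=
  [set A | exists m, exists2 B : set R, measurable B & A = (fun x => x m) @^-1` B].

Local Notation cyl := (g_sigma_algebraType cylinders).

Lemma measurable_coord m : measurable_fun [set: cyl] ((fun x => x m) : cyl -> R).
Proof.
move=> _ B mB; rewrite setTI; apply: sub_sigma_algebra; by exists m, B.
Qed.

Lemma measurable_fun_cyl d (T : measurableType d) (f : T -> cyl) :
  (forall m, measurable_fun [set: T] (fun x => f x m : R)) -> measurable_fun [set: T] f.
Proof.
move=> H; apply: (@measurability _ _ T cyl _ f cylinders) => //.
move=> _ [_ [m [B mB ->]] <-].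
exact: H.
Qed.

Definition updr (x : nat -> R) k t : nat -> R := fun m => if m == k then t else x m.

Lemma measurable_updr_pair k :
  measurable_fun [set: cyl * measurableTypeR R] (fun p => updr p.1 k p.2 : cyl).
Proof.
apply: measurable_fun_cyl => m; rewrite /updr; case: (m == k).
  exact: measurable_snd.
by apply: (measurableT_comp (measurable_coord m)); exact: measurable_fst.
Qed.

Lemma measurable_updr k (x : cyl) :
  measurable_fun [set: measurableTypeR R] (fun t => updr x k t : cyl).
Proof.
apply: measurable_fun_cyl => m; rewrite /updr; case: (m == k).
  exact: measurable_id.
exact: measurable_cst.
Qed.

Local Open Scope ereal_scope.
Implicit Types (F G : (nat -> R) -> \bar R) (x : nat -> R).

Definition mcyl (F : (nat -> R) -> \bar R) := measurable_fun [set: cyl] (F : cyl -> \bar R).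
Local Notation leb := (@lebesgue_measure R).

Lemma measurable_int_coord F k : mcyl F -> mcyl (fun x => \int[leb]_t F (updr x k t)).
Proof.
move=> mF.
have mF2 : measurable_fun [set: cyl * measurableTypeR R] (fun p => F (updr p.1 k p.2)).
  exact: (measurableT_comp mF (measurable_updr_pair k)).
(* Measurability of a parametrised integral comes from Tonelli for nonnegative functions, hence the
   split into positive and negative parts. *)
have -> : (fun x => \int[leb]_t F (updr x k t)) =
    (fun x => fubini_F leb (fun p : cyl * measurableTypeR R => F^\+ (updr p.1 k p.2)) x -
              fubini_F leb (fun p : cyl * measurableTypeR R => F^\- (updr p.1 k p.2)) x).
  apply/funext => x; rewrite [LHS]integralE /fubini_F.
  by congr (_ - _); apply: eq_integral => t _; rewrite ?funeposE ?funenegE.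
apply: emeasurable_funB; apply: measurable_fun_fubini_tonelli_F => //.
- exact: (measurableT_comp (measurable_funepos mF) (measurable_updr_pair k)).
- exact: (measurableT_comp (measurable_funeneg mF) (measurable_updr_pair k)).
Qed.

Lemma measurable_iint F k : mcyl F -> mcyl (iint k F).
Proof. by move=> mF; elim: k => [//|k IH] /=; exact: measurable_int_coord. Qed.

Lemma measurable_iint_upd F k j x : mcyl F ->
  measurable_fun [set: measurableTypeR R] (fun t => iint k F (updr x j t)).
Proof. by move=> mF; apply: (measurableT_comp (measurable_iint k mF) (measurable_updr j x)). Qed.

Lemma iint_ge0 F k x : (forall x, 0 <= F x) -> 0 <= iint k F x.
Proof. by move=> F0; elim: k x => [//|k IH] x /=; apply: integral_ge0. Qed.

Lemma le_iint F G k x : mcyl F -> mcyl G -> (forall x, 0 <= F x) ->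
  (forall x, F x <= G x) -> iint k F x <= iint k G x.
Proof.
move=> mF mG F0 FG; elim: k x => [|k IH] x //=.
apply: ge0_le_integral => //.
- by move=> t _; exact: iint_ge0.
- exact: measurable_iint_upd.
- exact: measurable_iint_upd.
Qed.

Lemma iintD F G k x : mcyl F -> mcyl G -> (forall x, 0 <= F x) -> (forall x, 0 <= G x) ->
  iint k (fun x => F x + G x) x = iint k F x + iint k G x.
Proof.
move=> mF mG F0 G0; elim: k x => [|k IH] x //=.
rewrite -ge0_integralD //.
- by apply: eq_integral => t _; exact: IH.
- by move=> t _; exact: iint_ge0.
- exact: measurable_iint_upd.
- by move=> t _; exact: iint_ge0.
- exact: measurable_iint_upd.
Qed.

Lemma iintZ F k x (c : R) : mcyl F -> (forall x, 0 <= F x) -> (0 <= c)%R ->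
  iint k (fun x => c%:E * F x) x = c%:E * iint k F x.
Proof.
move=> mF F0 c0; elim: k x => [|k IH] x //=.
rewrite -ge0_integralZl_EFin //.
- by apply: eq_integral => t _; exact: IH.
- by move=> t _; exact: iint_ge0.
- exact: measurable_iint_upd.
Qed.

Lemma iint_fatou (F : nat -> (nat -> R) -> \bar R) G k x : (forall N, mcyl (F N)) ->
  (forall N x, 0 <= F N x) -> mcyl G -> (forall x, 0 <= G x) ->
  (forall x, F N x @[N --> \oo] --> G x) ->
  iint k G x <= limn_einf (fun N => iint k (F N) x).
Proof.
move=> mF F0 mG G0 FG; elim: k x => [|k IH] x /=.
  by rewrite (cvg_limn_einf_sup (FG x)).1.
apply: (@le_trans _ _ (\int[leb]_t limn_einf (fun N => iint k (F N) (updr x k t)))).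
  apply: ge0_le_integral => //.
  - by move=> t _; exact: iint_ge0.
  - exact: measurable_iint_upd.
  - rewrite /limn_einf; apply: measurableT_comp => //.
    apply: measurable_fun_limn_esup => N; apply: measurableT_comp => //.
    exact: measurable_iint_upd.
apply: fatou => //.
- by move=> N; exact: measurable_iint_upd.
- by move=> N t _; exact: iint_ge0.
Qed.

Lemma iint_fatou_le (F : nat -> (nat -> R) -> \bar R) G k x c : (forall N, mcyl (F N)) ->
  (forall N x, 0 <= F N x) -> mcyl G -> (forall x, 0 <= G x) ->
  (forall x, F N x @[N --> \oo] --> G x) ->
  (forall N, iint k (F N) x <= c) -> iint k G x <= c.
Proof.
move=> mF F0 mG G0 FG Fc; rewrite (le_trans (iint_fatou k x mF F0 mG G0 FG)) //.
rewrite limn_einf_lim; apply: lime_le; first exact: is_cvg_einfs.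
apply: nearW => N; rewrite (le_trans _ (Fc N)) //; apply: ereal_inf_lbound.
by exists N => /=.
Qed.

(** Inner integrals may be infinite at some points, but only on a null set as the outer ones are
    finite; so the induction hypothesis applies almost everywhere. *)
Lemma iintB F G k x : mcyl F -> mcyl G -> (forall x, 0 <= F x) -> (forall x, 0 <= G x) ->
  iint k F x < +oo -> iint k G x < +oo ->
  iint k (fun x => F x - G x) x = iint k F x - iint k G x.
Proof.
move=> mF mG F0 G0; elim: k x => [|k IH] x //= iF iG.
have intF : leb.-integrable [set: measurableTypeR R] (fun t => iint k F (updr x k t)).
  apply/integrableP; split; first exact: measurable_iint_upd.
  by under eq_integral do rewrite gee0_abs ?iint_ge0 //.
have intG : leb.-integrable [set: measurableTypeR R] (fun t => iint k G (updr x k t)).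
  apply/integrableP; split; first exact: measurable_iint_upd.
  by under eq_integral do rewrite gee0_abs ?iint_ge0 //.
rewrite -integralB //; apply: ae_eq_integral => //.
- by apply: measurable_iint_upd; exact: emeasurable_funB.
- by apply: emeasurable_funB; exact: measurable_iint_upd.
have aF := integrable_ae measurableT intF.
have aG := integrable_ae measurableT intG.
apply: filterS2 aF aG => t hF hG _; apply: IH.
  by have := hF I; rewrite fin_numE => /andP[_]; rewrite ltey.
by have := hG I; rewrite fin_numE => /andP[_]; rewrite ltey.
Qed.

End CylinderAlgebra.
Notation cyl R := (g_sigma_algebraType (@cylinders R)).

(** * Substitutions and elementary integrals on the line and in the plane *)

Section LebesgueLine.
Context {R : realType}.
Local Open Scope ereal_scope.
Local Notation leb := (@lebesgue_measure R).
Local Notation RM := (measurableTypeR R).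
Implicit Types (h : R -> \bar R) (H : R * R -> \bar R).

Definition m1 h := measurable_fun [set: RM] h.
Definition m2 H := measurable_fun [set: RM * RM] H.

Lemma lebesgue_oc (a b : R) : leb [set` `]a, b]] = (Num.max (b - a) 0)%:E.
Proof.
rewrite lebesgue_measure_itv /= lte_fin; case: ltP => ab.
  by rewrite -EFinB max_l // subr_ge0 ltW.
by rewrite max_r // subr_le0.
Qed.

Lemma measurable_affine (c d : R) : measurable_fun [set: RM] (fun t : RM => (c * t + d)%R : RM).
Proof. by apply: measurable_funD => //; apply: measurable_funM. Qed.

(** The push-forward of Lebesgue measure, scaled by [c], agrees with it on half-open intervals,
    hence on all measurable sets. *)
Lemma int_affine h (c d : R) : m1 h -> (forall t, 0 <= h t) -> (0 < c)%R ->
  c%:E * \int[leb]_t h (c * t + d)%R = \int[leb]_t h t.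
Proof.
move=> mh h0 c0.
have ma := measurable_affine c d.
pose phi := fun t : RM => (c * t + d)%R : RM.
pose nu := measure_function_pushforward__canonical__measure_function_Measure leb ma.
have <- : \int[mscale (NngNum (ltW c0)) nu]_t h t = \int[leb]_t h t.
  apply: eq_measure_integral => A mA _; apply/esym.
  apply: lebesgue_measure_unique => //= _ [[a b] _ <-].
  rewrite /mscale /= /pushforward /=.
  have -> : phi @^-1` [set` `]a, b]] = [set` `](a - d) / c, (b - d) / c]%R].
    apply/seteqP; split => t /=; rewrite !in_itv /= /phi ltr_pdivrMr // ler_pdivlMr // ltrBlDr lerBrDr [(t * c)%R]mulrC //.
  rewrite !lebesgue_oc -EFinM; congr EFin.
  rewrite maxr_pMr ?(ltW c0) // mulr0; congr Num.max.
  by field; rewrite gt_eqF.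
rewrite ge0_integral_mscale //=.
by rewrite ge0_integral_pushforward.
Qed.

Lemma int_shift h (d : R) : m1 h -> (forall t, 0 <= h t) ->
  \int[leb]_t h (t + d)%R = \int[leb]_t h t.
Proof.
move=> mh h0; rewrite -(int_affine d mh h0 ltr01) mul1e.
by apply: eq_integral => t _; rewrite mul1r.
Qed.

Lemma int_scale h (c : R) : m1 h -> (forall t, 0 <= h t) -> (0 < c)%R ->
  \int[leb]_t h t = c%:E * \int[leb]_t h (c * t)%R.
Proof.
move=> mh h0 c0; rewrite -(int_affine 0%R mh h0 c0); congr (_ * _).
by apply: eq_integral => t _; rewrite addr0.
Qed.

Lemma measurable_lin2 (a b : R) :
  measurable_fun [set: RM * RM] (fun p : RM * RM => (a * p.1 + b * p.2)%R : RM).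
Proof.
apply: measurable_funD; exact: measurable_funM.
Qed.

Lemma m2_comp H (f g : R * R -> R) : m2 H ->
  measurable_fun [set: RM * RM] (f : RM * RM -> RM) ->
  measurable_fun [set: RM * RM] (g : RM * RM -> RM) -> m2 (fun p => H (f p, g p)).
Proof. by move=> mH mf mg; apply: (measurableT_comp mH); exact: measurable_fun_pair. Qed.

Lemma m2_lin H (a b c d : R) : m2 H ->
  m2 (fun p => H ((a * p.1 + b * p.2)%R, (c * p.1 + d * p.2)%R)).
Proof. by move=> mH; apply: m2_comp => //; exact: measurable_lin2. Qed.

Lemma m2_row H y : m2 H -> m1 (fun x => H (x, y)).
Proof. by move=> mH; apply: (measurableT_comp mH); exact: measurable_fun_pair. Qed.

Lemma m2_col H x : m2 H -> m1 (fun y => H (x, y)).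
Proof. by move=> mH; apply: (measurableT_comp mH); exact: measurable_fun_pair. Qed.

Lemma int2_swap H : m2 H -> (forall p, 0 <= H p) ->
  \int[leb]_y \int[leb]_x H (x, y) = \int[leb]_x \int[leb]_y H (x, y).
Proof. by move=> mH H0; rewrite (@fubini_tonelli _ _ RM RM R leb leb H mH H0). Qed.

Lemma int2_shear1 H (a : R) : m2 H -> (forall p, 0 <= H p) ->
  \int[leb]_y \int[leb]_x H ((x + a * y)%R, y) = \int[leb]_y \int[leb]_x H (x, y).
Proof.
move=> mH H0; apply: eq_integral => y _.
by rewrite (@int_shift (fun x => H (x, y)) (a * y)%R) //; exact: m2_row.
Qed.

Lemma int2_shear2 H (a : R) : m2 H -> (forall p, 0 <= H p) ->
  \int[leb]_y \int[leb]_x H (x, (y + a * x)%R) = \int[leb]_y \int[leb]_x H (x, y).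
Proof.
move=> mH H0; rewrite [RHS]int2_swap //.
rewrite (@int2_swap (fun p => H (p.1, (p.2 + a * p.1)%R))) //; last first.
  have := m2_lin 1 0 a 1 mH; congr m2; apply/funext => p.
  by congr (H (_, _)); rewrite !mul1r ?mul0r ?addr0 // addrC.
apply: eq_integral => x _.
by rewrite (@int_shift (fun y => H (x, y)) (a * x)%R) //; exact: m2_col.
Qed.

(* A rotation is a product of three shears. *)
Lemma int2_rot H (c s : R) : (c ^+ 2 + s ^+ 2 = 1)%R -> (1 + c != 0)%R ->
  m2 H -> (forall p, 0 <= H p) ->
  \int[leb]_y \int[leb]_x H ((c * x - s * y)%R, (s * x + c * y)%R) =
  \int[leb]_y \int[leb]_x H (x, y).
Proof.
move=> cs c1 mH H0; pose t := (- (s / (1 + c)))%R.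
pose H1 p := H ((p.1 + t * p.2)%R, p.2); pose H2 p := H1 (p.1, (p.2 + s * p.1)%R).
have mH1 : m2 H1.
  have := m2_lin 1 t 0 1 mH; congr m2; apply/funext => p.
  by congr (H (_, _)); rewrite !mul1r ?mul0r ?add0r.
have mH2 : m2 H2.
  have := m2_lin 1 0 s 1 mH1; congr m2; apply/funext => p.
  by congr (H1 (_, _)); rewrite !mul1r ?mul0r ?addr0 // addrC.
rewrite -(int2_shear1 t mH H0) -/(H1 (_, _)).
have -> : \int[leb]_y \int[leb]_x H ((x + t * y)%R, y) = \int[leb]_y \int[leb]_x H1 (x, y) by [].
rewrite -(int2_shear2 s mH1 (fun=> H0 _)).
have -> : \int[leb]_y \int[leb]_x H1 (x, (y + s * x)%R) = \int[leb]_y \int[leb]_x H2 (x, y) by [].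
rewrite -(int2_shear1 t mH2 (fun=> H0 _)).
apply: eq_integral => y _; apply: eq_integral => x _; rewrite /H2 /H1 /=.
have E : ((1 + c) * (1 - c) = s * s)%R.
  have -> : ((1 + c) * (1 - c) = 1 - c ^+ 2)%R by ring.
  by rewrite -cs; ring.
have e2 : (y + s * (x + t * y) = s * x + c * y)%R.
  have -> : (s * (x + t * y) = s * x - (s * s) / (1 + c) * y)%R by rewrite /t; ring.
  by rewrite -E [((1 + c) * _)%R]mulrC mulfK //; ring.
congr (H (_, _)); rewrite e2 //.
have -> : (x + t * y + t * (s * x + c * y) = x - (s * s) / (1 + c) * x - s / (1 + c) * (y * (1 + c)))%R.
  by rewrite /t; ring.
by rewrite -E [((1 + c) * _)%R]mulrC mulfK // [(y * _)%R]mulrC mulrA divfK //; ring.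
Qed.

(** The truncated power. At [m = 0] it is the indicator of [0 < S], so it also encodes membership in
    the ball. *)
Definition pospow (S : R) m : R := if (0 < S)%R then (S ^+ m)%R else 0%R.

Lemma pospow_ge0 S m : (0 <= pospow S m)%R.
Proof. by rewrite /pospow; case: ifP => // /ltW S0; rewrite exprn_ge0. Qed.

Lemma pospowM c S m : (0 < c)%R -> (pospow (c * S) m = c ^+ m * pospow S m)%R.
Proof. by move=> c0; rewrite /pospow pmulr_rgt0 //; case: ifP; rewrite ?mulr0 // exprMn. Qed.

Lemma pospowS S m : (pospow S m.+1 = S * pospow S m)%R.
Proof. by rewrite /pospow; case: ifP; rewrite ?mulr0 // exprS. Qed.

Lemma measurable_pospow d (T : measurableType d) (f : T -> R) m :
  measurable_fun [set: T] f -> measurable_fun [set: T] (fun x => pospow (f x) m).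
Proof.
move=> mf; rewrite /pospow; apply: measurable_fun_ifT => //.
  exact: measurable_fun_ltr.
exact: measurable_funX.
Qed.

Lemma int_exprn_itv a k : (0 < a)%R ->
  \int[leb]_(t in `[0%R, a]) (t ^+ k)%:E = (a ^+ k.+1 / k.+1%:R)%:E.
Proof.
move=> a0; rewrite (@continuous_FTC2 _ _ (fun t => t ^+ k.+1 / k.+1%:R)%R) //.
- by rewrite expr0n mul0r sube0.
- by apply/continuous_subspaceT => x; exact: exprn_continuous.
- have der x : derivable (fun t : R => t ^+ k.+1 / k.+1%:R)%R x 1.
    by apply: derivableM => //; exact: exprn_derivable.
  have cont : continuous (fun t : R => t ^+ k.+1 / k.+1%:R)%R.
    by move=> x; apply: cvgM; [exact: exprn_continuous|exact: cvg_cst].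
  split.
  + by move=> x _; exact: der.
  + exact/cvg_at_right_filter/cont.
  + exact/cvg_at_left_filter/cont.
- move=> x _; rewrite derive1E deriveMr //; last exact: exprn_derivable.
  rewrite exp_derive scaler1 /GRing.scale /=.
  by field.
Qed.

Lemma int_pospow_itv (u : R) m : (0 <= u)%R ->
  \int[leb]_(s in `[0%R, 1%R]) (pospow (s - u) m)%:E = (pospow (1 - u) m.+1 / m.+1%:R)%:E.
Proof.
move=> u0; have [u1|u1] := leP 1%R u.
  rewrite (_ : pospow (1 - u) _ = 0)%R; last by rewrite /pospow subr_gt0 ltNge u1.
  rewrite mul0r; apply: integral0_eq => s; rewrite /= in_itv /= => /andP[_ s1].
  by rewrite /pospow subr_gt0 ltNge (le_trans s1 u1).
have u1' : (0 < 1 - u)%R by rewrite subr_gt0.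
rewrite integral_mkcond.
have mI (D : set R) (f : R -> R) : measurable D -> measurable_fun [set: RM] f ->
    measurable_fun [set: RM] ((fun s => (f s)%:E) \_ D).
  move=> mD mf; apply/(measurable_restrictT _ _).1 => //.
  by apply: measurable_funTS; apply/measurable_EFinP.
rewrite -(@int_shift _ u); last 2 first.
- apply: mI; first exact: measurable_itv.
  by apply: measurable_pospow; exact: measurable_funB.
- by move=> s; rewrite patchE; case: ifP => // _; rewrite lee_fin pospow_ge0.
transitivity (\int[leb]_(t in `]0%R, (1 - u)%R]) (t ^+ m)%:E).
  rewrite [RHS]integral_mkcond; apply: eq_integral => s _.
  rewrite !patchE addrK /pospow !mem_setE !in_itv /=.
  case: (ltP 0%R s) => s0; last by case: ifP.
  by rewrite addr_ge0 ?(ltW s0) //= -lerBrDr; case: ifP.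
rewrite integral_itv_obnd_cbnd; last first.
  by apply: measurable_funTS; apply/measurable_EFinP; exact: measurable_funX.
by rewrite int_exprn_itv // /pospow u1'.
Qed.

End LebesgueLine.

(** * Radial integrals over a disc *)

Section RadialIntegrals.
Context {R : realType}.
Local Open Scope ereal_scope.
Local Notation leb := (@lebesgue_measure R).
Local Notation RM := (measurableTypeR R).

(** With [t = x + i y] this is [|t|^(2l) (S - |t|^2)_+^m], the integrand in one complex coordinate
    when a monomial is integrated over the ball coordinate by coordinate. *)
Definition radial l m (S x y : R) : R := ((x ^+ 2 + y ^+ 2) ^+ l * pospow (S - (x ^+ 2 + y ^+ 2)) m)%R.

Definition radial_int l m (S : R) : \bar R := \int[leb]_y \int[leb]_x (radial l m S x y)%:E.

Lemma radial_ge0 l m S x y : (0 <= radial l m S x y)%R.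
Proof. by rewrite mulr_ge0 ?pospow_ge0 // exprn_ge0 // addr_ge0 ?sqr_ge0. Qed.

Lemma measurable_radial d (T : measurableType d) l m (fS fx fy : T -> R) :
  measurable_fun [set: T] fS -> measurable_fun [set: T] fx -> measurable_fun [set: T] fy ->
  measurable_fun [set: T] (fun t => radial l m (fS t) (fx t) (fy t)).
Proof.
move=> mS mx my.
have mu : measurable_fun [set: T] (fun t => fx t ^+ 2 + fy t ^+ 2)%R.
  by apply: measurable_funD; exact: measurable_funX.
apply: measurable_funM; first exact: measurable_funX.
by apply: measurable_pospow; exact: measurable_funB.
Qed.

Lemma measurable_row l m (S y : R) : measurable_fun [set: RM] (fun x : RM => (radial l m S x y)%:E).
Proof. by apply/measurable_EFinP; apply: measurable_radial. Qed.

Lemma measurable_radial_row l m (S : R) :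
  measurable_fun [set: RM] (fun y : RM => \int[leb]_x (radial l m S x y)%:E).
Proof.
have := @measurable_fun_fubini_tonelli_F _ _ RM RM R leb
  (fun p => (radial l m S p.2 p.1)%:E) _ (fun p => _); apply.
  by apply/measurable_EFinP; apply: measurable_radial.
by move=> p; rewrite lee_fin radial_ge0.
Qed.

Lemma radial_row_ge0 l m S y : 0 <= \int[leb]_x (radial l m S x y)%:E.
Proof. by apply: integral_ge0 => x _; rewrite lee_fin radial_ge0. Qed.

Lemma radial_int_ge0 l m S : 0 <= radial_int l m S.
Proof. by apply: integral_ge0 => y _; exact: radial_row_ge0. Qed.

Lemma radial_int_le0 l m (S : R) : (S <= 0)%R -> radial_int l m S = 0.
Proof.
move=> S0; apply: integral0_eq => y _; apply: integral0_eq => x _.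
rewrite /radial /pospow ifF ?mulr0 //; apply/negbTE; rewrite -leNgt subr_le0.
by rewrite (le_trans S0) // addr_ge0 ?sqr_ge0.
Qed.

Lemma radial_int_scale l m (S : R) : (0 < S)%R ->
  radial_int l m S = (S ^+ (l + m).+1)%:E * radial_int l m 1.
Proof.
move=> S0; pose c := Num.sqrt S; have c0 : (0 < c)%R by rewrite sqrtr_gt0.
have cc : (c ^+ 2 = S)%R by rewrite sqr_sqrtr // ltW.
have E := @int_scale R (fun y => \int[leb]_x (radial l m S x y)%:E) c
  (measurable_radial_row l m S) (fun y => radial_row_ge0 l m S y) c0.
apply: (etrans E); clear E.
have -> : \int[leb]_y \int[leb]_x (radial l m S x (c * y))%:E =
    \int[leb]_y ((S ^+ (l + m) * c)%:E * \int[leb]_x (radial l m 1 x y)%:E).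
  apply: eq_integral => y _.
  have r0 x : 0 <= (radial l m S x (c * y))%:E by rewrite lee_fin radial_ge0.
  apply: (etrans (@int_scale R (fun x => (radial l m S x (c * y))%:E) c (measurable_row l m S (c * y)) r0 c0)).
  rewrite [(_ * c)%R]mulrC EFinM -muleA; congr (_ * _).
  rewrite -ge0_integralZl_EFin //.
  - apply: eq_integral => x _; rewrite -EFinM /radial !exprMn cc -mulrDr.
    have -> : (S - S * (x ^+ 2 + y ^+ 2) = S * (1 - (x ^+ 2 + y ^+ 2)))%R by ring.
    by rewrite pospowM // exprMn exprD mulrACA.
  - by move=> x _; rewrite lee_fin radial_ge0.
  - exact: measurable_row.
  - by rewrite exprn_ge0 // ltW.
rewrite ge0_integralZl_EFin //.
- by rewrite muleA -EFinM; congr (_%:E * _); rewrite exprSr -cc; ring.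
- by move=> y _; exact: radial_row_ge0.
- exact: measurable_radial_row.
- by rewrite mulr_ge0 ?exprn_ge0 // ltW.
Qed.

Lemma radial_int_add l m : radial_int l.+1 m 1 + radial_int l m.+1 1 = radial_int l m 1.
Proof.
rewrite /radial_int -ge0_integralD //.
- apply: eq_integral => y _; rewrite -ge0_integralD //.
  + apply: eq_integral => x _; rewrite -EFinD /radial pospowS exprS; congr EFin; ring.
  + by move=> x _; rewrite lee_fin radial_ge0.
  + exact: measurable_row.
  + by move=> x _; rewrite lee_fin radial_ge0.
  + exact: measurable_row.
- by move=> y _; exact: radial_row_ge0.
- exact: measurable_radial_row.
- by move=> y _; exact: radial_row_ge0.
- exact: measurable_radial_row.
Qed.

Definition ind01 (s : R) : R := if (0 <= s)%R && (s <= 1)%R then 1%R else 0%R.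

Lemma ind01_ge0 s : (0 <= ind01 s)%R.
Proof. by rewrite /ind01; case: ifP. Qed.

Lemma expr_ind01_ge0 s k : (0 <= s ^+ k * ind01 s)%R.
Proof.
by rewrite /ind01; case: ifP => [/andP[s0 _]|_]; rewrite ?mulr0 // mulr1 exprn_ge0.
Qed.

Lemma measurable_ind01 d (T : measurableType d) (f : T -> R) :
  measurable_fun [set: T] f -> measurable_fun [set: T] (fun x => ind01 (f x)).
Proof.
move=> mf; rewrite /ind01; apply: measurable_fun_ifT => //.
by apply: measurable_and; exact: measurable_fun_ler.
Qed.

Lemma int_ind01 (f : R -> R) :
  \int[leb]_s (f s * ind01 s)%:E = \int[leb]_(s in `[0%R, 1%R]) (f s)%:E.
Proof.
rewrite [RHS]integral_mkcond; apply: eq_integral => s _.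
by rewrite patchE mem_setE in_itv /= /ind01; case: ifP; rewrite ?mulr1 ?mulr0.
Qed.

Lemma int_expr_ind01 k : \int[leb]_s (s ^+ k * ind01 s)%:E = (k.+1%:R^-1)%:E.
Proof. by rewrite int_ind01 int_exprn_itv // expr1n mul1r. Qed.

Lemma radial_int_finite l m : radial_int l m 1 < +oo.
Proof.
pose B : \bar R := \int[leb]_(y in `[(-1)%R, 1%R]) 2%:E.
have mitv : measurable (`[(-1)%R, 1%R]%classic : set RM) by exact: measurable_itv.
have leb2 : leb [set` `[(-1)%R, 1%R]] = 2%:E.
  rewrite lebesgue_measure_itv /= lte_fin ifT; last by lra.
  by rewrite -EFinB; congr EFin; lra.
have sq1 (x y : R) : (x ^+ 2 + y ^+ 2 < 1)%R -> (-1 <= x <= 1)%R.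
  move=> h; have : (x ^+ 2 <= 1)%R by rewrite ltW // (le_lt_trans _ h) // lerDl sqr_ge0.
  by rewrite -[(x ^+ 2)%R]real_normK ?num_real // expr_le1 // ler_norml.
have rad1 (x y : R) : (radial l m 1 x y <= 1)%R.
  rewrite /radial /pospow subr_gt0; case: ifP => [h|_]; last by rewrite mulr0.
  have u0 : (0 <= x ^+ 2 + y ^+ 2)%R by rewrite addr_ge0 ?sqr_ge0.
  rewrite mulr_ile1 ?exprn_ge0 ?subr_ge0 ?exprn_ile1 ?subr_ge0 ?gerBl ?(ltW h) //.
have rad0 (x y : R) : ~~ (-1 <= x <= 1)%R || ~~ (-1 <= y <= 1)%R -> radial l m 1 x y = 0%R.
  move=> h; rewrite /radial /pospow subr_gt0 ifF ?mulr0 //; apply/negbTE.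
  apply: contraL h => h; rewrite negb_or !negbK (sq1 x y) //= (sq1 y x) //.
  by rewrite addrC.
have rowB y : \int[leb]_x (radial l m 1 x y)%:E <= 2%:E.
  apply: (@le_trans _ _ (\int[leb]_(x in `[(-1)%R, 1%R]) 1%:E)).
    rewrite [leRHS]integral_mkcond; apply: ge0_le_integral => //.
    - by move=> x _; rewrite lee_fin radial_ge0.
    - exact: measurable_row.
    - by apply/(measurable_restrictT _ _).1 => //; exact: measurable_cst.
    - move=> x _; rewrite patchE mem_setE in_itv /=; case: ifPn => h.
        by rewrite lee_fin.
      by rewrite lee_fin rad0 // h.
  have -> : \int[leb]_(x in `[(-1)%R, 1%R]) 1%:E = 1%:E * leb [set` `[(-1)%R, 1%R]] by apply: integral_cst.
  by rewrite leb2 mul1e.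
apply: (@le_lt_trans _ _ B).
  rewrite /radial_int /B [leRHS]integral_mkcond; apply: ge0_le_integral => //.
  - by move=> y _; exact: radial_row_ge0.
  - exact: measurable_radial_row.
  - by apply/(measurable_restrictT _ _).1 => //; exact: measurable_cst.
  - move=> y _; rewrite patchE mem_setE in_itv /=; case: ifPn => h; first exact: rowB.
    rewrite integral0_eq // => x _; by rewrite rad0 // h orbT.
have -> : B = 2%:E * leb [set` `[(-1)%R, 1%R]] by apply: integral_cst.
by rewrite leb2 -EFinM ltry.
Qed.

Lemma radial_int_fin_num l m : radial_int l m 1 \is a fin_num.
Proof. by rewrite (ge0_fin_numE (radial_int_ge0 l m 1)) radial_int_finite. Qed.

Lemma radial_int_gt0 : 0 < radial_int 0 0 1.
Proof.
pose a : R := 2^-1%R.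
have mitv : measurable (`[0%R, a] : set RM) by exact: measurable_itv.
have a0 : (0 < a)%R by rewrite invr_gt0.
have lebE : leb [set` `[0%R, a]] = a%:E.
  by rewrite lebesgue_measure_itv /= lte_fin a0 -EFinB subr0.
have row (y : R) : (0 <= y <= a)%R -> a%:E <= \int[leb]_x (radial 0 0 1 x y)%:E.
  move=> hy; have <- : \int[leb]_(x in `[0%R, a]) 1%:E = a%:E.
    by apply: etrans (_ : 1%:E * leb [set` `[0%R, a]] = _); [exact: integral_cst|rewrite lebE mul1e].
  rewrite [leLHS]integral_mkcond; apply: ge0_le_integral => //.
  - by move=> x _; rewrite patchE; case: ifP.
  - by apply/(measurable_restrictT _ _).1 => //; exact: measurable_cst.
  - exact: measurable_row.
  - move=> x _; rewrite patchE mem_setE in_itv /=; case: ifPn => hx; last first.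
      by rewrite lee_fin radial_ge0.
    rewrite /radial /pospow !expr0 mul1r ifT // subr_gt0.
    have sq (t : R) : (0 <= t <= a)%R -> (t ^+ 2 <= a ^+ 2)%R.
      by move=> /andP[t0 ta]; rewrite lerXn2r // nnegrE // ltW.
    rewrite (le_lt_trans (lerD (sq _ hx) (sq _ hy))) // /a; lra.
apply: (@lt_le_trans _ _ (\int[leb]_(y in `[0%R, a]) a%:E)).
  have -> : \int[leb]_(y in `[0%R, a]) a%:E = a%:E * leb [set` `[0%R, a]] by apply: integral_cst.
  by rewrite lebE -EFinM lte_fin mulr_gt0.
rewrite [leLHS]integral_mkcond; apply: ge0_le_integral => //.
- by move=> y _; rewrite patchE; case: ifP => // _; rewrite lee_fin ltW.
- by apply/(measurable_restrictT _ _).1 => //; exact: measurable_cst.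
- exact: measurable_radial_row.
- move=> y _; rewrite patchE mem_setE in_itv /=; case: ifPn => hy; first exact: row.
  exact: radial_row_ge0.
Qed.

(** The integral of [radial_int l m s] over [0 <= s <= 1], computed twice. Integrating in [s] first
    gives [radial_int l m.+1 1 / m.+1]; integrating in [s] last, homogeneity gives
    [radial_int l m 1 / (l + m).+2]. *)
Lemma radial_int_step l m : radial_int l m.+1 1 = (m.+1%:R / (l + m).+2%:R)%:E * radial_int l m 1.
Proof.
pose G (x y s : R) : R := (radial l m s x y * ind01 s)%R.
have G0 x y s : 0 <= (G x y s)%:E by rewrite lee_fin mulr_ge0 ?radial_ge0 ?ind01_ge0.
have mG d (T : measurableType d) (fx fy fs : T -> R) : measurable_fun [set: T] fx ->
    measurable_fun [set: T] fy -> measurable_fun [set: T] fs ->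
    measurable_fun [set: T] (fun t => (G (fx t) (fy t) (fs t))%:E).
  move=> mx my ms; apply/measurable_EFinP; apply: measurable_funM.
    exact: measurable_radial.
  exact: measurable_ind01.
have inner x y : \int[leb]_s (G x y s)%:E = (m.+1%:R^-1)%:E * (radial l m.+1 1 x y)%:E.
  have u0 : (0 <= x ^+ 2 + y ^+ 2)%R by rewrite addr_ge0 ?sqr_ge0.
  rewrite (int_ind01 (fun s => radial l m s x y)) /radial.
  under eq_integral do rewrite EFinM.
  rewrite ge0_integralZl_EFin //.
  - by rewrite int_pospow_itv // -!EFinM; congr EFin; field.
  - by move=> s _; rewrite lee_fin pospow_ge0.
  - by apply: measurable_funTS; apply/measurable_EFinP; apply: measurable_pospow; exact: measurable_funB.
  - exact: exprn_ge0.
have E1 : \int[leb]_y \int[leb]_x \int[leb]_s (G x y s)%:E =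
    (m.+1%:R^-1)%:E * radial_int l m.+1 1.
  rewrite /radial_int -ge0_integralZl_EFin //.
  - apply: eq_integral => y _; rewrite -ge0_integralZl_EFin //.
    + by apply: eq_integral => x _; exact: inner.
    + by move=> x _; rewrite lee_fin radial_ge0.
    + exact: measurable_row.
  - by move=> y _; exact: radial_row_ge0.
  - exact: measurable_radial_row.
have E2 : \int[leb]_y \int[leb]_x \int[leb]_s (G x y s)%:E =
    \int[leb]_s \int[leb]_y \int[leb]_x (G x y s)%:E.
  have -> : \int[leb]_y \int[leb]_x \int[leb]_s (G x y s)%:E =
      \int[leb]_y \int[leb]_s \int[leb]_x (G x y s)%:E.
    apply: eq_integral => y _; apply/esym.
    apply: (@int2_swap R (fun p => (G p.1 y p.2)%:E)) => //.
    exact: mG.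
  apply/esym; apply: (@int2_swap R (fun p => \int[leb]_x (G x p.1 p.2)%:E)) => //.
    apply: (@measurable_fun_fubini_tonelli_F _ _ (RM * RM)%type RM R leb
      (fun p => (G p.2 p.1.1 p.1.2)%:E)) => //.
    apply: mG => //; exact: (measurableT_comp _ measurable_fst).
  by move=> p; apply: integral_ge0.
have E3 : \int[leb]_s \int[leb]_y \int[leb]_x (G x y s)%:E =
    ((l + m).+2%:R^-1)%:E * radial_int l m 1.
  have -> : \int[leb]_s \int[leb]_y \int[leb]_x (G x y s)%:E =
      \int[leb]_s ((s ^+ (l + m).+1 * ind01 s)%:E * radial_int l m 1).
    apply: eq_integral => s _; rewrite /G /ind01; case: ifPn => [/andP[s0 _]|_].
      rewrite mulr1; under eq_integral do under eq_integral do rewrite mulr1.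
      move: s0; rewrite le_eqVlt => /predU1P[<-|s0].
        by rewrite expr0n mul0e; exact: radial_int_le0.
      exact: radial_int_scale.
    rewrite mulr0 mul0e; apply: integral0_eq => y _; apply: integral0_eq => x _.
    by rewrite mulr0.
  have [c cE] : exists c, radial_int l m 1 = c%:E.
    by exists (fine (radial_int l m 1)); apply: esym (fineK (radial_int_fin_num l m)).
  have c0 : (0 <= c)%R by rewrite -lee_fin -cE radial_int_ge0.
  rewrite cE; under eq_integral do rewrite muleC.
  have I0 (s : R) : [set: RM] s -> 0 <= (s ^+ (l + m).+1 * ind01 s)%:E.
    by move=> _; rewrite lee_fin expr_ind01_ge0.
  have mI : measurable_fun [set: RM] (fun s : RM => (s ^+ (l + m).+1 * ind01 s)%:E).
    apply/measurable_EFinP; apply: measurable_funM; last exact: measurable_ind01.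
    exact: measurable_funX.
  apply: (etrans (ge0_integralZl_EFin leb measurableT I0 mI c0)).
  by rewrite int_expr_ind01 muleC.
have a0 : (m.+1%:R != 0 :> R)%R by rewrite pnatr_eq0.
by rewrite EFinM -muleA -E3 -E2 E1 muleA -EFinM (divff a0) mul1e.
Qed.

(** The quotient of factorials is the Beta value [B(l + 1, m + 1)]. The area of the unit disc is
    left unevaluated, as it cancels in the normalized volume. *)
Lemma radial_intE l m : radial_int l m 1 =
  (l`!%:R * m`!%:R / (l + m).+1`!%:R)%:E * radial_int 0 0 1.
Proof.
elim: l m => [|l IH] m.
  elim: m => [|m IHm]; first by rewrite !fact0 mulr1 divff ?mul1e // oner_neq0.
  rewrite radial_int_step IHm muleA -EFinM; congr (_%:E * _).
  rewrite !add0n !fact0 (factS m) (factS m.+1) !natrM.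
  have f0 : (m`!%:R != 0 :> R)%R by rewrite pnatr_eq0 -lt0n fact_gt0.
  have g0 : (m.+1%:R != 0 :> R)%R by rewrite pnatr_eq0.
  have h0 : (m.+2%:R != 0 :> R)%R by rewrite pnatr_eq0.
  move: (m`!%:R)%R f0 => F f0; move: (m.+1%:R)%R (m.+2%:R)%R g0 h0 => a b a0 b0.
  by rewrite mul1r; field; rewrite f0 a0 b0.
have -> : radial_int l.+1 m 1 = radial_int l m 1 - radial_int l m.+1 1.
  by rewrite -(radial_int_add l m) addeK // radial_int_fin_num.
rewrite radial_int_step IH -(fineK (radial_int_fin_num 0 0)) -!EFinM -EFinB; congr EFin.
have f0 : ((l + m).+1`!%:R != 0 :> R)%R by rewrite pnatr_eq0 -lt0n fact_gt0.
have g0 : ((l + m).+2%:R != 0 :> R)%R by rewrite pnatr_eq0.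
rewrite addSn (factS (l + m).+1) (factS l); move: ((l + m).+1)`!%N f0 => F f0; rewrite !natrM.
have e : (l.+1%:R = (l + m).+2%:R - m.+1%:R :> R)%R by rewrite -addnS -addSn natrD addrK.
move: ((l + m).+2%:R)%R (m.+1%:R)%R g0 e => a b a0 ->; field; by rewrite f0 a0.
Qed.

End RadialIntegrals.

(** * Rotation of one complex coordinate *)

Section Rotations.
Context {R : realType}.
Local Open Scope ereal_scope.
Local Notation leb := (@lebesgue_measure R).
Local Notation RM := (measurableTypeR R).
Implicit Types (F : (nat -> R) -> \bar R) (x : nat -> R).

Definition rotx j (c s : R) x : nat -> R := fun m =>
  if m == (2 * j)%N then (c * x (2 * j)%N - s * x (2 * j + 1)%N)%R
  else if m == (2 * j + 1)%N then (s * x (2 * j)%N + c * x (2 * j + 1)%N)%R else x m.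

Lemma measurable_rotx j (c s : R) : measurable_fun [set: cyl R] (rotx j c s : cyl R -> cyl R).
Proof.
apply: measurable_fun_cyl => m; rewrite /rotx.
have mM (a : R) i : measurable_fun [set: cyl R] (fun x : cyl R => a * x i)%R.
  by apply: measurable_funM => //; exact: measurable_coord.
case: (m == _); first exact: measurable_funB.
case: (m == _); first exact: measurable_funD.
exact: measurable_coord.
Qed.

Lemma mcyl_rotx F j c s : mcyl F -> mcyl (F \o rotx j c s).
Proof. by move=> mF; apply: (measurableT_comp mF (measurable_rotx j c s)). Qed.

Lemma iint_comp F (g : (nat -> R) -> nat -> R) k x :
  (forall m t x, (m < k)%N -> g (updr x m t) = updr (g x) m t) ->
  iint k (F \o g) x = iint k F (g x).
Proof.
elim: k x => [//|k IH] x gk /=; apply: eq_integral => t _.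
rewrite -/(updr x k t) -/(updr (g x) k t) -gk //.
by apply: IH => m u y mk; apply: gk; exact: ltnW.
Qed.

(** Integrals over coordinates beyond [2 * j + 1] are peeled off. The two outermost that remain run
    over the rotated pair, and the inner ones commute with the rotation by [iint_comp]. *)
Lemma iint_rotx F j c s k x : (c ^+ 2 + s ^+ 2 = 1)%R -> (1 + c != 0)%R ->
  mcyl F -> (forall x, 0 <= F x) -> (2 * j + 1 < k)%N ->
  iint k (F \o rotx j c s) x = iint k F x.
Proof.
move=> cs c1 mF F0; elim: k x => [//|k IH] x; rewrite ltnS leq_eqVlt => /predU1P[<-|jk]; last first.
  by apply: eq_integral => t _; exact: IH.
rewrite addn1 /=.
pose H (p : R * R) := iint (2 * j)%N F (updr (updr x (2 * j)%N.+1 p.2) (2 * j)%N p.1).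
have mH : m2 H.
  apply: (measurableT_comp (measurable_iint (2 * j)%N mF)).
  apply: measurable_fun_cyl => m; rewrite /updr; case: (m == _); first exact: measurable_fst.
  by case: (m == _) => //; exact: measurable_snd.
rewrite -[RHS](@int2_rot R H c s cs c1 mH) => [|p]; last exact: iint_ge0.
apply: eq_integral => t1 _; apply: eq_integral => t0 _; rewrite iint_comp => [|m t y mj].
  congr iint; apply/funext => m; rewrite /rotx /updr /= !addn1 !eqxx.
  have -> : ((2 * j).+1 == (2 * j)%N) = false by rewrite gtn_eqF.
  by case: (m == _) => //; case: (m == _).
apply/funext => i; rewrite /rotx /updr.
have -> : ((2 * j)%N == m) = false by rewrite gtn_eqF.
have -> : ((2 * j + 1)%N == m) = false by rewrite gtn_eqF // addn1 ltnW.
case: (eqVneq i m) => // ->.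
by rewrite !ltn_eqF // addn1 ltnW.
Qed.

End Rotations.

(** * Torus invariance and the norms of monomials *)

Section BallIntegrals.
Context {R : realType} {n : nat}.
Local Open Scope ereal_scope.
Local Notation leb := (@lebesgue_measure R).
Local Notation RM := (measurableTypeR R).
Local Notation ptx := (@pt_of R n).
Implicit Types (F : cpt R n -> \bar R) (x : nat -> R).

Definition mC F := mcyl (fun x => F (ptx x)).

Lemma updr_pt_of (k : nat) (t : R) x (i : 'I_n) : (k < 2 * i)%N -> ptx (updr x k t) i = ptx x i.
Proof.
move=> ki; rewrite /pt_of /updr !gtn_eqF //.
by rewrite (leq_trans ki) // leq_addr.
Qed.

Lemma lebC_mulz_coord F (j : 'I_n) (u : R[i]) : cabs u = 1%R -> mC F -> (forall z, 0 <= F z) ->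
  mC (fun z => F (fun i => if i == j then (u * z i)%R else z i)) /\
  lebC (fun z => F (fun i => if i == j then (u * z i)%R else z i)) = lebC F.
Proof.
move=> u1 mF F0.
have jn : (2 * j + 1 < 2 * n)%N by rewrite addn1 -addn2 -[X in (_ + X)%N]muln1 -mulnDr leq_mul2l addn1 ltn_ord.
have cs : (complex.Re u ^+ 2 + complex.Im u ^+ 2 = 1)%R by have := abs2E u; rewrite u1 expr1n.
have step (v : R[i]) (G : cpt R n -> \bar R) : (complex.Re v ^+ 2 + complex.Im v ^+ 2 = 1)%R -> (1 + complex.Re v != 0)%R ->
  mC G -> (forall z, 0 <= G z) ->
  let G' z := G (fun i => if i == j then (v * z i)%R else z i) in mC G' /\ lebC G' = lebC G.
  move=> vs v1 mG G0 /=.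
  have E : (fun x => G (fun i => if i == j then (v * ptx x i)%R else ptx x i)) =
      (fun x => G (ptx x)) \o rotx j (complex.Re v) (complex.Im v).
    apply/funext => x /=; congr G; apply/funext => i; rewrite /pt_of /rotx.
    have -> : ((2 * i)%N == (2 * j + 1)%N) = false.
      by apply/negbTE/negP => /eqP /(congr1 odd); rewrite oddD !oddM.
    have -> : ((2 * i + 1)%N == (2 * j)%N) = false.
      by apply/negbTE/negP => /eqP /(congr1 odd); rewrite oddD !oddM.
    rewrite eqn_add2r eqn_pmul2l //.
    have -> : (nat_of_ord i == j) = (i == j) by [].
    case: eqVneq => [->|//].
    by case: v {vs v1} => a b; apply/eqP; rewrite eq_complex /= eqxx /= addrC eqxx.
  split; first by rewrite /mC E; exact: mcyl_rotx.
  by rewrite /lebC E iint_rotx //.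
have [c1|c1] := eqVneq (1 + complex.Re u)%R 0%R; last by exact: step.
(* The three-shear decomposition excludes [u = -1], which is the square of [i]. *)
have uE : u = ('i%C * 'i%C)%R.
  move: cs c1; case: (u) => a b /= cs c1.
  have a1 : (a = -1)%R by lra.
  have b0 : (b = 0)%R by apply/eqP; rewrite -sqrf_eq0; apply/eqP; move: cs; rewrite a1; lra.
  by rewrite a1 b0; apply/eqP; rewrite eq_complex /= !mul0r !mul1r sub0r addr0 !eqxx.
have [|| mG GE] := step 'i%C F _ _ mF F0; [by rewrite /= expr0n expr1n add0r|by rewrite /= addr0 oner_neq0|].
have [||mG' GE'] := step 'i%C _ _ _ mG (fun z => F0 _); [by rewrite /= expr0n expr1n add0r|by rewrite /= addr0 oner_neq0|].
have E : (fun z => F (fun i => if i == j then (u * z i)%R else z i)) =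
    fun z => F (fun i => if i == j then ('i%C * (if i == j then 'i%C * z i else z i))%R
                         else if i == j then ('i%C * z i)%R else z i).
  by apply/funext => z; congr F; apply/funext => i; case: ifP => // _; rewrite uE mulrA.
by rewrite E; split=> //; rewrite GE'.
Qed.

Definition rotz (u z : cpt R n) : cpt R n := fun i => (u i * z i)%R.

Lemma lebC_rotz F (u : cpt R n) : (forall i, cabs (u i) = 1%R) -> mC F -> (forall z, 0 <= F z) ->
  mC (fun z => F (rotz u z)) /\ lebC (fun z => F (rotz u z)) = lebC F.
Proof.
move=> u1 mF F0; pose v (s : seq 'I_n) : cpt R n := fun i => if i \in s then u i else 1%R.
suff H s : uniq s -> mC (fun z => F (rotz (v s) z)) /\ lebC (fun z => F (rotz (v s) z)) = lebC F.
  have -> : u = v (enum 'I_n) by apply/funext => i; rewrite /v mem_enum.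
  exact/H/enum_uniq.
elim: s => [_|j s IH /= /andP[js us]].
  have -> : (fun z => F (rotz (v [::]) z)) = F.
    by apply/funext => z; congr F; apply/funext => i; rewrite /rotz mul1r.
  by [].
have [mG GE] := IH us; rewrite -GE.
have [mG' GE'] := lebC_mulz_coord j (u1 j) mG (fun z => F0 _).
have E : (fun z => F (rotz (v (j :: s)) z)) =
    (fun z => F (rotz (v s) (fun i => if i == j then (u j * z i)%R else z i))).
  apply/funext => z; congr F; apply/funext => i; rewrite /rotz /v in_cons.
  by case: eqVneq => [->|_] //=; rewrite (negbTE js) mul1r.
by rewrite E.
Qed.

Definition xmono (a : mindex n) (z : cpt R n) : R := (\prod_i abs2 (z i) ^+ a i)%R.

Definition rho2 : R := fine (@radial_int R 0 0 1).

Lemma rho2_gt0 : (0 < rho2)%R.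
Proof. by rewrite fine_gt0 // radial_int_gt0 radial_int_finite. Qed.

Lemma radial_int_pospow l m (S : R) : radial_int l m S =
  (pospow S (l + m).+1 * (l`!%:R * m`!%:R / (l + m).+1`!%:R * rho2))%:E.
Proof.
rewrite /pospow; case: ltP => S0; last by rewrite mul0r radial_int_le0.
rewrite radial_int_scale // radial_intE !EFinM.
by rewrite fineK // radial_int_fin_num.
Qed.

(** Integrating out the first [j] complex coordinates turns the ball condition into a truncated
    power with exponent [mfst a j], with the constant [cfst a j] in front. *)
Definition mfst (a : mindex n) j := (\sum_(i < n | (i < j)%N) (a i).+1)%N.
Definition cfst (a : mindex n) j : R :=
  (rho2 ^+ j * (\prod_(i < n | (i < j)%N) (a i)`!%:R) / (mfst a j)`!%:R)%R.

Lemma measurable_abs2_coord (i : 'I_n) : measurable_fun [set: cyl R] (fun x : cyl R => abs2 (ptx x i) : R).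
Proof. by apply: measurable_funD; apply: measurable_funX; exact: measurable_coord. Qed.

Lemma measurable_normsq : measurable_fun [set: cyl R] (fun x : cyl R => normsq (ptx x) : R).
Proof. by apply: measurable_sum => i; exact: measurable_abs2_coord. Qed.

Lemma iint_xmono a j x : (j <= n)%N ->
  iint (2 * j) (fun x => (if inB (ptx x) then xmono a (ptx x) else 0%R)%:E) x =
  (cfst a j * \prod_(i < n | (j <= i)%N) abs2 (ptx x i) ^+ a i *
   pospow (1 - \sum_(i < n | (j <= i)%N) abs2 (ptx x i)) (mfst a j))%:E.
Proof.
elim: j x => [|j IH] x jn.
  have m0 : mfst a 0 = 0%N by rewrite /mfst big_pred0.
  have c0 : cfst a 0 = 1%R by rewrite /cfst m0 big_pred0 // expr0 fact0 mul1r divr1.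
  rewrite muln0 c0 m0 mul1r /pospow expr0 subr_gt0 /=.
  by rewrite /inB /normsq; case: ifP; rewrite ?mulr1 ?mulr0.
pose J := Ordinal jn.
have PJ (i : 'I_n) : ((j <= i)%N && (i != J)) = (j < i)%N by rewrite [RHS]ltn_neqAle andbC eq_sym.
have PJ' (i : 'I_n) : ((i < j.+1)%N && (i != J)) = (i < j)%N by rewrite ltnS [RHS]ltn_neqAle andbC.
set A := (\prod_(i < n | (j.+1 <= i)%N) abs2 (ptx x i) ^+ a i)%R.
set S := (1 - \sum_(i < n | (j.+1 <= i)%N) abs2 (ptx x i))%R.
have A0 : (0 <= A)%R by apply: prodr_ge0 => i _; rewrite exprn_ge0 ?abs2_ge0.
have C0 : (0 <= cfst a j)%R.
  rewrite /cfst !mulr_ge0 ?invr_ge0 ?exprn_ge0 ?(ltW rho2_gt0) //.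
  by apply: prodr_ge0 => i _.
have E : forall y t, iint (2 * j) (fun x => (if inB (ptx x) then xmono a (ptx x) else 0%R)%:E)
   (updr (updr x (2 * j)%N.+1 y) (2 * j)%N t) = (cfst a j * A)%:E * (radial (a J) (mfst a j) S t y)%:E.
  move=> y t; rewrite IH 1?ltnW //; set w := updr _ _ _.
  have wi (i : 'I_n) : (j < i)%N -> ptx w i = ptx x i.
    move=> ji; have h : ((2 * j).+1 < 2 * i)%N.
      by rewrite -addn2 -[X in (_ + X)%N]muln1 -mulnDr leq_mul2l addn1 in ji *.
    by rewrite !updr_pt_of // ltnW.
  have wJ : abs2 (ptx w J) = (t ^+ 2 + y ^+ 2)%R.
    by rewrite /abs2 /pt_of /w /updr /= addn1 !eqxx gtn_eqF.
  rewrite (bigD1 J) //= (eq_bigl _ _ PJ) (bigD1 J (P := fun i : 'I_n => (j <= i)%N)) //= (eq_bigl _ _ PJ).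
  rewrite wJ (eq_bigr (fun i => abs2 (ptx x i) ^+ a i)%R) => [|i /wi -> //].
  rewrite (eq_bigr (fun i => abs2 (ptx x i))) => [|i /wi -> //].
  rewrite -EFinM /radial -/A; congr EFin.
  have -> : (S - (t ^+ 2 + y ^+ 2) = 1 - (t ^+ 2 + y ^+ 2 + \sum_(i < n | (j < i)%N) abs2 (ptx x i)))%R.
    by rewrite /S; ring.
  ring.
have -> : iint (2 * j.+1) (fun x => (if inB (ptx x) then xmono a (ptx x) else 0%R)%:E) x =
    \int[leb]_y \int[leb]_t ((cfst a j * A)%:E * (radial (a J) (mfst a j) S t y)%:E).
  rewrite mulnS addnC addn2 /=; apply: eq_integral => y _; apply: eq_integral => t _; exact: E.
have CA0 : (0 <= cfst a j * A)%R by rewrite mulr_ge0.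
transitivity ((cfst a j * A)%:E * radial_int (a J) (mfst a j) S).
  rewrite /radial_int -ge0_integralZl_EFin //; last 2 first.
  - by move=> y _; exact: radial_row_ge0.
  - exact: measurable_radial_row.
  apply: eq_integral => y _; rewrite ge0_integralZl_EFin //; last exact: measurable_row.
  by move=> t _; rewrite lee_fin radial_ge0.
rewrite radial_int_pospow -EFinM; congr EFin.
have mE : mfst a j.+1 = (a J + mfst a j).+1.
  by rewrite /mfst (bigD1 J) //= (eq_bigl _ _ PJ') addSn.
rewrite {2}/cfst (bigD1 J) //= (eq_bigl _ _ PJ') -mE /cfst exprS.
have f0 k : (k`!%:R != 0 :> R)%R by rewrite pnatr_eq0 -lt0n fact_gt0.
have := f0 (mfst a j); have := f0 (mfst a j.+1).
move: ((mfst a j)`!%:R)%R ((mfst a j.+1)`!%:R)%R => f1 f2 f20 f10.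
by field; rewrite f10 f20.
Qed.

(** The squared Bergman norm of the monomial of [a], by [L2_mpow]. *)
Definition omega (a : mindex n) : R := (n`!%:R * (\prod_i (a i)`!%:R) / (n + mdeg a)`!%:R)%R.

Lemma lebC_xmono a : lebC (fun z => (if inB z then xmono a z else 0%R)%:E) =
  (rho2 ^+ n * (\prod_i (a i)`!%:R) / (n + mdeg a)`!%:R)%:E.
Proof.
have nP (i : 'I_n) : (n <= i)%N = false by rewrite leqNgt ltn_ord.
rewrite /lebC iint_xmono // !(eq_bigl xpred0 _ nP) !big_pred0_eq.
rewrite /pospow subr0 ltr01 expr1n !mulr1 /cfst /mfst.
have nP' (i : 'I_n) : (i < n)%N = xpredT i by rewrite ltn_ord.
rewrite !(eq_bigl _ _ nP').
rewrite [X in (_ / X`!%:R)%R](_ : _ = (n + mdeg a)%N) //.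
rewrite (eq_bigr (fun i => 1 + a i)%N) // big_split /=; congr (_ + _)%N.
by rewrite sum1_card card_ord.
Qed.

Lemma vol_ballE : @vol_ball R n = (rho2 ^+ n / n`!%:R)%:E.
Proof.
have := lebC_xmono [ffun=> 0%N].
rewrite big1 => [|i _]; last by rewrite ffunE fact0.
rewrite /mdeg big1 => [|i _]; last by rewrite ffunE.
rewrite addn0 mulr1 => <-; congr lebC; apply/funext => z; rewrite /xmono big1 => [|i _].
  by case: ifP.
by rewrite ffunE expr0.
Qed.

Definition vol : R := fine (@vol_ball R n).

Lemma vol_gt0 : (0 < vol)%R.
Proof. by rewrite /vol vol_ballE /= divr_gt0 ?exprn_gt0 ?rho2_gt0 // ltr0n fact_gt0. Qed.

Lemma vint_xmono a : vint (fun z => (xmono a z)%:E) = (omega a)%:E.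
Proof.
rewrite /vint (_ : (fun z => _) = (fun z => (if inB z then xmono a z else 0%R)%:E)).
  rewrite lebC_xmono vol_ballE /= -EFinM /omega; congr EFin.
  have f0 : (n`!%:R != 0 :> R)%R by rewrite pnatr_eq0 -lt0n fact_gt0.
  have g0 : ((n + mdeg a)`!%:R != 0 :> R)%R by rewrite pnatr_eq0 -lt0n fact_gt0.
  have r0 : (rho2 ^+ n != 0)%R by rewrite gt_eqF // exprn_gt0 // rho2_gt0.
  move: (n`!%:R)%R ((n + mdeg a)`!%:R)%R (rho2 ^+ n)%R f0 g0 r0 => f g r f0 g0 r0.
  by field; rewrite f0 g0 r0.
by apply/funext => z; case: ifP.
Qed.

End BallIntegrals.

(** * Square-integrable functions *)

Section NormalizedIntegral.
Context {R : realType} {n : nat}.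
Local Open Scope ereal_scope.
Local Notation ptx := (@pt_of R n).
Implicit Types (F G : cpt R n -> R) (x : nat -> R) (z : cpt R n) (c t : R).

(** Holomorphy on the ball says nothing about values outside it, so measurability and integrals
    always refer to the function cut off there. *)
Definition onB F z : R := if inB z then F z else 0%R.
Definition mB F := measurable_fun [set: cyl R] (fun x : cyl R => onB F (ptx x)).
Definition nvint F : \bar R := vint (fun z => (F z)%:E).

Lemma nvintE F : nvint F = iint (2 * n)%N (fun x => (onB F (ptx x))%:E) (fun=> 0%R) * ((@vol R n)^-1)%:E.
Proof.
rewrite /nvint /vint /lebC; congr (iint _ _ _ * _); apply/funext => x; rewrite /onB.
by case: ifP.
Qed.

Lemma measurable_inB : measurable_fun [set: cyl R] (fun x : cyl R => inB (ptx x)).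
Proof. by apply: measurable_fun_ltr => //; exact: measurable_normsq. Qed.

Lemma mB_measurable F : measurable_fun [set: cyl R] (fun x : cyl R => F (ptx x)) -> mB F.
Proof. by move=> mF; apply: measurable_fun_ifT => //; exact: measurable_inB. Qed.

Lemma mB_cst c : mB (fun=> c).
Proof. by apply: mB_measurable; exact: measurable_cst. Qed.

Lemma mB_Re (i : 'I_n) : mB (fun z => complex.Re (z i)).
Proof. by apply: mB_measurable; exact: measurable_coord. Qed.

Lemma mB_Im (i : 'I_n) : mB (fun z => complex.Im (z i)).
Proof. by apply: mB_measurable; exact: measurable_coord. Qed.

Lemma mBD F G : mB F -> mB G -> mB (fun z => F z + G z)%R.
Proof.
move=> mF mG; have := measurable_funD mF mG; congr measurable_fun.
by apply/funext => x /=; rewrite /onB; case: ifP; rewrite ?addr0.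
Qed.

Lemma mBM F G : mB F -> mB G -> mB (fun z => F z * G z)%R.
Proof.
move=> mF mG; have := measurable_funM mF mG; congr measurable_fun.
by apply/funext => x /=; rewrite /onB; case: ifP; rewrite ?mulr0.
Qed.

Lemma mBZ c F : mB F -> mB (fun z => c * F z)%R.
Proof. by apply: mBM; exact: mB_cst. Qed.

Lemma mBB F G : mB F -> mB G -> mB (fun z => F z - G z)%R.
Proof.
move=> mF mG; have := measurable_funB mF mG; congr measurable_fun.
by apply/funext => x /=; rewrite /onB; case: ifP; rewrite ?subr0.
Qed.

Lemma mB_norm F : mB F -> mB (fun z => `|F z|)%R.
Proof.
move=> mF; have := measurableT_comp (@normr_measurable R setT) mF; congr measurable_fun.
by apply/funext => x /=; rewrite /onB; case: ifP; rewrite ?normr0.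
Qed.

Lemma mB_sum (I : Type) (s : seq I) (F : I -> cpt R n -> R) : (forall i, mB (F i)) ->
  mB (fun z => \sum_(i <- s) F i z)%R.
Proof.
move=> mF; elim: s => [|i s IH].
  by under eq_fun do rewrite big_nil; exact: mB_cst.
by under eq_fun do rewrite big_cons; exact: mBD.
Qed.

Lemma eq_mB F G : (forall z, inB z -> F z = G z) -> mB F -> mB G.
Proof.
move=> FG; congr measurable_fun; apply/funext => x; rewrite /onB.
by case: ifP => // /FG.
Qed.

Lemma mB_cvg (F : nat -> cpt R n -> R) G : (forall k, mB (F k)) ->
  (forall z, inB z -> F k z @[k --> \oo] --> G z) -> mB G.
Proof.
move=> mF FG; apply: (measurable_fun_cvg mF) => x _; rewrite /onB.
by case: (boolP (inB _)) => [/FG //|_]; exact: cvg_cst.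
Qed.

Lemma mB_mcyl F : mB F -> mcyl (fun x => (onB F (ptx x))%:E).
Proof. by move=> mF; apply/measurable_EFinP. Qed.

Lemma onB_ge0 F : (forall z, inB z -> 0 <= F z)%R -> forall z, 0 <= (onB F z)%:E.
Proof. by move=> F0 z; rewrite lee_fin /onB; case: ifP => // /F0. Qed.

Lemma eq_nvint F G : (forall z, inB z -> F z = G z) -> nvint F = nvint G.
Proof.
move=> FG; rewrite !nvintE; congr (iint _ _ _ * _); apply/funext => x.
by rewrite /onB; case: ifP => // /FG ->.
Qed.

Lemma invvol_ge0 : 0 <= ((@vol R n)^-1)%:E.
Proof. by rewrite lee_fin invr_ge0 ltW // vol_gt0. Qed.

Lemma nvint_ge0 F : (forall z, inB z -> 0 <= F z)%R -> 0 <= nvint F.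
Proof.
move=> F0; rewrite nvintE mule_ge0 ?invvol_ge0 //.
by apply: iint_ge0 => x; exact: onB_ge0.
Qed.

Lemma le_nvint F G : mB F -> mB G -> (forall z, inB z -> 0 <= F z)%R ->
  (forall z, inB z -> F z <= G z)%R -> nvint F <= nvint G.
Proof.
move=> mF mG F0 FG; rewrite !nvintE lee_wpmul2r ?invvol_ge0 //; apply: le_iint.
- exact: mB_mcyl.
- exact: mB_mcyl.
- by move=> x; exact: onB_ge0.
- by move=> x; rewrite lee_fin /onB; case: ifP => // /FG.
Qed.

Lemma nvintD F G : mB F -> mB G -> (forall z, inB z -> 0 <= F z)%R ->
  (forall z, inB z -> 0 <= G z)%R -> nvint (fun z => F z + G z)%R = nvint F + nvint G.
Proof.
move=> mF mG F0 G0; rewrite !nvintE -muleDl; last 2 first.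
- by [].
- by apply: ge0_adde_def; rewrite inE; apply: iint_ge0 => x; exact: onB_ge0.
rewrite -iintD; [|exact: mB_mcyl|exact: mB_mcyl|by move=> x; exact: onB_ge0|by move=> x; exact: onB_ge0].
congr (iint _ _ _ * _); apply/funext => x; rewrite -EFinD /onB.
by case: ifP; rewrite ?addr0.
Qed.

Lemma nvintZ c F : mB F -> (forall z, inB z -> 0 <= F z)%R -> (0 <= c)%R ->
  nvint (fun z => c * F z)%R = c%:E * nvint F.
Proof.
move=> mF F0 c0; rewrite !nvintE muleA -iintZ //; [|exact: mB_mcyl|by move=> x; exact: onB_ge0].
congr (iint _ _ _ * _); apply/funext => x; rewrite -EFinM /onB.
by case: ifP; rewrite ?mulr0.
Qed.

Lemma nvint_fatou_le (F : nat -> cpt R n -> R) G c : (forall k, mB (F k)) -> mB G ->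
  (forall k z, inB z -> 0 <= F k z)%R -> (forall z, inB z -> 0 <= G z)%R ->
  (forall z, inB z -> F k z @[k --> \oo] --> G z) ->
  (forall k, nvint (F k) <= c%:E) -> nvint G <= c%:E.
Proof.
move=> mF mG F0 G0 FG Fc; have v0 := @vol_gt0 R n.
have H a : (a * ((@vol R n)^-1)%:E <= c%:E) = (a <= (c * @vol R n)%:E :> \bar R).
  by rewrite lee_pdivrMr // EFinM.
rewrite nvintE H; apply: (@iint_fatou_le _ (fun k x => (onB (F k) (ptx x))%:E)).
- by move=> k; exact: mB_mcyl.
- by move=> k x; exact: (onB_ge0 (F0 k)).
- exact: mB_mcyl.
- by move=> x; exact: onB_ge0.
- move=> x; rewrite /onB; apply/fine_cvgP; split; first exact: nearW.
  by case: (boolP (inB _)) => [/FG //|_]; exact: cvg_cst.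
- by move=> k; rewrite -H -nvintE.
Qed.

Lemma nvint_rotz F (u : cpt R n) : (forall i, cabs (u i) = 1%R) -> mB F ->
  (forall z, inB z -> 0 <= F z)%R ->
  mB (fun z => F (rotz u z)) /\ nvint (fun z => F (rotz u z)) = nvint F.
Proof.
move=> u1 mF F0.
have [|||mG GE] := @lebC_rotz R n (fun z => (onB F z)%:E) u => //.
- exact: mB_mcyl.
- exact: onB_ge0.
have BE z : inB (rotz u z) = inB z.
  by rewrite /inB !normsqE; under eq_bigr do rewrite /rotz cabsM u1 mul1r.
have E : (fun z => (onB F (rotz u z))%:E) = (fun z => (onB (fun z => F (rotz u z)) z)%:E).
  by apply/funext => z; rewrite /onB BE.
rewrite E in mG GE; split; first exact/measurable_EFinP.
by rewrite !nvintE; congr (_ * _).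
Qed.

Definition integ F := mB F /\ nvint (fun z => `|F z|)%R < +oo.
Definition Iv F : R := fine (nvint F).

Lemma nvintB F G : mB F -> mB G -> (forall z, inB z -> 0 <= F z)%R ->
  (forall z, inB z -> 0 <= G z)%R -> nvint F < +oo -> nvint G < +oo ->
  nvint (fun z => F z - G z)%R = nvint F - nvint G.
Proof.
move=> mF mG F0 G0; have v0 := @vol_gt0 R n.
have fin (a : \bar R) : 0 <= a -> a * ((@vol R n)^-1)%:E < +oo -> a < +oo.
  by move: a => [a||] _ //; rewrite ?ltry // gt0_mulye // lte_fin invr_gt0.
have i0 H : (forall z, inB z -> 0 <= H z)%R -> 0 <= iint (2 * n)%N (fun x => (onB H (ptx x))%:E) (fun=> 0%R).
  by move=> H0; apply: iint_ge0 => x; exact: onB_ge0.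
rewrite !nvintE => /(fin _ (i0 _ F0)) iF /(fin _ (i0 _ G0)) iG.
rewrite -muleBl; last 2 first.
- by [].
- by rewrite fin_num_adde_defl // fin_numN ge0_fin_numE // i0.
rewrite -iintB //; [|exact: mB_mcyl|exact: mB_mcyl|by move=> x; exact: onB_ge0|by move=> x; exact: onB_ge0].
congr (iint _ _ _ * _); apply/funext => x; rewrite -EFinB /onB.
by case: ifP; rewrite ?subr0.
Qed.

Lemma integ_ge0 F : mB F -> (forall z, inB z -> 0 <= F z)%R -> nvint F < +oo -> integ F.
Proof.
move=> mF F0 iF; split=> //; rewrite (@eq_nvint _ F) // => z /F0 h.
by rewrite ger0_norm.
Qed.

Lemma eq_integ F G : (forall z, inB z -> F z = G z) -> integ F -> integ G.
Proof.
move=> FG [mF iF]; split; first exact: eq_mB mF.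
by rewrite (@eq_nvint _ (fun z => `|F z|)%R) // => z /FG ->.
Qed.

Lemma eq_Iv F G : (forall z, inB z -> F z = G z) -> Iv F = Iv G.
Proof. by move=> FG; rewrite /Iv (eq_nvint FG). Qed.

Lemma nvint_Iv_ge0 F : (forall z, inB z -> 0 <= F z)%R -> nvint F < +oo -> nvint F = (Iv F)%:E.
Proof. by move=> F0 iF; rewrite /Iv fineK // ge0_fin_numE // nvint_ge0. Qed.

Lemma nvint_norm_fin F : integ F -> nvint (fun z => `|F z| - F z)%R < +oo.
Proof.
move=> [mF iF]; apply: (@le_lt_trans _ _ (nvint (fun z => 2 * `|F z|)%R)).
  apply: le_nvint.
  - by apply: mBB => //; exact: mB_norm.
  - by apply: mBZ; exact: mB_norm.
  - by move=> z _; rewrite subr_ge0 ler_norm.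
  - move=> z _; have := ler_norm (- F z)%R; rewrite normrN; lra.
rewrite nvintZ //; last exact: mB_norm.
by rewrite nvint_Iv_ge0 // ltry.
Qed.

(** The iterated integral is additive on nonnegative functions; signed ones are reached through
    [F = |F| - (|F| - F)], a difference of nonnegative integrable functions. *)
Lemma nvint_split F : integ F ->
  nvint F = (Iv (fun z => `|F z|)%R - Iv (fun z => `|F z| - F z)%R)%:E.
Proof.
move=> iF; have i2 := nvint_norm_fin iF; case: iF => mF iF.
rewrite EFinB -!nvint_Iv_ge0 -?nvintB //.
- by apply: eq_nvint => z _; ring.
- exact: mB_norm.
- by apply: mBB => //; exact: mB_norm.
- by move=> z _; rewrite subr_ge0 ler_norm.
- by move=> z _; rewrite subr_ge0 ler_norm.
Qed.

Lemma nvint_Iv F : integ F -> nvint F = (Iv F)%:E.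
Proof. by move=> iF; rewrite /Iv nvint_split. Qed.

Lemma Iv_diff F G H : integ G -> integ H -> (forall z, inB z -> 0 <= G z)%R ->
  (forall z, inB z -> 0 <= H z)%R -> (forall z, inB z -> F z = G z - H z)%R ->
  Iv F = (Iv G - Iv H)%R.
Proof.
move=> [mG iG] [mH iH] G0 H0 FE; apply/EFin_inj.
have fin K : (forall z, inB z -> 0 <= K z)%R -> nvint (fun z => `|K z|)%R < +oo -> nvint K < +oo.
  by move=> K0; rewrite (@eq_nvint _ K) // => z /K0 h; rewrite ger0_norm.
have GE := nvint_Iv_ge0 G0 (fin _ G0 iG); have HE := nvint_Iv_ge0 H0 (fin _ H0 iH).
have := nvintB mG mH G0 H0 (fin _ G0 iG) (fin _ H0 iH).
by rewrite GE HE -EFinB -(eq_nvint FE) => E; rewrite {1}/Iv E.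
Qed.

Lemma integD F G : integ F -> integ G -> integ (fun z => F z + G z)%R.
Proof.
move=> [mF iF] [mG iG]; split; first exact: mBD.
apply: (@le_lt_trans _ _ (nvint (fun z => `|F z| + `|G z|)%R)).
  apply: le_nvint; [by apply: mB_norm; exact: mBD|by apply: mBD; exact: mB_norm|by move=> z _|].
  by move=> z _; exact: ler_normD.
rewrite nvintD ?lte_add_pinfty //; exact: mB_norm.
Qed.

Lemma integZ c F : integ F -> integ (fun z => c * F z)%R.
Proof.
move=> [mF iF]; split; first exact: mBZ.
rewrite (@eq_nvint _ (fun z => `|c| * `|F z|)%R) => [|z _]; last exact: normrM.
rewrite nvintZ //; last exact: mB_norm.
by rewrite nvint_Iv_ge0 // ltry.
Qed.

Lemma integ_norm F : integ F -> integ (fun z => `|F z|)%R.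
Proof. by move=> [mF iF]; apply: integ_ge0 => //; exact: mB_norm. Qed.

Lemma integ_le F G : mB F -> integ G -> (forall z, inB z -> `|F z| <= G z)%R -> integ F.
Proof.
move=> mF [mG iG] FG; split=> //; apply: le_lt_trans iG; apply: le_nvint => //.
- exact: mB_norm.
- exact: mB_norm.
- by move=> z /FG h; rewrite (le_trans h) // ler_norm.
Qed.

Lemma integ_normB F : integ F -> integ (fun z => `|F z| - F z)%R.
Proof.
move=> iF; apply: eq_integ (integD (integ_norm iF) (integZ (-1) iF)) => z _.
by rewrite mulN1r.
Qed.

Lemma IvE F : integ F -> Iv F = (Iv (fun z => `|F z|) - Iv (fun z => `|F z| - F z))%R.
Proof. by move=> iF; rewrite {1}/Iv nvint_split. Qed.

Lemma Iv_addp F G : integ F -> integ G -> (forall z, inB z -> 0 <= F z)%R ->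
  (forall z, inB z -> 0 <= G z)%R -> Iv (fun z => F z + G z)%R = (Iv F + Iv G)%R.
Proof.
move=> iF iG F0 G0; apply/EFin_inj; rewrite EFinD -!nvint_Iv //; last exact: integD.
by apply: nvintD => //; [case: iF|case: iG].
Qed.

Lemma IvD F G : integ F -> integ G -> Iv (fun z => F z + G z)%R = (Iv F + Iv G)%R.
Proof.
move=> iF iG; have nF := integ_norm iF; have nG := integ_norm iG.
have dF := integ_normB iF; have dG := integ_normB iG.
have d0 (H : cpt R n -> R) z : inB z -> (0 <= `|H z| - H z)%R by rewrite subr_ge0 ler_norm.
rewrite (@Iv_diff _ (fun z => `|F z| + `|G z|)%R (fun z => (`|F z| - F z) + (`|G z| - G z))%R).
- rewrite (@Iv_addp (fun z => `|F z|)%R (fun z => `|G z|)%R) //.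
  rewrite (@Iv_addp (fun z => `|F z| - F z)%R (fun z => `|G z| - G z)%R dF dG (d0 F) (d0 G)).
  by rewrite (IvE iF) (IvE iG); ring.
- exact: integD.
- exact: integD.
- by move=> z _; rewrite addr_ge0.
- by move=> z zB; rewrite addr_ge0 // d0.
- by move=> z _; ring.
Qed.

Lemma IvN F : integ F -> Iv (fun z => - F z)%R = (- Iv F)%R.
Proof.
move=> iF; rewrite (@Iv_diff _ (fun z => `|F z| - F z)%R (fun z => `|F z|)%R).
- by rewrite (IvE iF); ring.
- exact: integ_normB.
- exact: integ_norm.
- by move=> z _; rewrite subr_ge0 ler_norm.
- by [].
- by move=> z _; ring.
Qed.

Lemma Iv_ge0 F : (forall z, inB z -> 0 <= F z)%R -> (0 <= Iv F)%R.
Proof. by move=> F0; rewrite fine_ge0 // nvint_ge0. Qed.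

Lemma IvZ c F : integ F -> Iv (fun z => c * F z)%R = (c * Iv F)%R.
Proof.
move=> iF.
have pos (b : R) : (0 <= b)%R -> Iv (fun z => b * F z)%R = (b * Iv F)%R.
  move=> b0; have nF := integ_norm iF; have dF := integ_normB iF.
  have Z H : integ H -> (forall z, inB z -> 0 <= H z)%R -> Iv (fun z => b * H z)%R = (b * Iv H)%R.
    move=> iH H0; apply/EFin_inj; rewrite EFinM -!nvint_Iv //; last exact: integZ.
    by apply: nvintZ => //; case: iH.
  have d0 z : inB z -> (0 <= `|F z| - F z)%R by rewrite subr_ge0 ler_norm.
  rewrite (@Iv_diff _ (fun z => b * `|F z|)%R (fun z => b * (`|F z| - F z))%R).
  - by rewrite !Z // (IvE iF); ring.
  - exact: integZ.
  - exact: integZ.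
  - by move=> z _; rewrite mulr_ge0.
  - by move=> z zB; rewrite mulr_ge0 // d0.
  - by move=> z _; ring.
have [c0|c0] := leP 0%R c; first exact: pos.
have c0' : (0 <= - c)%R by rewrite oppr_ge0 ltW.
rewrite (@eq_Iv _ (fun z => - (- c * F z))%R) => [|z _]; last by ring.
by rewrite IvN ?pos //; [ring|exact: integZ].
Qed.

Lemma le_Iv F G : integ F -> integ G -> (forall z, inB z -> F z <= G z)%R -> (Iv F <= Iv G)%R.
Proof.
move=> iF iG FG; rewrite -subr_ge0.
rewrite (_ : (_ - _)%R = Iv (fun z => G z + -1 * F z)%R).
  by apply: Iv_ge0 => z /FG h; lra.
by rewrite IvD ?IvZ //; [ring|exact: integZ].
Qed.

End NormalizedIntegral.

(** * Squared norm and real inner product *)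

Section SquareIntegrable.
Context {R : realType} {n : nat}.
Implicit Types (u v w : cpt R n -> R[i]) (z : cpt R n) (t : R) (c : R[i]).

Definition mBC u := mB (fun z => complex.Re (u z)) /\ mB (fun z => complex.Im (u z)).
Definition L2 u := mBC u /\ (bnorm2 u < +oo)%E.
Definition nrm u : R := Iv (fun z => abs2 (u z)).
(** Only the real part is carried along: by [ip_im_re] the imaginary part is the real part for
    [- i u], and [P] is a complex subspace. *)
Definition rip u v : R := Iv (fun z => complex.Re (u z * cconj (v z))).

Lemma ReM (a b : R[i]) : complex.Re (a * b) = complex.Re a * complex.Re b - complex.Im a * complex.Im b.
Proof. by case: a b => [? ?] [? ?]. Qed.

Lemma ImM (a b : R[i]) : complex.Im (a * b) = complex.Re a * complex.Im b + complex.Im a * complex.Re b.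
Proof. by case: a b => [? ?] [? ?]. Qed.

Lemma ReD (a b : R[i]) : complex.Re (a + b) = complex.Re a + complex.Re b.
Proof. by case: a b => [? ?] [? ?]. Qed.

Lemma ImD (a b : R[i]) : complex.Im (a + b) = complex.Im a + complex.Im b.
Proof. by case: a b => [? ?] [? ?]. Qed.

Lemma mBC_cst c : mBC (fun=> c).
Proof. by split; exact: mB_cst. Qed.

Lemma mBC_coord (i : 'I_n) : mBC (fun z => z i).
Proof. by split; [exact: mB_Re|exact: mB_Im]. Qed.

Lemma eq_mBC u v : (forall z, inB z -> u z = v z) -> mBC u -> mBC v.
Proof. by move=> uv [h1 h2]; split; [apply: eq_mB h1|apply: eq_mB h2] => z /uv ->. Qed.

Lemma mBCD u v : mBC u -> mBC v -> mBC (fun z => u z + v z).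
Proof.
move=> [u1 u2] [v1 v2]; split.
  by apply: eq_mB (mBD u1 v1) => z _; rewrite ReD.
by apply: eq_mB (mBD u2 v2) => z _; rewrite ImD.
Qed.

Lemma mBCM u v : mBC u -> mBC v -> mBC (fun z => u z * v z).
Proof.
move=> [u1 u2] [v1 v2]; split.
  by apply: eq_mB (mBB (mBM u1 v1) (mBM u2 v2)) => z _; rewrite ReM.
by apply: eq_mB (mBD (mBM u1 v2) (mBM u2 v1)) => z _; rewrite ImM.
Qed.

Lemma mBC_conj u : mBC u -> mBC (fun z => cconj (u z)).
Proof.
move=> [u1 u2]; split => //; apply: eq_mB (mBZ (-1) u2) => z _.
by rewrite /= mulN1r.
Qed.

Lemma mBC_sum (I : Type) (s : seq I) (F : I -> cpt R n -> R[i]) : (forall i, mBC (F i)) ->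
  mBC (fun z => \sum_(i <- s) F i z).
Proof.
move=> mF; elim: s => [|i s IH].
  by under eq_fun do rewrite big_nil; exact: mBC_cst.
by under eq_fun do rewrite big_cons; exact: mBCD.
Qed.

Lemma mBC_mpow (a : mindex n) : mBC (fun z => mpow z a).
Proof.
have mX (i : 'I_n) k : mBC (fun z => z i ^+ k).
  elim: k => [|k IH]; first by under eq_fun do rewrite expr0; exact: mBC_cst.
  by under eq_fun do rewrite exprS; apply: mBCM => //; exact: mBC_coord.
rewrite /mpow; elim: (index_enum _) => [|i s IH].
  by under eq_fun do rewrite big_nil; exact: mBC_cst.
by under eq_fun do rewrite big_cons; exact: mBCM.
Qed.

Lemma mBC_psum (c : mindex n -> R[i]) K : mBC (psum c K).
Proof. by apply: mBC_sum => a; apply: mBCM; [exact: mBC_cst|exact: mBC_mpow]. Qed.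

Lemma mB_abs2 u : mBC u -> mB (fun z => abs2 (u z)).
Proof. by move=> [u1 u2]; apply: eq_mB (mBD (mBM u1 u1) (mBM u2 u2)). Qed.

Lemma ccvg_Re (u : nat -> R[i]) l : ccvg u l -> complex.Re (u k) @[k --> \oo] --> complex.Re l.
Proof.
move=> h; apply/cvgrPdist_lt => e e0; have [N HN] := h e e0.
exists N => // k /= /HN; apply: le_lt_trans; rewrite cabsB.
by rewrite (le_trans _ (normr_Re _)) //; case: l {h HN} (u k) => [? ?] [? ?].
Qed.

Lemma ccvg_Im (u : nat -> R[i]) l : ccvg u l -> complex.Im (u k) @[k --> \oo] --> complex.Im l.
Proof.
move=> h; apply/cvgrPdist_lt => e e0; have [N HN] := h e e0.
exists N => // k /= /HN; apply: le_lt_trans; rewrite cabsB.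
by rewrite (le_trans _ (normr_Im _)) //; case: l {h HN} (u k) => [? ?] [? ?].
Qed.

Lemma ccvg_abs2 (u : nat -> R[i]) l : ccvg u l -> abs2 (u k) @[k --> \oo] --> abs2 l.
Proof.
move=> h; rewrite /abs2 !expr2.
by apply: cvgD; apply: cvgM; try exact: ccvg_Re; exact: ccvg_Im.
Qed.

Lemma mBC_cvg (u : nat -> cpt R n -> R[i]) v : (forall k, mBC (u k)) ->
  (forall z, inB z -> ccvg (fun k => u k z) (v z)) -> mBC v.
Proof.
move=> mu uv; split.
  by apply: mB_cvg (fun k => (mu k).1) _ => z /uv /ccvg_Re.
by apply: mB_cvg (fun k => (mu k).2) _ => z /uv /ccvg_Im.
Qed.

Lemma bnorm2E u : bnorm2 u = nvint (fun z => abs2 (u z)).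
Proof. by []. Qed.

Lemma integ_abs2 u : L2 u -> integ (fun z => abs2 (u z)).
Proof.
by move=> [mu iu]; apply: integ_ge0 => //; [exact: mB_abs2|move=> z _; exact: abs2_ge0].
Qed.

Lemma L2_integ u : mBC u -> integ (fun z => abs2 (u z)) -> L2 u.
Proof. by move=> mu iu; split=> //; rewrite bnorm2E nvint_Iv // ltry. Qed.

Lemma bnorm2_nrm u : L2 u -> bnorm2 u = (nrm u)%:E.
Proof. by move=> /integ_abs2; exact: nvint_Iv. Qed.

Lemma nrm_ge0 u : 0 <= nrm u.
Proof. by apply: Iv_ge0 => z _; exact: abs2_ge0. Qed.

Lemma eq_nrm u v : (forall z, inB z -> u z = v z) -> nrm u = nrm v.
Proof. by move=> uv; apply: eq_Iv => z /uv ->. Qed.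

Lemma eq_L2 u v : (forall z, inB z -> u z = v z) -> L2 u -> L2 v.
Proof.
move=> uv [mu iu]; split; first exact: eq_mBC mu.
by move: iu; rewrite !bnorm2E (@eq_nvint _ _ _ (fun z => abs2 (v z))) // => z /uv ->.
Qed.

Lemma abs2D_le (a b : R[i]) : abs2 (a + b) <= 2 * abs2 a + 2 * abs2 b.
Proof.
case: a b => [a a'] [b b']; rewrite /abs2 /=.
by have := sqr_ge0 (a - b); have := sqr_ge0 (a' - b'); lra.
Qed.

Lemma ReMconj_le (a b : R[i]) : `|complex.Re (a * cconj b)| <= abs2 a + abs2 b.
Proof.
case: a b => [a a'] [b b']; rewrite /abs2 /=.
have := sqr_ge0 (a - b); have := sqr_ge0 (a' - b'); have := sqr_ge0 (a + b); have := sqr_ge0 (a' + b').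
by rewrite ler_norml => *; apply/andP; split; lra.
Qed.

Lemma L2D u v : L2 u -> L2 v -> L2 (fun z => u z + v z).
Proof.
move=> hu hv; have [iu iv] := (integ_abs2 hu, integ_abs2 hv).
have m := mBCD hu.1 hv.1; apply: L2_integ => //.
apply: integ_le (mB_abs2 m) (integD (integZ 2 iu) (integZ 2 iv)) _ => z _.
by rewrite ger0_norm ?abs2_ge0 // abs2D_le.
Qed.

(** Norms stay squared throughout; this takes the place of the triangle inequality. *)
Lemma nrmD_le u v : L2 u -> L2 v -> nrm (fun z => u z + v z) <= 2 * nrm u + 2 * nrm v.
Proof.
move=> hu hv; have [iu iv] := (integ_abs2 hu, integ_abs2 hv).
rewrite /nrm -(IvZ _ iu) -(IvZ _ iv) -IvD; [|exact: integZ|exact: integZ].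
apply: le_Iv; [exact/integ_abs2/L2D|by apply: integD; exact: integZ|by move=> z _; exact: abs2D_le].
Qed.

Lemma L2_bound u w t : mBC w -> (forall z, inB z -> abs2 (w z) <= t) -> L2 u ->
  L2 (fun z => w z * u z) /\ nrm (fun z => w z * u z) <= t * nrm u.
Proof.
move=> mw wt hu; have iu := integ_abs2 hu.
have h : L2 (fun z => w z * u z).
  have m := mBCM mw hu.1; apply: L2_integ => //.
  apply: integ_le (mB_abs2 m) (integZ t iu) _ => z zB.
  by rewrite ger0_norm ?abs2_ge0 // abs2M ler_wpM2r ?abs2_ge0 // wt.
split=> //; rewrite /nrm -IvZ //; apply: le_Iv; [exact: integ_abs2|exact: integZ|].
by move=> z zB; rewrite abs2M ler_wpM2r ?abs2_ge0 // wt.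
Qed.

Lemma L2Z u c : L2 u -> L2 (fun z => c * u z).
Proof. by move=> hu; have [] := L2_bound (mBC_cst c) (fun z _ => lexx _) hu. Qed.

Lemma L2B u v : L2 u -> L2 v -> L2 (fun z => u z - v z).
Proof.
move=> hu hv; apply: eq_L2 (L2D hu (L2Z (-1) hv)) => z _.
by rewrite mulN1r.
Qed.

Lemma nrmZ u c : L2 u -> nrm (fun z => c * u z) = abs2 c * nrm u.
Proof.
move=> hu; rewrite /nrm -IvZ; last exact: integ_abs2.
by apply: eq_Iv => z _; rewrite abs2M.
Qed.

Lemma nrmB_le u v : L2 u -> L2 v -> nrm (fun z => u z - v z) <= 2 * nrm u + 2 * nrm v.
Proof.
move=> hu hv; have := nrmD_le hu (L2Z (-1) hv).
rewrite nrmZ // (_ : abs2 (-1) = 1) ?mul1r; last by rewrite abs2E cabsN cabs1 expr1n.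
by rewrite (@eq_nrm _ (fun z => u z - v z)) // => z _; rewrite mulN1r.
Qed.

Lemma L2_0 : L2 (fun=> 0).
Proof.
split; first exact: mBC_cst.
rewrite bnorm2E (@eq_nvint _ _ _ (fun=> 0 * 0)) => [|z _]; last by rewrite /abs2 /= expr0n mul0r addr0.
by rewrite nvintZ ?mul0e //; exact: mB_cst.
Qed.

Lemma L2_coord u (i : 'I_n) : L2 u -> L2 (mulz i u) /\ nrm (mulz i u) <= nrm u.
Proof.
move=> hu; have [|? ?] := @L2_bound u (fun z => z i) 1 (mBC_coord i) _ hu; last by split; rewrite // -[leRHS]mul1r.
by move=> z zB; rewrite abs2E (le_trans (cabs_le_normsq z i)) // ltW.
Qed.

Definition conjz (i : 'I_n) u : cpt R n -> R[i] := fun z => cconj (z i) * u z.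

Lemma L2_conjz u (i : 'I_n) : L2 u -> L2 (conjz i u) /\ nrm (conjz i u) <= nrm u.
Proof.
move=> hu; have [|? ?] := @L2_bound u (fun z => cconj (z i)) 1 (mBC_conj (mBC_coord i)) _ hu; last by split; rewrite // -[leRHS]mul1r.
by move=> z zB; rewrite abs2E cabs_conj (le_trans (cabs_le_normsq z i)) // ltW.
Qed.

Lemma integ_rip u v : L2 u -> L2 v -> integ (fun z => complex.Re (u z * cconj (v z))).
Proof.
move=> hu hv; have [iu iv] := (integ_abs2 hu, integ_abs2 hv).
apply: integ_le (integD iu iv) _; last by move=> z _; exact: ReMconj_le.
by have [] := mBCM hu.1 (mBC_conj hv.1).
Qed.

Lemma ip_re_rip u v : L2 u -> L2 v -> ip_re u v = (rip u v)%:E.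
Proof. by move=> hu hv; apply: nvint_Iv; exact: integ_rip. Qed.

Lemma ip_im_re u v : ip_im u v = ip_re (fun z => - 'i%C * u z) v.
Proof.
congr vint; apply/funext => z; congr EFin.
by case: (u z) (v z) => [? ?] [? ?] /=; ring.
Qed.

Lemma rip_sym u v : rip u v = rip v u.
Proof. by apply: eq_Iv => z _; case: (u z) (v z) => [? ?] [? ?] /=; ring. Qed.

Lemma ripD u v w : L2 u -> L2 v -> L2 w -> rip (fun z => u z + v z) w = rip u w + rip v w.
Proof.
move=> hu hv hw; rewrite /rip -IvD; [|exact: integ_rip|exact: integ_rip].
by apply: eq_Iv => z _; rewrite mulrDl ReD.
Qed.

Lemma ripZ u v t : L2 u -> L2 v -> rip (fun z => t%:C%C * u z) v = t * rip u v.
Proof.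
move=> hu hv; rewrite /rip -IvZ; last exact: integ_rip.
by apply: eq_Iv => z _; rewrite -mulrA ReM /= mul0r subr0.
Qed.

Lemma nrm_expand u v t : L2 u -> L2 v ->
  nrm (fun z => u z + t%:C%C * v z) = nrm u + 2 * t * rip u v + t ^+ 2 * nrm v.
Proof.
move=> hu hv; have [iu iv] := (integ_abs2 hu, integ_abs2 hv); have ir := integ_rip hu hv.
rewrite /nrm /rip -(IvZ _ ir) -(IvZ _ iv) -IvD //; last exact: integZ.
rewrite -IvD; [|by apply: integD => //; exact: integZ|exact: integZ].
by apply: eq_Iv => z _; case: (u z) (v z) => [? ?] [? ?]; rewrite /abs2 /=; ring.
Qed.

Lemma nrm_fatou (u : nat -> cpt R n -> R[i]) v (B : R) : (forall k, L2 (u k)) ->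
  (forall z, inB z -> ccvg (fun k => u k z) (v z)) -> (forall k, nrm (u k) <= B) ->
  L2 v /\ nrm v <= B.
Proof.
move=> hu uv uB; have mv : mBC v by apply: mBC_cvg uv => k; exact: (hu k).1.
have le : (bnorm2 v <= B%:E)%E.
  apply: (@nvint_fatou_le _ _ (fun k z => abs2 (u k z))).
  - by move=> k; apply: mB_abs2; exact: (hu k).1.
  - exact: mB_abs2.
  - by move=> k z _; exact: abs2_ge0.
  - by move=> z _; exact: abs2_ge0.
  - by move=> z /uv /ccvg_abs2.
  - by move=> k; rewrite -bnorm2E bnorm2_nrm // lee_fin.
have hv : L2 v by split=> //; rewrite (le_lt_trans le) // ltry.
by split=> //; rewrite -lee_fin -bnorm2_nrm.
Qed.

(** On the ball [u] is the pointwise limit of its Taylor polynomials, which are measurable for the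
    cylinder sigma-algebra. *)
Lemma holoB_mBC u : holoB u -> mBC u.
Proof.
move=> /holoB_power_series[A HA]; apply: (mBC_cvg (mBC_psum A)) => z zB.
have [C [q [q0 q1 H]]] := HA z zB.
move=> e e0; have [K0 HK] := @gtail_small R n q C e q0 q1 e0.
by exists K0 => K /HK; apply: le_lt_trans; exact: H.
Qed.

Lemma bergman_L2 u : bergman u -> L2 u.
Proof. by move=> [hu iu]; split=> //; exact: holoB_mBC. Qed.

End SquareIntegrable.

(** * Fourier analysis on finite tori *)

Section FourierAveraging.
Context {R : realType} {n : nat}.
Implicit Types (u z : cpt R n) (c d A : mindex n -> R[i]) (a b : mindex n).

Definition utorus N (l : {ffun 'I_n -> 'I_N}) : cpt R n := torus (fun=> 1) l.
Definition ucoef N (g : cpt R n -> R[i]) a : R[i] := torus_coef N (fun=> 1) g a.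

Lemma mul_cconj (z : R[i]) : z * cconj z = ((abs2 z)%:C)%C.
Proof. by case: z => x y; apply/eqP; rewrite eq_complex /abs2 /=; apply/andP; split; apply/eqP; ring. Qed.

Lemma cconj_unit (z : R[i]) : cabs z = 1 -> cconj z = z^-1.
Proof.
move=> z1; have z0 : z != 0 by rewrite -cabs_gt0 z1.
by apply: (mulfI z0); rewrite mul_cconj abs2E z1 expr1n divff.
Qed.

Lemma cconjM (z w : R[i]) : cconj (z * w) = cconj z * cconj w.
Proof. by rewrite !cconjE rmorphM. Qed.

Lemma cconj_sum (I : Type) (s : seq I) (F : I -> R[i]) :
  cconj (\sum_(i <- s) F i) = \sum_(i <- s) cconj (F i).
Proof. by rewrite cconjE rmorph_sum; apply: eq_bigr => i _; rewrite cconjE. Qed.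

Lemma cabs_utorus N (l : {ffun 'I_n -> 'I_N}) i : cabs (utorus l i) = 1.
Proof. by rewrite cabs_torus. Qed.

Lemma cabs_mpow_unit u a : (forall i, cabs (u i) = 1) -> cabs (mpow u a) = 1.
Proof. by move=> u1; rewrite /mpow cabs_prod big1 // => i _; rewrite cabsX u1 expr1n. Qed.

Lemma box_mono K N a : (K <= N)%N -> a \in box (n:=n) K -> a \in box (n:=n) N.
Proof. by rewrite !mem_box => KN /forallP H; apply/forallP => i; exact: leq_trans (H i) KN. Qed.

Lemma ucoef_box d K N a : (K <= N)%N -> a \in box (n:=n) K ->
  ucoef N (fun u => \sum_(b <- box (n:=n) K) d b * mpow u b) a = d a.
Proof.
move=> KN aK.
have -> : ucoef N (fun u => \sum_(b <- box (n:=n) K) d b * mpow u b) a =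
    \sum_(b <- box (n:=n) K) d b * ucoef N (fun u => mpow u b) a.
  rewrite /ucoef /torus_coef; under [RHS]eq_bigr do rewrite mulrCA.
  rewrite -mulr_sumr; congr (_ * _); under [RHS]eq_bigr do rewrite mulr_sumr.
  rewrite exchange_big /=; apply: eq_bigr => l _; rewrite mulr_suml.
  by apply: eq_bigr => b _; rewrite mulrA.
rewrite (bigD1_seq a) ?box_uniq //= /ucoef torus_coef_mpow ?(box_mono KN) // eqxx mulr1.
rewrite big_seq_cond big1 ?addr0 // => b /andP[bK ba].
by rewrite torus_coef_mpow ?(box_mono KN) // eq_sym (negbTE ba) mulr0.
Qed.

Definition uavg N (g : cpt R n -> R[i]) : R[i] := (N ^ n)%:R^-1 * \sum_(l : {ffun 'I_n -> 'I_N}) g (utorus l).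

Lemma uavg_conj N K g d : uavg N (fun u => g u * cconj (\sum_(a <- box (n:=n) K) d a * mpow u a)) =
  \sum_(a <- box (n:=n) K) cconj (d a) * ucoef N g a.
Proof.
rewrite /ucoef /torus_coef; under [RHS]eq_bigr do rewrite mulrCA.
rewrite -mulr_sumr; congr (_ * _); under [RHS]eq_bigr do rewrite mulr_sumr.
rewrite exchange_big /=; apply: eq_bigr => l _; rewrite cconj_sum mulr_sumr.
apply: eq_bigr => a _; rewrite cconjM (cconj_unit (cabs_mpow_unit a (cabs_utorus l))).
exact: mulrCA.
Qed.

Definition ravg N (g : cpt R n -> R) : R := (N ^ n)%:R^-1 * \sum_(l : {ffun 'I_n -> 'I_N}) g (utorus l).

Lemma ravg_uavg N g : uavg N (fun u => ((g u)%:C)%C) = ((ravg N g)%:C)%C.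
Proof.
rewrite /uavg /ravg rmorphM /= fmorphV rmorph_nat rmorph_sum //.
Qed.

Lemma ravg_expand N g h : ravg N (fun u => abs2 (g u - h u)) =
  ravg N (fun u => abs2 (g u)) - 2 * complex.Re (uavg N (fun u => g u * cconj (h u)))
    + ravg N (fun u => abs2 (h u)).
Proof.
have -> : complex.Re (uavg N (fun u => g u * cconj (h u))) =
    ravg N (fun u => complex.Re (g u * cconj (h u))).
  rewrite /uavg /ravg ReM -(rmorph_nat (real_complex R)) -fmorphV /= mul0r subr0; congr (_ * _).
  elim: (index_enum _) => [|l s IH]; first by rewrite !big_nil.
  by rewrite !big_cons ReD IH.
rewrite /ravg; set k := (N ^ n)%:R^-1.
transitivity (k * \sum_(l : {ffun 'I_n -> 'I_N}) (abs2 (g (utorus l))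
   - 2 * complex.Re (g (utorus l) * cconj (h (utorus l))) + abs2 (h (utorus l)))).
  congr (_ * _); apply: eq_bigr => l _.
  by case: (g _) (h _) => [? ?] [? ?]; rewrite /abs2 /=; ring.
rewrite big_split /= sumrB -mulr_sumr; ring.
Qed.

(** No limit is involved: characters with exponents below [N] are orthonormal on the finite
    torus. *)
Lemma ravg_parseval d K N : (K <= N)%N ->
  ravg N (fun u => abs2 (\sum_(a <- box (n:=n) K) d a * mpow u a)) = \sum_(a <- box (n:=n) K) abs2 (d a).
Proof.
move=> KN; apply: (@complexI R); rewrite -ravg_uavg.
under eq_fun do rewrite -mul_cconj.
rewrite uavg_conj rmorph_sum; apply: eq_big_seq => a aK.
by rewrite ucoef_box // mulrC mul_cconj.
Qed.

Lemma ravg_bessel g K N : (K <= N)%N ->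
  \sum_(a <- box (n:=n) K) abs2 (ucoef N g a) <= ravg N (fun u => abs2 (g u)).
Proof.
move=> KN; pose d a := ucoef N g a.
have : 0 <= ravg N (fun u => abs2 (g u - \sum_(a <- box (n:=n) K) d a * mpow u a)).
  by rewrite mulr_ge0 ?invr_ge0 // sumr_ge0 // => l _; exact: abs2_ge0.
rewrite ravg_expand ravg_parseval // uavg_conj.
have -> : complex.Re (\sum_(a <- box (n:=n) K) cconj (d a) * ucoef N g a) = \sum_(a <- box (n:=n) K) abs2 (d a).
  rewrite (eq_bigr (fun a => ((abs2 (d a))%:C)%C)) -?rmorph_sum // => a _.
  by rewrite mulrC mul_cconj.
rewrite /d; lra.
Qed.

End FourierAveraging.

(** * Parseval's identity for the volume integral *)

Section Parseval.
Context {R : realType} {n : nat}.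
Implicit Types (u z : cpt R n) (c d A : mindex n -> R[i]) (a b : mindex n).

Lemma integ_sum (I : Type) (s : seq I) (F : I -> cpt R n -> R) : (forall i, integ (F i)) ->
  integ (fun z => \sum_(i <- s) F i z).
Proof.
move=> iF; elim: s => [|i s IH].
  apply: eq_integ (integ_abs2 L2_0) => z _; by rewrite big_nil /abs2 /= expr0n addr0.
by apply: eq_integ (integD (iF i) IH) => z _; rewrite big_cons.
Qed.

Lemma Iv_sum (I : Type) (s : seq I) (F : I -> cpt R n -> R) : (forall i, integ (F i)) ->
  Iv (fun z => \sum_(i <- s) F i z) = \sum_(i <- s) Iv (F i).
Proof.
move=> iF; elim: s => [|i s IH].
  rewrite big_nil (@eq_Iv _ _ _ (fun z => 0 * abs2 0)) => [|z _]; last by rewrite big_nil mul0r.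
  by rewrite (IvZ 0 (integ_abs2 L2_0)) mul0r.
rewrite big_cons -IH -(IvD (iF i) (integ_sum _ iF)).
by apply: eq_Iv => z _; rewrite big_cons.
Qed.

Lemma integ_rotz (F : cpt R n -> R) u : (forall i, cabs (u i) = 1) -> integ F ->
  (forall z, inB z -> 0 <= F z) -> integ (fun z => F (rotz u z)) /\ Iv (fun z => F (rotz u z)) = Iv F.
Proof.
move=> u1 [mF iF] F0; have [mG GE] := nvint_rotz u1 mF F0.
have BE z : inB (rotz u z) = inB z.
  by rewrite /inB !normsqE; under eq_bigr do rewrite /rotz cabsM u1 mul1r.
split; last by rewrite /Iv GE.
apply: integ_ge0 => //; first by move=> z zB; apply: F0; rewrite BE.
by rewrite GE (@eq_nvint _ _ _ (fun z => `|F z|)) // => z /F0 h; rewrite ger0_norm.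
Qed.

Lemma nrm_ravg (f : cpt R n -> R[i]) N : (0 < N)%N -> L2 f ->
  integ (fun z => ravg N (fun u => abs2 (f (rotz u z)))) /\
  Iv (fun z => ravg N (fun u => abs2 (f (rotz u z)))) = nrm f.
Proof.
move=> N0 hf.
have H (l : {ffun 'I_n -> 'I_N}) : integ (fun z => abs2 (f (rotz (utorus l) z))) /\
    Iv (fun z => abs2 (f (rotz (utorus l) z))) = nrm f.
  have [|i1 i2] := @integ_rotz (fun z => abs2 (f z)) (utorus l) (cabs_utorus l) (integ_abs2 hf).
    by move=> z _; exact: abs2_ge0.
  by [].
have iS : integ (fun z => \sum_(l : {ffun 'I_n -> 'I_N}) abs2 (f (rotz (utorus l) z))).
  by apply: integ_sum => l; exact: (H l).1.
split; first exact: integZ.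
rewrite /ravg IvZ // Iv_sum => [|l]; last exact: (H l).1.
rewrite (eq_bigr (fun=> nrm f)) => [|l _]; last exact: (H l).2.
rewrite sumr_const card_ffun !card_ord -[nrm f *+ _]mulr_natl mulrA mulVf ?mul1r //.
by rewrite pnatr_eq0 -lt0n expn_gt0 N0.
Qed.

Lemma L2_sum (I : Type) (s : seq I) (F : I -> cpt R n -> R[i]) : (forall i, L2 (F i)) ->
  L2 (fun z => \sum_(i <- s) F i z).
Proof.
move=> iF; elim: s => [|i s IH]; first by under eq_fun do rewrite big_nil; exact: L2_0.
by under eq_fun do rewrite big_cons; exact: L2D.
Qed.

(** Functions that transform by distinct characters of the torus are orthogonal: average over
    rotations at each fixed [z], then use [ravg_parseval]. The common factor [w] admits families
    such as [\bar z_j z^a]. *)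
Lemma nrm_parseval (phi : mindex n -> cpt R n -> R[i]) (w : cpt R n -> R[i]) c K :
  (forall a, L2 (phi a)) -> (forall u, (forall i, cabs (u i) = 1) -> cabs (w u) = 1) ->
  (forall u, (forall i, cabs (u i) = 1) -> forall a z, phi a (rotz u z) = w u * mpow u a * phi a z) ->
  nrm (fun z => \sum_(a <- box (n:=n) K) c a * phi a z) = \sum_(a <- box (n:=n) K) abs2 (c a) * nrm (phi a).
Proof.
move=> Lphi w1 phiE.
have LF a : L2 (fun z => c a * phi a z) by exact: L2Z.
have [_ <-] := nrm_ravg (ltn0Sn K) (L2_sum (box (n:=n) K) LF).
rewrite (@eq_Iv _ _ _ (fun z => \sum_(a <- box (n:=n) K) abs2 (c a * phi a z))) => [|z _].
  rewrite Iv_sum => [|a]; last exact/integ_abs2.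
  by apply: eq_bigr => a _; rewrite -nrmZ.
rewrite -(ravg_parseval _ (leqnSn K)) /ravg; congr (_ * _); apply: eq_bigr => l _.
have u1 := @cabs_utorus R n _ l.
rewrite -[RHS]mul1r -[1](expr1n _ 2) -(w1 _ u1) -abs2E -abs2M mulr_sumr; congr abs2.
by apply: eq_bigr => a _; rewrite phiE //; ring.
Qed.

Lemma mpow_rotz u z a : mpow (rotz u z) a = mpow u a * mpow z a.
Proof. by rewrite /mpow -big_split; apply: eq_bigr => i _; rewrite exprMn. Qed.

Lemma abs2_mpow z a : abs2 (mpow z a) = xmono a z.
Proof.
rewrite abs2E /mpow cabs_prod -prodrXl; apply: eq_bigr => i _.
by rewrite cabsX exprAC -abs2E.
Qed.

Lemma L2_mpow a : L2 (fun z : cpt R n => mpow z a) /\ nrm (fun z : cpt R n => mpow z a) = omega (R := R) a.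
Proof.
have E : bnorm2 (fun z : cpt R n => mpow z a) = (omega a)%:E.
  by rewrite -vint_xmono; congr vint; apply/funext => z; rewrite abs2_mpow.
have h : L2 (fun z : cpt R n => mpow z a) by split; [exact: mBC_mpow|rewrite E ltry].
by split=> //; apply/EFin_inj; rewrite -bnorm2_nrm.
Qed.

Lemma omega_gt0 a : 0 < omega (R := R) a.
Proof.
rewrite /omega divr_gt0 ?mulr_gt0 ?ltr0n ?fact_gt0 //.
by apply: prodr_gt0 => i _; rewrite ltr0n fact_gt0.
Qed.

(** The squared norm of [psum c K], by [nrm_psum]. *)
Definition csum c K : R := \sum_(a <- box (n:=n) K) abs2 (c a) * omega a.

Lemma csum_ge0 c K : 0 <= csum c K.
Proof. by apply: sumr_ge0 => a _; rewrite mulr_ge0 ?abs2_ge0 // ltW // omega_gt0. Qed.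

Lemma L2_psum c K : L2 (psum c K).
Proof. by apply: L2_sum => a; apply: L2Z; exact: (L2_mpow a).1. Qed.

Lemma nrm_psum c K : nrm (psum c K) = csum c K.
Proof.
rewrite /psum (@nrm_parseval (fun a z => mpow z a) (fun=> 1)) //.
- by apply: eq_bigr => a _; rewrite (L2_mpow a).2.
- by move=> a; exact: (L2_mpow a).1.
- by move=> u _; exact: cabs1.
- by move=> u _ a z; rewrite mul1r mpow_rotz.
Qed.

(** The bound is uniform over the closed polydisc through [z], so it covers all rotations of [z]
    that enter a torus average. *)
Definition series_of f A := forall z, inB z -> exists C q : R, [/\ 0 <= q, q < 1 &
  forall w, (forall i, cabs (w i) <= cabs (z i)) ->
    forall K, cabs (psum A K w - f w) <= C * gtail (n := n) q K].

Lemma series_ccvg f A z : series_of f A -> inB z -> ccvg (fun K => psum A K z) (f z).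
Proof.
move=> HA zB; have [C [q [q0 q1 H]]] := HA z zB.
move=> e e0; have [K0 HK] := @gtail_small R n q C e q0 q1 e0.
by exists K0 => K /HK; apply: le_lt_trans; exact: H.
Qed.

Lemma cvg_sum_seq (I : Type) (s : seq I) (F : I -> nat -> R) (l : I -> R) :
  (forall i, F i k @[k --> \oo] --> l i) -> \sum_(i <- s) F i k @[k --> \oo] --> \sum_(i <- s) l i.
Proof.
move=> H; elim: s => [|i s IH].
  by rewrite big_nil; under eq_fun do rewrite big_nil; exact: cvg_cst.
by rewrite big_cons; under eq_fun do rewrite big_cons; exact: cvgD.
Qed.

Lemma ucoef_series_le f A z a N (E : R) : (0 < N)%N -> a \in box (n:=n) N ->
  (forall w, (forall i, cabs (w i) <= cabs (z i)) -> cabs (psum A N w - f w) <= E) ->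
  cabs (ucoef N (fun u => f (rotz u z)) a - A a * mpow z a) <= E.
Proof.
move=> N0 aN H.
rewrite -(@ucoef_box _ _ (fun b => A b * mpow z b) N N a (leqnn N) aN).
have -> : ucoef N (fun u => f (rotz u z)) a - ucoef N (fun u => \sum_(b <- box (n:=n) N) A b * mpow z b * mpow u b) a =
   - torus_coef N (fun=> 1) (fun u => psum A N (rotz u z) - f (rotz u z)) a.
  rewrite /ucoef /torus_coef -mulrBr -sumrB -mulrN; congr (_ * _); rewrite -sumrN; apply: eq_bigr => l _.
  rewrite -mulrBl -mulNr opprB; congr ((_ - _) / _); apply: eq_bigr => b _.
  by rewrite mpow_rotz; ring.
rewrite cabsN.
have -> : E = E / \prod_(i < n) (1 : R) ^+ a i.
  by rewrite big1 ?divr1 // => i _; rewrite expr1n.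
apply: torus_coef_le => // u hu; apply: H => i.
by rewrite /rotz cabsM hu mul1r.
Qed.

Lemma ucoef_series f A z a : series_of f A -> inB z ->
  ccvg (fun N => ucoef N (fun u => f (rotz u z)) a) (A a * mpow z a).
Proof.
move=> HA zB e e0; have [C [q [q0 q1 H]]] := HA z zB.
have [K0 HK] := @gtail_small R n q C e q0 q1 e0; have [N1 HN1] := mindex_in_box a.
exists (maxn (maxn K0 N1) 1) => N; rewrite !geq_max => /andP[/andP[NK NN] N0].
apply: le_lt_trans (HK N NK).
by apply: ucoef_series_le => //; [exact: HN1|move=> w wz; exact: H].
Qed.

(** Bessel's inequality for the rotates of [f] at each point, integrated over the ball; Fatou's
    lemma lets the number of sample points grow. *)
Lemma csum_le_nrm f A K : L2 f -> series_of f A -> csum A K <= nrm f.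
Proof.
move=> hf HA.
have mrot u : (forall i, cabs (u i) = 1) -> mBC (fun z => f (rotz u z)).
  move=> u1; apply: (@mBC_cvg _ _ (fun K z => psum A K (rotz u z))) => [k|z zB].
    apply: eq_mBC (mBC_psum (fun a => A a * mpow u a) k) => z _.
    by apply: eq_bigr => a _; rewrite mpow_rotz mulrA.
  apply: series_ccvg => //; move: zB.
  by rewrite /inB !normsqE; under [in X in _ -> X]eq_bigr do rewrite /rotz cabsM u1 mul1r.
pose F N z := \sum_(a <- box (n:=n) K) abs2 (ucoef (N + K).+1 (fun u => f (rotz u z)) a).
have mF N : mB (F N).
  apply: mB_sum => a; apply: mB_abs2; rewrite /ucoef /torus_coef.
  apply: mBCM; first exact: mBC_cst.
  apply: mBC_sum => l; apply: mBCM; last exact: mBC_cst.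
  by apply: mrot; exact: cabs_utorus.
have F0 N z : inB z -> 0 <= F N z by move=> _; apply: sumr_ge0 => a _; exact: abs2_ge0.
have : (nvint (fun z => (\sum_(a <- box (n:=n) K) abs2 (A a * mpow z a))%R) <= (nrm f)%:E)%E.
  apply: (@nvint_fatou_le _ _ F) => //.
  - by apply: mB_sum => a; apply: mB_abs2; apply: mBCM; [exact: mBC_cst|exact: mBC_mpow].
  - by move=> z _; apply: sumr_ge0 => a _; exact: abs2_ge0.
  - move=> z zB; apply: cvg_sum_seq => a; apply: ccvg_abs2 => e e0.
    have [N0 HN] := ucoef_series a HA zB e0; exists N0 => N NN0; apply: HN.
    by rewrite (leq_trans NN0) // -addnS leq_addr.
  - move=> N; have [i1 <-] := nrm_ravg (ltn0Sn (N + K)) hf.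
    rewrite -nvint_Iv //; apply: le_nvint => //; [by case: i1|exact: F0|].
    by move=> z _; apply: ravg_bessel; rewrite -addSn leq_addl.
have LF a : L2 (fun z : cpt R n => A a * mpow z a) by apply: L2Z; exact: (L2_mpow a).1.
rewrite nvint_Iv; last by apply: integ_sum => a; exact: integ_abs2.
rewrite lee_fin Iv_sum => [|a]; last exact: integ_abs2.
apply: le_trans; rewrite le_eqVlt; apply/orP; left; apply/eqP; apply: eq_bigr => a _.
by rewrite -(L2_mpow a).2 -nrmZ //; exact: (L2_mpow a).1.
Qed.

Lemma nrm_le_csum f A (B : R) : (forall z, inB z -> ccvg (fun K => psum A K z) (f z)) ->
  (forall K, csum A K <= B) -> L2 f /\ nrm f <= B.
Proof.
move=> HA AB; apply: (nrm_fatou (L2_psum A)) => // K.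
by rewrite nrm_psum.
Qed.

End Parseval.

(** * The Bergman space *)

Section PowerSeriesConverse.
Context {R : realType} {n : nat}.
Implicit Types (u z w : cpt R n) (c A : mindex n -> R[i]) (a b : mindex n).

Lemma binomial_term_le (x y : R) (b m : nat) : 0 <= x -> 0 <= y ->
  'C(b + m, b)%:R * (x ^+ b * y ^+ m) <= (x + y) ^+ (b + m).
Proof.
move=> x0 y0; rewrite exprDn.
have hm : (m < (b + m).+1)%N by rewrite ltnS leq_addl.
rewrite (bigD1 (Ordinal hm)) //= addnK -[X in X <= _]addr0 lerD //.
  by rewrite mulr_natl -bin_sub ?leq_addr // addKn.
by apply: sumr_ge0 => i _; rewrite mulrn_wge0 // mulr_ge0 // exprn_ge0.
Qed.

(** One term of the multinomial theorem, cleared of denominators; each coordinate is added through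
    the binomial case. *)
Lemma multinomial_term_le (x : 'I_n -> R) a (s : seq 'I_n) : (forall i, 0 <= x i) ->
  (\sum_(i <- s) a i)`!%:R * \prod_(i <- s) x i ^+ a i <=
  (\sum_(i <- s) x i) ^+ (\sum_(i <- s) a i) * \prod_(i <- s) (a i)`!%:R.
Proof.
move=> x0; elim: s => [|i s IH]; first by rewrite !big_nil expr0 fact0.
rewrite !big_cons.
set b := a i; set m := (\sum_(j <- s) a j)%N in IH *; set S := \sum_(j <- s) x j in IH *.
set P := \prod_(j <- s) x j ^+ a j in IH *; set Q := \prod_(j <- s) (a j)`!%:R in IH *.
have S0 : 0 <= S by exact: sumr_ge0.
have Q0 : 0 <= Q by apply: prodr_ge0.
have -> : (b + m)`!%:R * (x i ^+ b * P) = 'C(b + m, b)%:R * (x i ^+ b * b`!%:R) * (m`!%:R * P).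
  have := @bin_fact (b + m) b (leq_addr m b); rewrite addKn => <-.
  by rewrite !natrM; ring.
rewrite (le_trans (ler_wpM2l _ IH)) ?mulr_ge0 ?exprn_ge0 //.
have -> : 'C(b + m, b)%:R * (x i ^+ b * b`!%:R) * (S ^+ m * Q) =
   ('C(b + m, b)%:R * (x i ^+ b * S ^+ m)) * (b`!%:R * Q) by ring.
by rewrite ler_wpM2r ?mulr_ge0 // binomial_term_le.
Qed.

(** The multinomial bound leaves the factor ['C(n + mdeg a, n) * t ^+ mdeg a * t ^+ mdeg a]. One of
    the two powers absorbs the binomial coefficient at the price of [(1 - t) ^- n], the other
    remains as decay. *)
Lemma xmono_omega_le z a (t : R) : 0 < t -> t < 1 -> normsq z <= t ^+ 2 ->
  xmono a z <= (1 - t) ^- n * t ^+ mdeg a * omega a.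
Proof.
move=> t0 t1 zt; have d0 : 0 < 1 - t by rewrite subr_gt0.
have f0 k : 0 < (k`!%:R : R) by rewrite ltr0n fact_gt0.
have k0 k : (k`!%:R : R) != 0 by rewrite gt_eqF.
have z0 : 0 <= normsq z by apply: sumr_ge0 => i _; exact: abs2_ge0.
have P0 : 0 <= \prod_i ((a i)`!%:R : R) by apply: prodr_ge0.
have := @multinomial_term_le (fun i => abs2 (z i)) a (index_enum _) (fun i => abs2_ge0 _).
rewrite -/(normsq z) -/(mdeg a) -/(xmono a z) => H.
have H1 : normsq z ^+ mdeg a <= t ^+ mdeg a * t ^+ mdeg a.
  by rewrite -exprMn -expr2 lerXn2r // nnegrE exprn_ge0 // ltW.
have H2 : 'C(n + mdeg a, n)%:R * t ^+ mdeg a <= (1 - t) ^- n.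
  rewrite -[leRHS]mul1r ler_pdivlMr ?exprn_gt0 // -mulrA [t ^+ _ * _]mulrC.
  rewrite (le_trans (binomial_term_le _ _ (ltW d0) (ltW t0))) //.
  by rewrite subrK expr1n.
rewrite -(ler_pM2l (f0 (mdeg a))) (le_trans H) //.
rewrite (le_trans (ler_wpM2r P0 H1)) //.
have E : omega a = (\prod_i (a i)`!%:R) / ('C(n + mdeg a, n)%:R * (mdeg a)`!%:R) :> R.
  rewrite /omega -(@bin_fact (n + mdeg a) n (leq_addr _ _)) addKn !natrM.
  have c0 : 'C(n + mdeg a, n)%:R != 0 :> R by rewrite pnatr_eq0 -lt0n bin_gt0 leq_addr.
  move: (k0 n) (k0 (mdeg a)); move: (n`!%:R) ((mdeg a)`!%:R) ('C(_, _)%:R) c0 => x y w w0 x0 y0.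
  by field; rewrite w0 x0 y0.
have c0 : 0 < 'C(n + mdeg a, n)%:R :> R by rewrite ltr0n bin_gt0 leq_addr.
rewrite E; set T := t ^+ mdeg a in H1 H2 *; set P := \prod_i _ in P0 *.
have T0 : 0 <= T by rewrite exprn_ge0 // ltW.
set D := (1 - t) ^- n in H2 *.
have -> : (mdeg a)`!%:R * (D * T * (P / ('C(n + mdeg a, n)%:R * (mdeg a)`!%:R))) =
    (T * P) * (D / 'C(n + mdeg a, n)%:R).
  move: (k0 (mdeg a)) (gt_eqF c0) => y0 /negbT w0.
  move: ((mdeg a)`!%:R) ('C(_, _)%:R) y0 w0 => y w y0 w0.
  by field; rewrite y0 w0.
have -> : T * T * P = (T * P) * T by ring.
by rewrite ler_wpM2l ?mulr_ge0 // ler_pdivlMr // mulrC.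
Qed.

Lemma csum_term_le A (B : R) a : (forall K, csum A K <= B) -> abs2 (A a) * omega a <= B.
Proof.
move=> AB; have [N0 HN] := mindex_in_box a.
apply: le_trans (AB N0.+1); rewrite /csum.
rewrite (bigD1_seq a) ?box_uniq //=; last by rewrite HN.
rewrite lerDl; apply: sumr_ge0 => b _; rewrite mulr_ge0 ?abs2_ge0 // ltW //.
exact: omega_gt0.
Qed.

(** The constants depend on [B] and [t] only. This uniformity turns convergence of coefficients into
    uniform convergence on smaller balls. *)
Lemma coef_geometric_unif (B t : R) : 0 <= B -> 0 < t -> t < 1 ->
  exists C q : R, [/\ 0 <= C, 0 <= q, q < 1 &
    forall A, (forall K, csum A K <= B) ->
    forall w, normsq w <= t ^+ 2 -> forall a, cabs (A a * mpow w a) <= C * q ^+ mdeg a].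
Proof.
move=> B0 t0 t1; have d0 : 0 < 1 - t by rewrite subr_gt0.
have X0 : 0 <= B * (1 - t) ^- n by rewrite mulr_ge0 // invr_ge0 exprn_ge0 // ltW.
exists (Num.sqrt (B * (1 - t) ^- n)), (Num.sqrt t); split; rewrite ?sqrtr_ge0 //.
  by rewrite -sqrtr1 ltr_sqrt.
move=> A AB w wt a; rewrite -(@ler_pXn2r _ 2) ?nnegrE ?mulr_ge0 ?exprn_ge0 ?sqrtr_ge0 ?cabs_ge0 //.
rewrite exprMn sqr_sqrtr // exprAC sqr_sqrtr ?(ltW t0) // -abs2E abs2M abs2_mpow.
rewrite (le_trans (ler_wpM2l (abs2_ge0 _) (xmono_omega_le a t0 t1 wt))) //.
have -> : abs2 (A a) * ((1 - t) ^- n * t ^+ mdeg a * omega a) =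
   (abs2 (A a) * omega a) * ((1 - t) ^- n * t ^+ mdeg a) by ring.
rewrite -[leRHS]mulrA ler_wpM2r ?(csum_term_le _ AB) // mulr_ge0 ?invr_ge0 ?exprn_ge0 ?(ltW d0) ?(ltW t0) //.
Qed.

Lemma coef_geometric A (B t : R) : (forall K, csum A K <= B) -> 0 < t -> t < 1 ->
  exists C q : R, [/\ 0 <= C, 0 <= q, q < 1 &
    forall w, normsq w <= t ^+ 2 -> forall a, cabs (A a * mpow w a) <= C * q ^+ mdeg a].
Proof.
move=> AB t0 t1; have B0 : 0 <= B by apply: le_trans (AB 0%N); exact: csum_ge0.
have [C [q [C0 q0 q1 H]]] := coef_geometric_unif B0 t0 t1.
by exists C, q; split=> //; exact: H.
Qed.

Lemma ccvg_unique (u : nat -> R[i]) l l' : ccvg u l -> ccvg u l' -> l = l'.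
Proof.
move=> ul ul'; apply/eqP; rewrite -subr_eq0 -cabs_eq0 eq_le cabs_ge0 andbT.
apply/ler_addgt0Pr => e e0; have e2 : 0 < e / 2 by rewrite divr_gt0.
have [N1 H1] := ul _ e2; have [N2 H2] := ul' _ e2.
rewrite add0r (le_trans (ler_cabs_dist (u (maxn N1 N2)) _ _)) //.
by rewrite (splitr e) lerD // ltW // ?H2 ?leq_maxr // cabsB H1 ?leq_maxl.
Qed.

Lemma geometric_ccvg (c : mindex n -> R[i]) (C q : R) : 0 <= C -> 0 <= q -> q < 1 ->
  (forall a, cabs (c a) <= C * q ^+ mdeg a) ->
  exists2 l, ccvg (fun K => \sum_(a <- box (n:=n) K) c a) l &
    forall K, cabs (\sum_(a <- box (n:=n) K) c a - l) <= C * gtail (n := n) q K.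
Proof.
move=> C0 q0 q1 hc.
have tail K N : (K <= N)%N -> cabs (\sum_(a <- box (n:=n) K) c a - \sum_(a <- box (n:=n) N) c a) <= C * gtail (n := n) q K.
  by move=> KN; rewrite cabsB; exact: sum_box_tail.
have bnd K : cabs (\sum_(a <- box (n:=n) K) c a) <= cabs (\sum_(a <- box (n:=n) 0) c a) + C * gtail (n := n) q 0.
  rewrite -lerBlDl (le_trans (ler_cabs_sub _ _)) // cabsB.
  exact: tail.
have [f fmono [l fl]] := bolzano_weierstrass_complex bnd.
have H K : cabs (\sum_(a <- box (n:=n) K) c a - l) <= C * gtail (n := n) q K.
  apply/ler_addgt0Pr => e /fl [N HN].
  pose i := maxn N K; rewrite (le_trans (ler_cabs_dist (\sum_(a <- box (n:=n) (f i)) c a) _ _)) // lerD //.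
    by apply: tail; rewrite (leq_trans (leq_maxr N K)) // increasing_seq_ge.
  by apply/ltW/HN; exact: leq_maxl.
exists l => // e e0; have [K0 HK] := @gtail_small R n q C e q0 q1 e0.
by exists K0 => K /HK; apply: le_lt_trans.
Qed.

Lemma geometric_tail (c : mindex n -> R[i]) (C q : R) l K : 0 <= C -> 0 <= q -> q < 1 ->
  (forall a, cabs (c a) <= C * q ^+ mdeg a) -> ccvg (fun K => \sum_(a <- box (n:=n) K) c a) l ->
  cabs (\sum_(a <- box (n:=n) K) c a - l) <= C * gtail (n := n) q K.
Proof.
move=> C0 q0 q1 hc cl; have [l' cl' H] := geometric_ccvg C0 q0 q1 hc.
by rewrite (ccvg_unique cl cl').
Qed.

Lemma normsq_mono w z : (forall i, cabs (w i) <= cabs (z i)) -> normsq w <= normsq z.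
Proof. by move=> wz; rewrite [normsq z]normsqE normsq_le_sum. Qed.

Lemma between_radius z : inB z -> exists2 t : R, 0 < t & t < 1 /\ normsq z < t ^+ 2.
Proof.
move=> zB; have z0 : 0 <= normsq z by apply: sumr_ge0 => i _; exact: abs2_ge0.
have h : 0 < (1 + normsq z) / 2 by lra.
rewrite /inB in zB; exists (Num.sqrt ((1 + normsq z) / 2)); rewrite ?sqrtr_gt0 // sqr_sqrtr ?ltW //.
by split; [rewrite -[ltRHS]sqrtr1 ltr_sqrt //; lra|lra].
Qed.

Lemma series_exists A (B : R) : (forall K, csum A K <= B) -> exists f, series_of f A.
Proof.
(* The default 0 is taken only where the series diverges, which happens nowhere in the ball. *)
move=> AB; pose f z := xget 0 [set l | ccvg (fun K => psum A K z) l].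
have E t : 0 < t -> t < 1 -> exists C q : R, [/\ 0 <= q, q < 1 & forall w, normsq w <= t ^+ 2 ->
    forall K, cabs (psum A K w - f w) <= C * gtail (n := n) q K].
  move=> t0 t1; have [C [q [C0 q0 q1 H]]] := coef_geometric AB t0 t1.
  exists C, q; split=> // w wt K.
  have [l ll lK] := geometric_ccvg C0 q0 q1 (H w wt).
  have fl : ccvg (fun K => psum A K w) (f w).
    by apply: (@xgetPex _ 0 [set l | ccvg (fun K => psum A K w) l]); exists l.
  by rewrite (ccvg_unique fl ll); exact: lK.
exists f => z /between_radius[t t0 [t1 zt]].
have [C [q [q0 q1 H]]] := E t t0 t1; exists C, q; split=> // w wz.
by apply: H; rewrite (le_trans (normsq_mono wz)) // ltW.
Qed.

Lemma cont_wrt_unif (X : Type) (D : X -> R) (G : nat -> X -> R[i]) g p (d0 : R) : 0 < d0 ->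
  (forall e : R, 0 < e -> exists K, forall q, D q < d0 -> cabs (G K q - g q) < e) -> D p < d0 ->
  (forall K, cont_wrt D (G K) p) -> cont_wrt D g p.
Proof.
move=> d00 Gg pd cG e e0; have e3 : 0 < e / 3 by rewrite divr_gt0.
have [K HK] := Gg _ e3; have [d dpos Hd] := cG K _ e3.
exists (Num.min d d0) => [|q]; rewrite lt_min ?dpos // => /andP[/Hd h1 /HK h2].
have h3 := HK p pd.
have -> : g q - g p = (G K q - G K p) - (G K q - g q) + (G K p - g p) by ring.
rewrite (le_lt_trans (ler_cabsD _ _)) // (_ : e = e / 3 + e / 3 + e / 3); last by field.
by rewrite ltrD // (le_lt_trans (ler_cabsB _ _)) // ltrD.
Qed.

Lemma cont_wrt_sum (X I : Type) (D : X -> R) (s : seq I) (F : I -> X -> R[i]) p :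
  (forall i, cont_wrt D (F i) p) -> cont_wrt D (fun q => \sum_(i <- s) F i q) p.
Proof.
move=> H; elim: s => [|i s IH]; first by under eq_fun do rewrite big_nil; exact: cont_wrt_cst.
by under eq_fun do rewrite big_cons; exact: cont_wrtD.
Qed.

Lemma cont_wrtX (X : Type) (D : X -> R) (F : X -> R[i]) k p :
  cont_wrt D F p -> cont_wrt D (fun q => F q ^+ k) p.
Proof.
move=> H; elim: k => [|k IH]; first by under eq_fun do rewrite expr0; exact: cont_wrt_cst.
by under eq_fun do rewrite exprS; exact: cont_wrtM.
Qed.

Lemma psum_cont c K z : cont_wrt (fun w => dist2 w z) (psum c K) z.
Proof.
apply: cont_wrt_sum => a; apply: cont_wrtM; first exact: cont_wrt_cst.
rewrite /mpow; elim: (index_enum _) => [|i s IH].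
  have -> : (fun q : cpt R n => \prod_(i <- [::]) q i ^+ a i) = fun=> 1.
    by apply/funext => q; rewrite big_nil.
  exact: cont_wrt_cst.
have -> : (fun q : cpt R n => \prod_(k <- i :: s) q k ^+ a k) = fun q => q i ^+ a i * \prod_(k <- s) q k ^+ a k.
  by apply/funext => q; rewrite big_cons.
apply: cont_wrtM => //; apply: cont_wrtX.
move=> e e0; exists (e ^+ 2); first by rewrite exprn_gt0.
move=> w hw; rewrite -abs2_lt // abs2E.
exact: le_lt_trans (cabs_le_normsq (fun i => w i - z i) i) hw.
Qed.

Lemma dist2_ball z (t : R) : 0 < t -> normsq z < t ^+ 2 -> exists2 d : R, 0 < d &
  forall w, dist2 w z < d -> normsq w <= t ^+ 2.
Proof.
move=> t0 zt; have z0 : 0 <= normsq z by apply: sumr_ge0 => i _; exact: abs2_ge0.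
(* [|x|^2 <= (1+s) |y|^2 + (1+1/s) |x-y|^2] with [s] small *)
pose N := normsq z; pose s := (t ^+ 2 - N) / (2 * (N + 1)).
have s0 : 0 < s by rewrite divr_gt0 ?subr_gt0 // mulr_gt0 // ltr_wpDl.
have key (x y : R[i]) : abs2 x <= (1 + s) * abs2 y + (1 + s^-1) * abs2 (x - y).
  have w0 : s^-1 * s = 1 by rewrite mulVf // gt_eqF.
  have real (p q : R) : p ^+ 2 <= (1 + s) * q ^+ 2 + (1 + s^-1) * (p - q) ^+ 2.
    have : 0 <= s^-1 * (s * q - (p - q)) ^+ 2 by rewrite mulr_ge0 ?sqr_ge0 // invr_ge0 ltW.
    have -> : s^-1 * (s * q - (p - q)) ^+ 2 =
       (s^-1 * s) * s * q ^+ 2 - 2 * (s^-1 * s) * q * (p - q) + s^-1 * (p - q) ^+ 2 by ring.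
    rewrite w0; lra.
  case: x y => [x x'] [y y']; rewrite /abs2 /=.
  by have := real x y; have := real x' y'; lra.
have k0 : 0 < 1 + s^-1 by rewrite addr_gt0 // invr_gt0.
exists ((t ^+ 2 - N) / 2 / (1 + s^-1)).
  by rewrite !divr_gt0 // subr_gt0.
move=> w; rewrite ltr_pdivlMr // => hw.
have : normsq w <= (1 + s) * N + (1 + s^-1) * dist2 w z.
  by rewrite /N /dist2 /normsq !mulr_sumr -big_split /=; apply: ler_sum => i _; exact: key.
have : s * N <= (t ^+ 2 - N) / 2.
  rewrite /s mulrAC ler_pdivrMr ?mulr_gt0 ?ltr_wpDl //.
  have -> : (t ^+ 2 - N) / 2 * (2 * (N + 1)) = (t ^+ 2 - N) * (N + 1) by field.
  by rewrite ler_wpM2l ?subr_ge0 ?lerDl // ltW.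
lra.
Qed.

(** Continuity passes through locally uniform limits of polynomials. In the variable [j] the slope
    function is the series of the slopes of the powers, which again converges uniformly. *)
Lemma bounded_series_holoB A (B : R) f : (forall K, csum A K <= B) -> series_of f A -> holoB f.
Proof.
move=> AB HA; split.
  move=> z zB e e0; have [t t0 [t1 zt]] := between_radius zB.
  have [C [q [C0 q0 q1 H]]] := coef_geometric AB t0 t1.
  have [d d0 Hd] := dist2_ball t0 zt.
  have D0 : dist2 z z = 0.
    by rewrite /dist2 normsqE big1 // => i _; rewrite subrr cabs0 expr0n.
  have cf : cont_wrt (fun w => dist2 w z) f z.
    apply: (@cont_wrt_unif _ _ (fun K => psum A K) f z d d0) => //; last by move=> K; exact: psum_cont.
      move=> e' e'0; have [K0 HK] := @gtail_small R n q C e' q0 q1 e'0; exists K0 => w /Hd wt.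
      apply: le_lt_trans (HK K0 (leqnn _)).
      have wB : inB w by rewrite /inB (le_lt_trans wt) // expr_lt1 // ltW.
      by apply: geometric_tail => //; [exact: H|exact: series_ccvg].
    by rewrite D0.
  have se : 0 < Num.sqrt e by rewrite sqrtr_gt0.
  have [d' d'0 Hd'] := cf _ se; exists d'; split=> // w /Hd'.
  by rewrite -abs2_lt // sqr_sqrtr // ltW.
move=> z zB j; apply/cdiffE.
have [t t0 [t1 zt]] := between_radius zB.
have [C [q [C0 q0 q1 H]]] := coef_geometric AB t0 t1.
pose g (u : R[i]) := f (upd z j u); pose u0 := z j; change (cd g u0).
have gE (u : R[i]) : g u = f (upd z j u) by [].
have nupd (u : R[i]) : normsq (upd z j u) = normsq z - abs2 u0 + abs2 u.
  rewrite /normsq (bigD1 j) //= [\sum_(i < n) abs2 (z i)](bigD1 j) //= /upd eqxx.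
  rewrite (eq_bigr (fun i => abs2 (z i))) => [|i /negbTE -> //]; rewrite -/u0; ring.
(* The largest modulus of the [j]-th coordinate, the others being those of [z], that stays in the
   ball of radius [t]. *)
pose rho := Num.sqrt (abs2 u0 + (t ^+ 2 - normsq z)).
have arg0 : 0 < abs2 u0 + (t ^+ 2 - normsq z) by rewrite ltr_wpDl ?abs2_ge0 // subr_gt0.
have rho0 : 0 < rho by rewrite sqrtr_gt0.
have rho2 : rho ^+ 2 = abs2 u0 + (t ^+ 2 - normsq z) by rewrite sqr_sqrtr // ltW.
have u0rho : cabs u0 < rho.
  by rewrite -(@ltr_pXn2r _ 2) ?nnegrE ?cabs_ge0 ?(ltW rho0) // rho2 -abs2E ltrDl subr_gt0.
have inrho (u : R[i]) : cabs u <= rho -> normsq (upd z j u) <= t ^+ 2.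
  move=> ur; rewrite nupd (abs2E u).
  have : cabs u ^+ 2 <= rho ^+ 2 by rewrite lerXn2r // nnegrE ?cabs_ge0 ?(ltW rho0).
  rewrite rho2; lra.
pose c a := A a * \prod_(i < n | i != j) z i ^+ a i.
have mE (u : R[i]) a : A a * mpow (upd z j u) a = c a * u ^+ a j.
  rewrite /mpow (bigD1 j) //= {1}/upd eqxx (eq_bigr (fun i => z i ^+ a i)) => [|i /negbTE ij].
    by rewrite /c; ring.
  by rewrite /upd ij.
have cC a : cabs (c a) * rho ^+ a j <= C * q ^+ mdeg a.
  have := H (upd z j (rho%:C)%C) _ a; rewrite mE cabsM cabsX cabs_real ger0_norm ?(ltW rho0) //.
  by apply; apply: inrho; rewrite cabs_real ger0_norm ?(ltW rho0).
pose s k (u : R[i]) : R[i] := \sum_(i < k) u ^+ (k.-1 - i) * u0 ^+ i.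
have sE k (u : R[i]) : u ^+ k - u0 ^+ k = (u - u0) * s k u by exact: subrXX.
have sle k (u : R[i]) : cabs u <= rho -> cabs (s k u) * rho <= k%:R * rho ^+ k.
  move=> ur; rewrite (le_trans (ler_wpM2r (ltW rho0) (ler_cabs_sum _ _ _))) // mulr_suml.
  rewrite -[k in k%:R]card_ord -sumr_const mulr_suml; apply: ler_sum => i _.
  rewrite mul1r cabsM !cabsX.
  have ik : (i < k)%N by [].
  have -> : rho ^+ k = rho ^+ (k.-1 - i) * rho ^+ i * rho.
    have k0 : (0 < k)%N by exact: leq_ltn_trans (leq0n i) ik.
    by rewrite -exprD -exprSr subnK ?prednK // -ltnS prednK.
  rewrite ler_wpM2r ?(ltW rho0) // ler_pM ?exprn_ge0 ?cabs_ge0 //.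
    by rewrite lerXn2r // nnegrE ?cabs_ge0 // ltW.
  by rewrite lerXn2r ?nnegrE ?cabs_ge0 ?(ltW rho0) // ltW.
(* Half of the geometric decay is given up to absorb the factor [a j] that the slopes bring in. *)
pose q' := Num.sqrt q; have q'0 : 0 <= q' by exact: sqrtr_ge0.
have q'1 : q' < 1 by rewrite -sqrtr1 ltr_sqrt.
have q'2 : q' ^+ 2 = q by rewrite sqr_sqrtr.
pose C' := C / rho * (1 - q')^-1.
have C'0 : 0 <= C' by rewrite /C' !mulr_ge0 ?invr_ge0 ?(ltW rho0) // subr_ge0 ltW.
have csC (u : R[i]) : cabs u <= rho -> forall a, cabs (c a * s (a j) u) <= C' * q' ^+ mdeg a.
  move=> ur a; rewrite cabsM -(ler_pM2r rho0) -mulrA.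
  rewrite (le_trans (ler_wpM2l (cabs_ge0 _) (sle (a j) u ur))) //.
  have -> : cabs (c a) * ((a j)%:R * rho ^+ a j) = (a j)%:R * (cabs (c a) * rho ^+ a j) by ring.
  rewrite (le_trans (ler_wpM2l (ler0n _ _) (cC a))) //.
  have aj : ((a j)%:R : R) <= (mdeg a)%:R by rewrite ler_nat /mdeg (bigD1 j) //= leq_addr.
  rewrite (le_trans (ler_wpM2r _ aj)) ?mulr_ge0 ?exprn_ge0 //.
  have -> : (mdeg a)%:R * (C * q ^+ mdeg a) = ((mdeg a)%:R * q' ^+ mdeg a) * (C * q' ^+ mdeg a).
    by rewrite -q'2 exprAC expr2; ring.
  rewrite (le_trans (ler_wpM2r _ (natr_geometric_le (mdeg a) q'0 q'1))) ?mulr_ge0 ?exprn_ge0 //.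
  by rewrite /C' [leRHS](_ : _ = (1 - q')^-1 * (C * q' ^+ mdeg a)) //; field; rewrite !gt_eqF // subr_gt0.
have [l0 cl0 _] := geometric_ccvg C'0 q'0 q'1 (csC u0 (ltW u0rho)).
pose S (u : R[i]) := if u == u0 then l0 else (g u - g u0) / (u - u0).
have gcv (u : R[i]) : cabs u <= rho -> ccvg (fun K => \sum_(a <- box (n:=n) K) c a * u ^+ a j) (g u).
  move=> /inrho ut; have wB : inB (upd z j u) by rewrite /inB (le_lt_trans ut) // expr_lt1 // ltW.
  have := series_ccvg HA wB; rewrite -gE; congr ccvg.
  by apply/funext => K; apply: eq_bigr => a _; exact: mE.
have ScS (u : R[i]) : cabs u <= rho -> ccvg (fun K => \sum_(a <- box (n:=n) K) c a * s (a j) u) (S u).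
  move=> ur; rewrite /S; case: eqVneq => [->//|uu0].
  have d0 : u - u0 != 0 by rewrite subr_eq0.
  have := ccvgZ (u - u0)^-1 (ccvgD (gcv u ur) (ccvgZ (-1) (gcv u0 (ltW u0rho)))).
  rewrite mulN1r [_ / _]mulrC; congr ccvg; apply/funext => K.
  rewrite mulN1r -sumrB mulr_sumr; apply: eq_bigr => a _.
  by rewrite -mulrBr sE (mulrCA (c a)) mulKf.
exists S => [u|].
  by rewrite /S; case: eqVneq => [->|uu0]; [rewrite !subrr mulr0|rewrite divfK // subr_eq0].
have near (u : R[i]) : cabs (u - u0) < rho - cabs u0 -> cabs u <= rho.
  move=> h; rewrite -(subrK u0 u) (le_trans (ler_cabsD _ _)) // -lerBrDr ltW //.
apply: (@cont_wrt_unif _ _ (fun K (u : R[i]) => \sum_(a <- box (n:=n) K) c a * s (a j) u) S u0 (rho - cabs u0)).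
- by rewrite subr_gt0.
- move=> e e0; have [K0 HK] := @gtail_small R n q' C' e q'0 q'1 e0; exists K0 => u /near ur.
  apply: le_lt_trans (HK K0 (leqnn _)).
  by apply: geometric_tail => //; [exact: csC|exact: ScS].
- by rewrite subrr cabs0 subr_gt0.
- move=> K; apply: cont_wrt_sum => a; apply: cont_wrtM; first exact: cont_wrt_cst.
  apply: cont_wrt_sum => i; apply: cont_wrtM; last exact: cont_wrt_cst.
  by apply: cont_wrtX; exact: ccont_at_id.
Qed.

End PowerSeriesConverse.

(** * Linear structure and normal families *)

Section BergmanSpace.
Context {R : realType} {n : nat}.
Implicit Types (u z w : cpt R n) (c A : mindex n -> R[i]) (a b : mindex n) (f g h : cpt R n -> R[i]).

Lemma holoBP f : holoB f <-> (forall z, inB z -> cont_wrt (fun w => dist2 w z) f z) /\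
  (forall z, inB z -> forall j, cd (fun u : R[i] => f (upd z j u)) (z j)).
Proof.
split=> -[h1 h2]; split.
- move=> z zB e e0; have e2 : 0 < e ^+ 2 by rewrite exprn_gt0.
  have [d [d0 H]] := h1 z zB _ e2; exists d => // w /H.
  by rewrite abs2_lt.
- by move=> z zB j; apply/cdiffE; exact: h2.
- move=> z zB e e0; have se : 0 < Num.sqrt e by rewrite sqrtr_gt0.
  have [d d0 H] := h1 z zB _ se; exists d; split=> // w /H.
  by rewrite -abs2_lt // sqr_sqrtr // ltW.
- by move=> z zB j; apply/cdiffE; exact: h2.
Qed.

Lemma holoBD f g : holoB f -> holoB g -> holoB (fun z => f z + g z).
Proof.
move=> /holoBP[f1 f2] /holoBP[g1 g2]; apply/holoBP; split=> z zB.
  by apply: cont_wrtD; [exact: f1|exact: g1].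
by move=> j; apply: cdD; [exact: f2|exact: g2].
Qed.

Lemma holoBZ (k : R[i]) f : holoB f -> holoB (fun z => k * f z).
Proof.
move=> /holoBP[f1 f2]; apply/holoBP; split=> z zB.
  by apply: cont_wrtM; [exact: cont_wrt_cst|exact: f1].
by move=> j; apply: cdM; [exact: cd_cst|exact: f2].
Qed.

Lemma holoB_mulz (i : 'I_n) f : holoB f -> holoB (mulz i f).
Proof.
move=> /holoBP[f1 f2]; apply/holoBP; split=> z zB.
  apply: cont_wrtM; last exact: f1.
  move=> e e0; exists (e ^+ 2); first by rewrite exprn_gt0.
  move=> w hw; rewrite -abs2_lt // abs2E.
  exact: le_lt_trans (cabs_le_normsq (fun i => w i - z i) i) hw.
move=> j; apply: cdM; last exact: f2.
by rewrite /upd; case: (i == j); [exact: cd_id|exact: cd_cst].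
Qed.

Lemma holoB0 : holoB ((fun=> 0) : cpt R n -> R[i]).
Proof. by apply/holoBP; split=> *; [exact: cont_wrt_cst|exact: cd_cst]. Qed.

Lemma bergmanP f : bergman f <-> holoB f /\ L2 f.
Proof.
split=> [h|[h1 [_ h2]]]; last by split.
by split; [case: h|exact: bergman_L2].
Qed.

Lemma bergmanD f g : bergman f -> bergman g -> bergman (fun z => f z + g z).
Proof.
move=> /bergmanP[f1 f2] /bergmanP[g1 g2]; apply/bergmanP.
by split; [exact: holoBD|exact: L2D].
Qed.

Lemma bergmanZ (k : R[i]) f : bergman f -> bergman (fun z => k * f z).
Proof. by move=> /bergmanP[f1 f2]; apply/bergmanP; split; [exact: holoBZ|exact: L2Z]. Qed.

Lemma bergmanB f g : bergman f -> bergman g -> bergman (fun z => f z - g z).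
Proof.
move=> hf hg; have := bergmanD hf (bergmanZ (-1) hg); congr bergman.
by apply/funext => z; rewrite mulN1r.
Qed.

Lemma bergman_mulz (i : 'I_n) f : bergman f -> bergman (mulz i f).
Proof. by move=> /bergmanP[f1 f2]; apply/bergmanP; split; [exact: holoB_mulz|exact: (L2_coord i f2).1]. Qed.

Lemma bergman0 : bergman ((fun=> 0) : cpt R n -> R[i]).
Proof. by apply/bergmanP; split; [exact: holoB0|exact: L2_0]. Qed.

Lemma bergman_series f : bergman f -> exists A, series_of f A.
Proof. by case=> /holoB_power_series[A HA] _; exists A. Qed.

Lemma bounded_series_bergman A (B : R) : (forall K, csum A K <= B) ->
  exists f, [/\ series_of f A, bergman f & nrm f <= B].
Proof.
move=> AB; have [f fA] := series_exists AB; exists f.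
have [|f2 fB] := @nrm_le_csum _ _ f A B _ AB; first by move=> z; exact: series_ccvg.
by split=> //; apply/bergmanP; split=> //; exact: bounded_series_holoB fA.
Qed.

Lemma cvg_le_bound (u : nat -> R) (l B : R) : (forall k, u k <= B) -> u k @[k --> \oo] --> l -> l <= B.
Proof.
move=> uB ul; rewrite -(cvg_lim (@Rhausdorff R) ul); apply: limr_le.
  by apply/cvg_ex; exists l.
exact: nearW.
Qed.

Lemma coef_cvg_pointwise (f : nat -> cpt R n -> R[i]) g (A : nat -> mindex n -> R[i]) A0 (B : R) :
  (forall k K, csum (A k) K <= B) -> (forall K, csum A0 K <= B) ->
  (forall k, series_of (f k) (A k)) -> series_of g A0 ->
  (forall a, ccvg (fun k => A k a) (A0 a)) -> forall z, inB z -> ccvg (fun k => f k z) (g z).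
Proof.
move=> AB A0B fA gA0 AA0 z zB e e0; have [t t0 [t1 zt]] := between_radius zB.
have B0 : 0 <= B by apply: le_trans (A0B 0%N); exact: csum_ge0.
have [C [q [C0 q0 q1 H]]] := @coef_geometric_unif R n B t B0 t0 t1.
have e3 : 0 < e / 3 by rewrite divr_gt0.
have [K0 HK] := @gtail_small R n q C _ q0 q1 e3.
have tail A' f' : (forall K, csum A' K <= B) -> series_of f' A' -> cabs (psum A' K0 z - f' z) < e / 3.
  move=> A'B fA'; apply: le_lt_trans (HK K0 (leqnn _)).
  apply: geometric_tail => //; last exact: series_ccvg.
  by move=> a; apply: H => //; exact: ltW.
have cs : ccvg (fun k => psum (A k) K0 z) (psum A0 K0 z).
  apply: ccvg_sum => a; have := ccvgZ (mpow z a) (AA0 a); rewrite mulrC.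
  by congr ccvg; apply/funext => k; rewrite mulrC.
have [N HN] := cs _ e3; exists N => k /HN h.
have -> : f k z - g z = - (psum (A k) K0 z - f k z) + (psum (A k) K0 z - psum A0 K0 z) + (psum A0 K0 z - g z) by ring.
rewrite (le_lt_trans (ler_cabsD _ _)) // (_ : e = e / 3 + e / 3 + e / 3); last by field.
rewrite ltrD ?tail // (le_lt_trans (ler_cabsD _ _)) // ltrD // cabsN tail //.
Qed.

(** The norm bounds every coefficient, so a diagonal subsequence has convergent coefficients; the
    limits keep the bound [B] and define the limit function. *)
Lemma montel (f : nat -> cpt R n -> R[i]) (B : R) : (forall k, bergman (f k)) -> (forall k, nrm (f k) <= B) ->
  exists phi : nat -> nat, (forall k, (phi k < phi k.+1)%N) /\
    exists g, [/\ bergman g, nrm g <= B & forall z, inB z -> ccvg (fun k => f (phi k) z) (g z)].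
Proof.
move=> hf fB.
have [A HA] := choice (fun k => bergman_series (hf k)).
have AB k K : csum (A k) K <= B.
  by rewrite (le_trans _ (fB k)) // csum_le_nrm //; exact: bergman_L2.
pose c i k : R[i] := if unpickle k is Some a then A i a else 0.
pose D k : R := if unpickle k is Some a then Num.sqrt (B / omega (a : mindex n)) else 0.
have cD i k : cabs (c i k) <= D k.
  rewrite /c /D; case: (unpickle k) => [a|]; last by rewrite cabs0.
  rewrite -(@ler_pXn2r _ 2) ?nnegrE ?sqrtr_ge0 ?cabs_ge0 //.
  have h := csum_term_le a (AB i); have o0 := @omega_gt0 R n a.
  have B0 : 0 <= B by rewrite (le_trans _ h) // mulr_ge0 ?abs2_ge0 // ltW.
  have E : Num.sqrt (B / omega (a : mindex n)) ^+ 2 = B / omega (a : mindex n).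
    by rewrite sqr_sqrtr // divr_ge0 // ltW.
  by rewrite E ler_pdivlMr //; move: h; rewrite abs2E.
have [phi [phi_inc [l Hl]]] := diagonal_extraction cD.
pose A0 a := l (pickle a).
have AA0 a : ccvg (fun k => A (phi k) a) (A0 a).
  by have := Hl (pickle a); congr ccvg; apply/funext => k; rewrite /c pickleK.
have A0B K : csum A0 K <= B.
  apply: (@cvg_le_bound (fun k => csum (A (phi k)) K)); first by move=> k; exact: AB.
  apply: cvg_sum_seq => a; apply: cvgM; last exact: cvg_cst.
  exact: ccvg_abs2.
have [g [gA0 bg gB]] := bounded_series_bergman A0B.
exists phi; split=> //; exists g; split=> //.
by apply: coef_cvg_pointwise gA0 AA0 => // k K; exact: AB.
Qed.

End BergmanSpace.

(** * Orthogonal projection onto [P] *)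

Section Projection.
Context {R : realType} {n : nat}.
Variable M : set (cpt R n).
Hypothesis hM : M `<=` ballB (n := n).
Implicit Types (u z w : cpt R n) (f g h p : cpt R n -> R[i]).

Lemma inP_L2 f : inP M f -> L2 f.
Proof. by case=> /bergman_L2. Qed.

Lemma inPD f g : inP M f -> inP M g -> inP M (fun z => f z + g z).
Proof.
by move=> [f1 f2] [g1 g2]; split=> [|z zM]; [exact: bergmanD|rewrite f2 // g2 // addr0].
Qed.

Lemma inPZ (k : R[i]) f : inP M f -> inP M (fun z => k * f z).
Proof. by move=> [f1 f2]; split=> [|z zM]; [exact: bergmanZ|rewrite f2 // mulr0]. Qed.

Lemma inPB f g : inP M f -> inP M g -> inP M (fun z => f z - g z).
Proof.
by move=> [f1 f2] [g1 g2]; split=> [|z zM]; [exact: bergmanB|rewrite f2 // g2 // subr0].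
Qed.

Lemma inP_mulz (i : 'I_n) f : inP M f -> inP M (mulz i f).
Proof. by move=> [f1 f2]; split=> [|z zM]; [exact: bergman_mulz|rewrite /mulz f2 // mulr0]. Qed.

Lemma inP0 : inP M (fun=> 0).
Proof. by split; [exact: bergman0|]. Qed.

(** As [M] lies in the ball, vanishing on [M] survives pointwise limits on the ball. *)
Lemma inP_montel (f : nat -> cpt R n -> R[i]) (B : R) : (forall k, inP M (f k)) -> (forall k, nrm (f k) <= B) ->
  exists phi : nat -> nat, (forall k, (phi k < phi k.+1)%N) /\
    exists g, [/\ inP M g, nrm g <= B & forall z, inB z -> ccvg (fun k => f (phi k) z) (g z)].
Proof.
move=> hf fB; have [phi [phi_inc [g [bg gB fg]]]] := montel (fun k => (hf k).1) fB.
exists phi; split=> //; exists g; split=> //; split=> // z zM.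
have zB : inB z by exact: hM.
have := fg z zB; have -> : (fun k => f (phi k) z) = fun=> 0.
  by apply/funext => k; exact: (hf (phi k)).2.
by move=> /(ccvg_unique (ccvg_cst 0)) <-.
Qed.

Lemma minimizer_orthogonal F h : L2 F -> L2 h ->
  (forall t : R, nrm F <= nrm (fun z => F z + (t%:C)%C * h z)) -> rip F h = 0.
Proof.
move=> LF Lh H; set r := rip F h; set N := nrm h.
have N0 : 0 <= N by exact: nrm_ge0.
have d0 : 0 < N + 1 by rewrite ltr_wpDl.
(* The optimal value of [t] is [- r / N]; the denominator [N + 1] excludes division by zero and
   still lowers the norm strictly unless [r = 0]. *)
have := H (- r / (N + 1)); rewrite nrm_expand // -/r -/N -addrA lerDl.
have -> : 2 * (- r / (N + 1)) * r + (- r / (N + 1)) ^+ 2 * N =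
    - (r ^+ 2 * ((N + 2) / (N + 1) ^+ 2)) by field; rewrite gt_eqF.
rewrite oppr_ge0 pmulr_lle0; last by rewrite divr_gt0 ?exprn_gt0 // ltr_wpDl.
by move=> h0; apply/eqP; rewrite -sqrf_eq0 eq_le h0 sqr_ge0.
Qed.

(** A minimizing sequence in [P] has a pointwise convergent subsequence, and Fatou's lemma shows
    that its limit attains the distance. *)
Lemma projection_exists F : L2 F -> exists p, inP M p /\
  forall h, inP M h -> rip (fun z => F z - p z) h = 0.
Proof.
move=> LF; pose S : set R := [set nrm (fun z => F z - p z) | p in [set p | inP M p]].
have S0 : S !=set0 by exists (nrm (fun z => F z - 0)), (fun=> 0) => //; exact: inP0.
have Slb : lbound S 0 by move=> _ [p _ <-]; exact: nrm_ge0.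
have Sinf : has_inf S by split=> //; exists 0.
pose m := inf S.
have mle p : inP M p -> m <= nrm (fun z => F z - p z).
  by move=> hp; apply: ge_inf; [exists 0|exists p].
have ex k : exists p, inP M p /\ nrm (fun z => F z - p z) < m + k.+1%:R^-1.
  have e0 : 0 < (k.+1%:R^-1 : R) by rewrite invr_gt0.
  by have [_ [p hp <-] h] := inf_adherent e0 Sinf; exists p.
have [p Hp] := choice ex.
have LFp q : inP M q -> L2 (fun z => F z - q z) by move=> /inP_L2; exact: L2B.
have pB k : nrm (p k) <= 2 * nrm F + 2 * (m + 1).
  have [hk hm] := Hp k.
  rewrite (@eq_nrm _ _ _ (fun z => F z - (F z - p k z))) => [|z _]; last by ring.
  rewrite (le_trans (nrmB_le LF (LFp _ hk))) // lerD2l ler_pM2l // (le_trans (ltW hm)) //.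
  by rewrite lerD2l invf_le1 ?ler1n.
have [phi [phi_inc [q [hq _ pq]]]] := inP_montel (fun k => (Hp k).1) pB.
have phige k : (k <= phi k)%N by elim: k => [//|k IH]; rewrite (leq_ltn_trans IH).
have qm : nrm (fun z => F z - q z) <= m.
  apply/ler_addgt0Pr => e e0; have [N HN] : exists N : nat, N.+1%:R^-1 <= e.
    exists (Num.truncn e^-1); rewrite -[leRHS]invrK lef_pV2 ?posrE ?invr_gt0 //.
    by rewrite ltW // truncnS_gt.
  have [|||_ h] := @nrm_fatou _ _ (fun k z => F z - p (phi (N + k)%N) z) (fun z => F z - q z) (m + e) => //.
  - by move=> k; apply: LFp; exact: (Hp _).1.
  - move=> z zB e' e'0; have [N' HN'] := pq z zB _ e'0; exists N' => k kN.
    rewrite (_ : _ - _ = - (p (phi (N + k)%N) z - q z)); last by ring.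
    by rewrite cabsN HN' // (leq_trans kN) // leq_addl.
  - move=> k; rewrite (le_trans (ltW (Hp _).2)) // lerD2l (le_trans _ HN) //.
    by rewrite lef_pV2 ?posrE ?ltr0n // ler_nat ltnS (leq_trans _ (phige _)) // leq_addr.
exists q; split=> // h hh; apply: minimizer_orthogonal; [exact: LFp|exact: inP_L2|].
move=> t; rewrite (le_trans qm) //.
rewrite (@eq_nrm _ _ _ (fun z => F z - (q z + (- t%:C)%C * h z))) => [|z _]; last by ring.
by apply: mle; apply: inPD => //; exact: inPZ.
Qed.

Lemma orthogonal_ip F h : L2 F -> (forall h, inP M h -> rip F h = 0) -> inP M h ->
  ip_re h F = 0%E /\ ip_im h F = 0%E.
Proof.
move=> LF orth hh; have hi := inPZ (- 'i%C) hh.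
rewrite ip_im_re (ip_re_rip (inP_L2 hh) LF) (ip_re_rip (inP_L2 hi) LF).
by rewrite (rip_sym h) (rip_sym _ F) (orth _ hh) (orth _ hi).
Qed.

Lemma orthogonal_distance x p p' : L2 x -> inP M p -> inP M p' ->
  (forall h, inP M h -> rip (fun z => x z - p' z) h = 0) ->
  nrm (fun z => x z - p' z) <= nrm (fun z => x z - p z).
Proof.
move=> Lx hp hp' orth; have hd := inPB hp' hp.
have LL : L2 (fun z => x z - p' z) by apply: L2B => //; exact: inP_L2.
rewrite (@eq_nrm _ _ (fun z => x z - p z) (fun z => (x z - p' z) + (1%:C)%C * (p' z - p z))) => [|z _].
  by rewrite nrm_expand ?orth //; [rewrite mulr0 addr0 lerDl mulr_ge0 ?nrm_ge0 ?sqr_ge0|exact: inP_L2].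
by rewrite mul1r; ring.
Qed.

End Projection.

(** * The Hankel defect *)

Section HankelApproximation.
Context {R : realType} {n : nat}.
Variable j : 'I_n.
Implicit Types (u z w : cpt R n) (A : mindex n -> R[i]) (a b : mindex n) (f g : cpt R n -> R[i]).

Definition minc (i : 'I_n) a : mindex n := [ffun k => if k == i then (a k).+1 else a k].
Definition mdec a : mindex n := [ffun k => if k == j then (a k).-1 else a k].

Lemma mincK b : mdec (minc j b) = b.
Proof. by apply/ffunP => i; rewrite !ffunE; case: eqP. Qed.

Lemma mdecK a : (0 < a j)%N -> minc j (mdec a) = a.
Proof. by move=> aj; apply/ffunP => i; rewrite !ffunE; case: eqP => // ->; rewrite prednK. Qed.

Lemma mpow_minc i z a : mpow z (minc i a) = z i * mpow z a.
Proof.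
rewrite /mpow (bigD1 i) //= [in RHS](bigD1 i) //= ffunE eqxx exprS -mulrA; congr (_ * (_ * _)).
by apply: eq_bigr => k /negbTE ki; rewrite ffunE ki.
Qed.

Lemma xmono_minc i z a : xmono (minc i a) z = abs2 (z i) * xmono a z.
Proof. by rewrite -!abs2_mpow mpow_minc abs2M. Qed.

Lemma mdeg_minc i a : mdeg (minc i a) = (mdeg a).+1.
Proof.
rewrite /mdeg (bigD1 i) //= [in RHS](bigD1 i) //= ffunE eqxx addSn; congr (_ + _).+1.
by apply: eq_bigr => k /negbTE ki; rewrite ffunE ki.
Qed.

Lemma omega_minc i a : omega (R := R) (minc i a) = omega a * ((a i).+1%:R / (n + mdeg a).+1%:R).
Proof.
rewrite /omega mdeg_minc addnS factS (bigD1 i) //= [in RHS](bigD1 i) //= ffunE eqxx factS.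
rewrite (eq_bigr (fun k => (a k)`!%:R)) => [|k /negbTE ki]; last by rewrite ffunE ki.
have f0 : (n + mdeg a)`!%:R != 0 :> R by rewrite pnatr_eq0 -lt0n fact_gt0.
have g0 : (n + mdeg a).+1%:R != 0 :> R by rewrite pnatr_eq0.
rewrite !natrM; move: ((n + mdeg a)`!%:R) ((n + mdeg a).+1%:R) f0 g0 => x y x0 y0.
by field; rewrite x0 y0.
Qed.

Lemma sum_box_shift (V : nmodType) K (F : mindex n -> V) :
  \sum_(a <- box (n:=n) K | (0 < a j)%N) F a = \sum_(b <- box (n:=n) K | ((b j).+1 < K)%N) F (minc j b).
Proof.
rewrite -big_filter -[RHS]big_filter -(big_map (minc j) xpredT F); apply: perm_big.
have minc_inj : injective (minc j) by move=> a b /(congr1 mdec); rewrite !mincK.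
apply: uniq_perm; rewrite ?filter_uniq ?box_uniq ?(map_inj_uniq minc_inj) ?filter_uniq ?box_uniq //.
move=> a; rewrite mem_filter; apply/andP/mapP => [[aj aK]|[b]].
  exists (mdec a); last by rewrite mdecK.
  rewrite mem_filter ffunE eqxx prednK //; move: aK; rewrite !mem_box => /forallP aK.
  rewrite aK; apply/forallP => i; rewrite ffunE; case: eqP => // _.
  by rewrite (leq_ltn_trans (leq_pred _)).
rewrite mem_filter => /andP[bK]; rewrite !mem_box => /forallP bK' ->.
by rewrite ffunE eqxx; split=> //; apply/forallP => i; rewrite ffunE; case: eqP => // ->.
Qed.

(** By [omega_kap] it is [omega a / omega (mdec a)] when [a j > 0], so [\bar z_j z^a] projects to
    [kap a] times the monomial of [mdec a]. It is 0 when [a j = 0], which makes the value of [mdec]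
    there harmless. *)
Definition kap a : R := (a j)%:R / (n + mdeg a)%:R.

Lemma kap_ge0 a : 0 <= kap a.
Proof. by rewrite divr_ge0. Qed.

Lemma kap_le1 a : kap a <= 1.
Proof.
rewrite /kap; have [->|h] := posnP (n + mdeg a)%N; first by rewrite invr0 mulr0.
by rewrite ler_pdivrMr ?ltr0n // mul1r ler_nat /mdeg (bigD1 j) //= addnCA leq_addr.
Qed.

Lemma omega_kap b : omega (minc j b) = omega b * kap (minc j b).
Proof. by rewrite omega_minc /kap mdeg_minc addnS ffunE eqxx. Qed.

(* The coefficients of the Bergman projection of [\bar z_j f]. *)
Definition hshift A b : R[i] := (kap (minc j b))%:C%C * A (minc j b).

Lemma abs2_real (x : R) : abs2 (x%:C)%C = x ^+ 2.
Proof. by rewrite /abs2 /= expr0n addr0. Qed.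

Lemma hshift_le A b : abs2 (hshift A b) * omega b <= abs2 (A (minc j b)) * omega (minc j b).
Proof.
rewrite /hshift abs2M abs2_real omega_kap.
have -> : kap (minc j b) ^+ 2 * abs2 (A (minc j b)) * omega b =
  (abs2 (A (minc j b)) * (omega b * kap (minc j b))) * kap (minc j b) by ring.
rewrite ler_piMr ?kap_le1 //; apply: mulr_ge0; first exact: abs2_ge0.
by apply: mulr_ge0; [exact/ltW/omega_gt0|exact: kap_ge0].
Qed.

Lemma csum_hshift A K : csum (hshift A) K <= csum A K.+1.
Proof.
have t0 A' a : 0 <= abs2 (A' a : R[i]) * omega a by rewrite mulr_ge0 ?abs2_ge0 // ltW // omega_gt0.
apply: (@le_trans _ _ (\sum_(a <- box (n:=n) K.+1 | (0 < a j)%N) abs2 (A a) * omega a)); last first.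
  rewrite /csum [leRHS](bigID (fun a => 0 < a j)%N) /= lerDl.
  by apply: sumr_ge0 => a _.
rewrite sum_box_shift /csum -(sum_box_le _ (leqnSn K)).
rewrite [leLHS]big_mkcond [leRHS]big_mkcond; apply: ler_sum => b _; case: ifP => [|_].
  by rewrite mem_box => /forallP/(_ j); rewrite ltnS => ->; exact: hshift_le.
by case: ifP.
Qed.

(** The component of [\bar z_j z^a] orthogonal to the Bergman space. *)
Definition hphi a z : R[i] := cconj (z j) * mpow z a - (kap a)%:C%C * mpow z (mdec a).

Lemma integ_xmono a : integ (xmono a : cpt R n -> R).
Proof.
apply: eq_integ (integ_abs2 (L2_mpow a).1) => z _; exact: abs2_mpow.
Qed.

Lemma Iv_xmono a : Iv (xmono a : cpt R n -> R) = omega a.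
Proof. by rewrite /Iv /nvint vint_xmono. Qed.

Lemma L2_hphi a : L2 (hphi a).
Proof.
apply: L2B; last by apply: L2Z; exact: (L2_mpow _).1.
exact: (L2_conjz j (L2_mpow a).1).1.
Qed.

(** For [a j > 0] the squared norm is [omega a] times [(a_j + 1) / (n + |a| + 1) - a_j / (n + |a|)];
    the part proportional to [a_j] is not positive. The remaining denominator is the source of
    compactness. *)
Lemma nrm_hphi a : nrm (hphi a) <= omega a / (n + mdeg a).+1%:R.
Proof.
have [aj|aj] := posnP (a j).
  rewrite /nrm (@eq_Iv _ _ _ (xmono (minc j a))) => [|z _].
    by rewrite Iv_xmono omega_minc aj mul1r.
  by rewrite /hphi /kap aj mul0r mul0r subr0 abs2M xmono_minc abs2_mpow !abs2E cabs_conj.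
set b := mdec a; have aE : a = minc j b by rewrite mdecK.
have i1 := integ_xmono (minc j a); have i2 := integ_xmono a; have i3 := integ_xmono b.
rewrite /nrm (@eq_Iv _ _ _ (fun z => (xmono (minc j a) z + - (2 * kap a) * xmono a z) + kap a ^+ 2 * xmono b z)) => [|z _].
  rewrite IvD; [|by apply: integD => //; exact: integZ|exact: integZ].
  rewrite IvD //; last exact: integZ.
  rewrite !IvZ // !Iv_xmono omega_minc.
  have -> : kap a ^+ 2 * omega b = kap a * omega a by rewrite [in omega a]aE omega_kap -aE; ring.
  have -> : omega a * ((a j).+1%:R / (n + mdeg a).+1%:R) + - (2 * kap a) * omega a + kap a * omega a =
    omega a * ((a j).+1%:R / (n + mdeg a).+1%:R - kap a) by ring.
  rewrite ler_wpM2l ?(ltW (omega_gt0 _)) // lerBlDr -natr1 mulrDl addrC mul1r lerD2l /kap.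
  have [h|h] := posnP (n + mdeg a)%N.
    by move: aj; rewrite /mdeg in h *; move: h; rewrite (bigD1 j) //=; case: (a j) => // k; rewrite addnCA.
  by rewrite ler_wpM2l // lef_pV2 ?posrE ?ltr0n // ler_nat.
rewrite xmono_minc [in xmono a z]aE xmono_minc.
have -> : hphi a z = ((abs2 (z j) - kap a)%:C)%C * mpow z b.
  by rewrite /hphi -/b [in mpow z a]aE mpow_minc mulrA [cconj _ * _]mulrC mul_cconj -mulrBl -rmorphB.
by rewrite abs2M abs2_real abs2_mpow; ring.
Qed.

Definition wsum A K : R := \sum_(a <- box (n:=n) K) abs2 (A a) * (omega a / (n + mdeg a).+1%:R).

Lemma nrm_hankel_psum A K : nrm (fun z => \sum_(a <- box (n:=n) K) A a * hphi a z) <= wsum A K.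
Proof.
rewrite (@nrm_parseval _ _ hphi (fun u => cconj (u j))).
- by apply: ler_sum => a _; rewrite ler_wpM2l ?abs2_ge0 // nrm_hphi.
- exact: L2_hphi.
- by move=> u u1; rewrite cabs_conj u1.
move=> u u1 a z; rewrite /hphi !mpow_rotz /rotz cconjM mulrBr; congr (_ - _); first by ring.
have [aj|aj] := posnP (a j); first by rewrite /kap aj mul0r !mul0r mulr0.
have -> : mpow u a = u j * mpow u (mdec a) by rewrite -mpow_minc mdecK.
have e : cconj (u j) * u j = 1 by rewrite mulrC mul_cconj abs2E u1 expr1n.
have -> : cconj (u j) * (u j * mpow u (mdec a)) * ((kap a)%:C%C * mpow z (mdec a)) =
   (cconj (u j) * u j) * ((kap a)%:C%C * (mpow u (mdec a) * mpow z (mdec a))) by ring.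
by rewrite e mul1r.
Qed.

Lemma hankel_cvg f g A (B : R) z : (forall K, csum A K <= B) -> series_of f A -> series_of g (hshift A) ->
  inB z -> ccvg (fun K => \sum_(a <- box (n:=n) K) A a * hphi a z) (conjz j f z - g z).
Proof.
move=> AB fA gA zB; pose c b := hshift A b * mpow z b.
have E K : \sum_(a <- box (n:=n) K) A a * hphi a z =
    cconj (z j) * psum A K z - \sum_(b <- box (n:=n) K) (if ((b j).+1 < K)%N then c b else 0).
  have -> : \sum_(b <- box (n:=n) K) (if ((b j).+1 < K)%N then c b else 0) =
      \sum_(a <- box (n:=n) K | (0 < a j)%N) (kap a)%:C%C * A a * mpow z (mdec a).
    by rewrite sum_box_shift -big_mkcond; apply: eq_bigr => b _; rewrite mincK.
  rewrite [X in _ - X]big_mkcond /psum mulr_sumr -sumrB; apply: eq_bigr => a _; rewrite /hphi.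
  by case: posnP => [aj|_]; [rewrite /kap aj mul0r mul0r !subr0|]; ring.
have [t t0 [t1 zt]] := between_radius zB.
have bB K : csum (hshift A) K <= B by rewrite (le_trans (csum_hshift A K)).
have [C [q [C0 q0 q1 H]]] := coef_geometric bB t0 t1.
have cC a : cabs (c a) <= C * q ^+ mdeg a by apply: H; exact: ltW.
have first : ccvg (fun K => cconj (z j) * psum A K z) (conjz j f z).
  by apply: ccvgZ; exact: series_ccvg.
(* The shift removes the layer [b j = K - 1] from the box. What is left contains [box K.-1], so the
   tail estimate of that smaller box applies. *)
have second : ccvg (fun K => \sum_(b <- box (n:=n) K) (if ((b j).+1 < K)%N then c b else 0)) (g z).
  move=> e e0; have e2 : 0 < e / 2 by rewrite divr_gt0.
  have [K0 HK] := @gtail_small R n q C _ q0 q1 e2.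
  exists K0.+1 => -[//|L] KL; have {HK}h := HK L KL.
  rewrite (le_lt_trans (ler_cabs_dist (psum (hshift A) L z) _ _)) // (splitr e) ltrD //; last first.
    by apply: le_lt_trans h; apply: geometric_tail => //; exact: series_ccvg.
  apply: le_lt_trans h.
  have -> : psum (hshift A) L z = \sum_(b <- box (n:=n) L) (if ((b j).+1 < L.+1)%N then c b else 0).
    apply: eq_big_seq => b; rewrite mem_box => /forallP/(_ j).
    by rewrite -ltnS => ->.
  apply: sum_box_tail => // b; case: ifP => // _.
  by rewrite cabs0 mulr_ge0 ?exprn_ge0.
have := ccvgD first (ccvgZ (-1) second); rewrite mulN1r; congr ccvg.
by apply/funext => K; rewrite E mulN1r.
Qed.

Lemma nrm_hankel_le f g A (B W : R) : (forall K, csum A K <= B) -> series_of f A ->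
  series_of g (hshift A) -> (forall K, wsum A K <= W) -> nrm (fun z => conjz j f z - g z) <= W.
Proof.
move=> AB fA gA AW.
have [|||_ //] := @nrm_fatou _ _ (fun K z => \sum_(a <- box (n:=n) K) A a * hphi a z) (fun z => conjz j f z - g z) W.
- by move=> K; apply: L2_sum => a; apply: L2Z; exact: L2_hphi.
- by move=> z; exact: hankel_cvg AB fA gA.
- by move=> K; rewrite (le_trans (nrm_hankel_psum A K)).
Qed.

(** The factor [1 - |z|^2] is the one that appears, squared, in [words_defect]. *)
Definition defect f : cpt R n -> R[i] := fun z => ((1 - normsq z)%:C)%C * f z.

Lemma mB_normsq : mB (fun z : cpt R n => normsq z).
Proof. by apply: mB_measurable; exact: measurable_normsq. Qed.

Lemma normsq_ge0 z : 0 <= normsq z.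
Proof. by apply: sumr_ge0 => i _; exact: abs2_ge0. Qed.

Lemma L2_defect f : L2 f -> L2 (defect f) /\ nrm (defect f) <= nrm f.
Proof.
move=> Lf; have [|||? ?] := @L2_bound _ _ f (fun z => ((1 - normsq z)%:C)%C) 1; last by split; rewrite // -[leRHS]mul1r.
- by split; [apply: mBB; [exact: mB_cst|exact: mB_normsq]|exact: mB_cst].
- move=> z; rewrite /inB => zB; rewrite abs2_real expr_le1 ?subr_ge0 ?(ltW zB) //.
  by rewrite gerBl normsq_ge0.
- exact: Lf.
Qed.

(** On the ball [(1 - |z|^2)^2 <= 1 - |z|^2], and the squared norms of the [z_i z^a] add up to
    [omega a * (n + |a|) / (n + |a| + 1)]. The bound is that of [nrm_hphi], so [wsum] controls both
    errors. *)
Lemma nrm_defect_mpow a : nrm (defect (fun z : cpt R n => mpow z a)) <= omega a / (n + mdeg a).+1%:R.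
Proof.
have iS : integ (fun z : cpt R n => \sum_(i < n) xmono (minc i a) z).
  by apply: integ_sum => i; exact: integ_xmono.
have iD : integ (fun z : cpt R n => xmono a z + -1 * \sum_(i < n) xmono (minc i a) z).
  by apply: integD; [exact: integ_xmono|exact: integZ].
apply: (@le_trans _ _ (Iv (fun z : cpt R n => xmono a z + -1 * \sum_(i < n) xmono (minc i a) z))).
  apply: le_Iv => //; first by apply: integ_abs2; exact: (L2_defect (L2_mpow a).1).1.
  move=> z zB; rewrite /defect abs2M abs2_real abs2_mpow.
  rewrite (eq_bigr (fun i => abs2 (z i) * xmono a z)) => [|i _]; last exact: xmono_minc.
  rewrite -mulr_suml -/(normsq z).
  have x0 : 0 <= xmono a z by rewrite -abs2_mpow abs2_ge0.
  have -> : xmono a z + -1 * (normsq z * xmono a z) = (1 - normsq z) * xmono a z by ring.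
  rewrite ler_wpM2r // expr2 ler_piMl //; first by rewrite subr_ge0; exact: ltW.
  by rewrite gerBl; exact: normsq_ge0.
rewrite IvD; [|exact: integ_xmono|exact: integZ].
rewrite IvZ // Iv_sum => [|i]; last exact: integ_xmono.
rewrite Iv_xmono (eq_bigr (fun i => omega a / (n + mdeg a).+1%:R * (a i).+1%:R)) => [|i _]; last first.
  by rewrite Iv_xmono omega_minc; ring.
rewrite -mulr_sumr -natr_sum.
have -> : (\sum_(i < n) (a i).+1 = n + mdeg a)%N.
  rewrite (eq_bigr (fun i => 1 + a i)%N) // big_split /=; congr (_ + _)%N.
  by rewrite sum1_card card_ord.
rewrite le_eqVlt; apply/orP; left; apply/eqP.
have g0 : (n + mdeg a).+1%:R != 0 :> R by rewrite pnatr_eq0.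
have -> : (n + mdeg a)%:R = (n + mdeg a).+1%:R - 1 :> R by rewrite -natr1 addrK.
by move: ((n + mdeg a).+1%:R) g0 => x x0; field.
Qed.

Lemma nrm_defect_le f A (W : R) : series_of f A -> (forall K, wsum A K <= W) -> nrm (defect f) <= W.
Proof.
move=> fA AW; have LD a := (L2_defect (L2_mpow (R := R) a).1).1.
have [|||_ //] := @nrm_fatou _ _ (fun K z => \sum_(a <- box (n:=n) K) A a * defect (fun z => mpow z a) z) (defect f) W.
- by move=> K; apply: L2_sum => a; apply: L2Z; exact: LD.
- move=> z zB; have := ccvgZ ((1 - normsq z)%:C)%C (series_ccvg fA zB); congr ccvg.
  by apply/funext => K; rewrite mulr_sumr; apply: eq_bigr => a _; rewrite /defect; ring.
- move=> K; apply: le_trans (AW K).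
  rewrite (@nrm_parseval _ _ (fun a => defect (fun z => mpow z a)) (fun=> 1)) //.
  + by apply: ler_sum => a _; rewrite ler_wpM2l ?abs2_ge0 // nrm_defect_mpow.
  + by move=> u _; exact: cabs1.
  + move=> u u1 a z; rewrite /defect mpow_rotz mul1r.
    have -> : normsq (rotz u z) = normsq z.
      by rewrite !normsqE; under eq_bigr do rewrite /rotz cabsM u1 mul1r.
    by ring.
Qed.

Lemma sum_box_mono K N (F : mindex n -> R) : (forall a, 0 <= F a) -> (K <= N)%N ->
  \sum_(a <- box (n:=n) K) F a <= \sum_(a <- box (n:=n) N) F a.
Proof.
move=> F0 KN; rewrite -(sum_box_le _ KN) [leRHS](bigID (fun a => a \in box (n:=n) K)) /= lerDl.
by apply: sumr_ge0.
Qed.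

(** Inside [box L] the damping is dropped; outside, the degree is at least [L], so the damping is at
    most [1 / L.+1]. *)
Lemma wsum_le A (B : R) K L : (forall K, csum A K <= B) -> wsum A K <= csum A L + B / L.+1%:R.
Proof.
move=> AB; have o0 a : 0 <= abs2 (A a) * omega a by rewrite mulr_ge0 ?abs2_ge0 // ltW // omega_gt0.
have wE a : abs2 (A a) * (omega a / (n + mdeg a).+1%:R) = abs2 (A a) * omega a / (n + mdeg a).+1%:R by rewrite mulrA.
have w0 a : 0 <= abs2 (A a) * (omega a / (n + mdeg a).+1%:R) by rewrite wE divr_ge0.
apply: (le_trans (sum_box_mono w0 (leq_maxl K L))).
rewrite (bigID (fun a => a \in box (n:=n) L)) /= lerD //.
  rewrite (sum_box_le _ (leq_maxr K L)); apply: ler_sum => a _.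
  by rewrite wE ler_pdivrMr ?ltr0n // ler_peMr // ler1n.
apply: (@le_trans _ _ (csum A (maxn K L) / L.+1%:R)); last by rewrite ler_wpM2r ?invr_ge0.
rewrite /csum mulr_suml big_mkcond; apply: ler_sum => a _; case: ifPn => [aL|_]; last by rewrite divr_ge0.
rewrite wE ler_wpM2l // lef_pV2 ?posrE ?ltr0n // ler_nat ltnS.
apply: contraNT aL; rewrite -ltnNge mem_box => h; apply/forallP => i; apply: leq_ltn_trans h.
by rewrite /mdeg (bigD1 i) //= addnCA leq_addr.
Qed.

Lemma wsum_small (A : nat -> mindex n -> R[i]) (B e : R) : (forall k K, csum (A k) K <= B) ->
  (forall a, ccvg (fun k => A k a) 0) -> 0 < e ->
  exists N, forall k, (N <= k)%N -> forall K, wsum (A k) K <= e.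
Proof.
move=> AB A0 e0; have B0 : 0 <= B by apply: le_trans (AB 0%N 0%N); exact: csum_ge0.
have e2 : 0 < e / 2 by rewrite divr_gt0.
have [L HL] : exists L : nat, B / L.+1%:R <= e / 2.
  exists (Num.truncn (B / (e / 2))); rewrite ler_pdivrMr ?ltr0n // mulrC -ler_pdivrMr //.
  by rewrite ltW // truncnS_gt.
have : csum (A k) L @[k --> \oo] --> (0 : R).
  have -> : (0 : R) = csum (n := n) (fun=> 0) L.
    by rewrite /csum big1 // => a _; rewrite abs2E cabs0 expr0n mul0r.
  apply: cvg_sum_seq => a; apply: cvgM; last exact: cvg_cst.
  exact: ccvg_abs2.
move=> /cvgrPdist_lt /(_ _ e2)[N _ HN]; exists N => k Nk K.
rewrite (le_trans (wsum_le K L (AB k))) // (splitr e) lerD //.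
have := HN k Nk; rewrite /= sub0r normrN ger0_norm ?csum_ge0 //; exact: ltW.
Qed.

End HankelApproximation.

(** * Pointwise, coefficientwise and locally uniform decay *)

Section CoefficientDecay.
Context {R : realType} {n : nat}.
Implicit Types (u z w : cpt R n) (a b : mindex n) (A : nat -> mindex n -> R[i]) (d : nat -> cpt R n -> R[i]).

(** Up to an error uniform in [k], a coefficient is a combination of the values of [d k] at finitely
    many points of one torus orbit. *)
Lemma coef_decay d A (B : R) : (forall k K, csum (A k) K <= B) -> (forall k, series_of (d k) (A k)) ->
  (forall z, inB z -> ccvg (fun k => d k z) 0) -> forall a, ccvg (fun k => A k a) 0.
Proof.
move=> AB dA d0 a; have B0 : 0 <= B by apply: le_trans (AB 0%N 0%N); exact: csum_ge0.
(* The point with all coordinates [x] has norm at most 1/2, and no monomial vanishes at it. *)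
pose x : R := (2 * n.+1%:R)^-1; have x0 : 0 < x by rewrite invr_gt0 mulr_gt0.
pose t : R := 2^-1; have t0 : 0 < t by rewrite invr_gt0.
have t1 : t < 1 by rewrite invf_lt1 // ltr1n.
pose z : cpt R n := fun=> (x%:C)%C.
have zi i : cabs (z i) = x by rewrite cabs_real ger0_norm // ltW.
have zt : normsq z <= t ^+ 2.
  rewrite normsqE (eq_bigr (fun=> x ^+ 2)) => [|i _]; last by rewrite zi.
  rewrite sumr_const card_ord -[_ *+ n]mulr_natl /x invfM exprMn mulrCA -/t.
  rewrite ler_piMr ?sqr_ge0 // exprVn ler_pdivrMr ?exprn_gt0 // mul1r -natrX ler_nat.
  by rewrite expnS expn1 (leq_trans (leqnSn n)) // leq_pmulr.
have mz0 : 0 < cabs (mpow z a).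
  rewrite /mpow cabs_prod prodr_gt0 // => i _; by rewrite cabsX zi exprn_gt0.
have wB w : normsq w <= t ^+ 2 -> inB w.
  by move=> wt; rewrite /inB (le_lt_trans wt) // expr_lt1 // ltW.
have [C [q [C0 q0 q1 H]]] := @coef_geometric_unif R n B t B0 t0 t1.
move=> e e0; pose e' := e * cabs (mpow z a) / 2.
have e'0 : 0 < e' by rewrite /e' divr_gt0 // mulr_gt0.
have [K0 HK] := @gtail_small R n q C e' q0 q1 e'0; have [N1 HN1] := mindex_in_box a.
pose N := maxn (maxn K0 N1) 1.
have [NK [NN N0]] : (K0 <= N)%N /\ (N1 <= N)%N /\ (0 < N)%N.
  by have := leqnn N; rewrite {1}/N !geq_max => /andP[/andP[-> ->] ->].
have near k : cabs (ucoef N (fun u => d k (rotz u z)) a - A k a * mpow z a) <= C * gtail (n := n) q N.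
  apply: ucoef_series_le => //; first exact: HN1.
  move=> w wz; have wt : normsq w <= t ^+ 2 by rewrite (le_trans (normsq_mono wz)).
  apply: geometric_tail => //; [by move=> b; exact: H|exact/series_ccvg/wB].
have cu : ccvg (fun k => ucoef N (fun u => d k (rotz u z)) a) 0.
  rewrite -(mulr0 ((N ^ n)%:R^-1 : R[i])); apply: ccvgZ.
  suff : ccvg (fun k => \sum_(l : {ffun 'I_n -> 'I_N}) d k (rotz (torus (fun=> 1) l) z) / mpow (torus (fun=> 1) l) a)
      (\sum_(l : {ffun 'I_n -> 'I_N}) 0) by rewrite big1.
  apply: ccvg_sum => l; rewrite -(mulr0 (mpow (torus (fun=> 1) l) a)^-1).
  have lB : inB (rotz (torus (fun=> 1) l) z).
    apply: wB; rewrite (le_trans (normsq_mono _) zt) // => i.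
    by rewrite /rotz cabsM cabs_torus // mul1r.
  have := ccvgZ (mpow (torus (fun=> 1) l) a)^-1 (d0 _ lB).
  by congr ccvg; apply/funext => k; rewrite mulrC.
have [K HKk] := cu _ e'0; exists K => k kK; rewrite subr0.
rewrite -(ltr_pM2r mz0) -cabsM.
have -> : A k a * mpow z a = - (ucoef N (fun u => d k (rotz u z)) a - A k a * mpow z a) + (ucoef N (fun u => d k (rotz u z)) a - 0) by ring.
rewrite (le_lt_trans (ler_cabsD _ _)) // cabsN (_ : e * cabs (mpow z a) = e' + e'); last by rewrite /e'; field.
by rewrite ltrD ?HKk // (le_lt_trans (near k)) // HK.
Qed.

Lemma unif_decay (g : nat -> cpt R n -> R[i]) A (B t e : R) : (forall k K, csum (A k) K <= B) ->
  (forall k, series_of (g k) (A k)) -> (forall a, ccvg (fun k => A k a) 0) ->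
  0 < t -> t < 1 -> 0 < e ->
  exists N, forall k, (N <= k)%N -> forall z, normsq z <= t ^+ 2 -> abs2 (g k z) <= e.
Proof.
move=> AB gA A0 t0 t1 e0; have B0 : 0 <= B by apply: le_trans (AB 0%N 0%N); exact: csum_ge0.
have [C [q [C0 q0 q1 H]]] := @coef_geometric_unif R n B t B0 t0 t1.
pose e' := Num.sqrt e; have e'0 : 0 < e' by rewrite sqrtr_gt0.
have e2 : 0 < e' / 2 by rewrite divr_gt0.
have [K HK] := @gtail_small R n q C _ q0 q1 e2.
have [N HN] : exists N, forall k, (N <= k)%N -> \sum_(a <- box (n:=n) K) cabs (A k a) < e' / 2.
  have : \sum_(a <- box (n:=n) K) cabs (A k a) @[k --> \oo] --> (\sum_(a <- box (n:=n) K) 0 : R).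
    apply: cvg_sum_seq => a; apply/cvgrPdist_lt => e3 /(A0 a)[N HN]; exists N => // k /= /HN.
    by rewrite subr0 sub0r normrN ger0_norm // cabs_ge0.
  rewrite big1 // => /cvgrPdist_lt /(_ _ e2)[N _ HN]; exists N => k /HN /=.
  by rewrite sub0r normrN ger0_norm // sumr_ge0 // => a _; exact: cabs_ge0.
exists N => k /HN kN z zt.
have zB : inB z by rewrite /inB (le_lt_trans zt) // expr_lt1 // ltW.
have z1 i : cabs (z i) <= 1.
  by rewrite -(@expr_le1 _ 2) ?cabs_ge0 // (le_trans (cabs_le_normsq z i)) // ltW.
rewrite abs2E -[leRHS](sqr_sqrtr (ltW e0)) lerXn2r ?nnegrE ?cabs_ge0 ?(ltW e'0) //.
have -> : g k z = - (psum (A k) K z - g k z) + psum (A k) K z by ring.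
rewrite (le_trans (ler_cabsD _ _)) // cabsN -/e' (splitr e') lerD //.
  apply: ltW; apply: le_lt_trans (HK K (leqnn _)).
  apply: geometric_tail => //; [by move=> b; exact: H|exact: series_ccvg].
rewrite (le_trans (ler_cabs_sum _ _ _)) // (le_trans _ (ltW kN)) //; apply: ler_sum => a _.
rewrite cabsM ler_piMr ?cabs_ge0 // /mpow cabs_prod.
by apply: prodr_ile1 => i _; rewrite cabsX exprn_ge0 ?cabs_ge0 // exprn_ile1 // cabs_ge0.
Qed.

End CoefficientDecay.

(** * Words in the coordinates *)

Section WordFamily.
Context {R : realType} {n : nat}.
Variable j : 'I_n.
Implicit Types (z w : cpt R n) (s : seq 'I_n) (f g : cpt R n -> R[i]).

Definition psi s z : R[i] := \prod_(i <- s) z i.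

(* [chi s] is the partial derivative of [psi s] in the j-th variable. *)
Fixpoint chi s z : R[i] := if s is i :: s' then z i * chi s' z + (i == j)%:R * psi s' z else 0.

Fixpoint words m : seq (seq 'I_n) :=
  if m is m'.+1 then [seq i :: s | s <- words m', i <- enum 'I_n] else [:: [::]].

Lemma sum_words m (F : seq 'I_n -> R) :
  \sum_(s <- words m.+1) F s = \sum_(s <- words m) \sum_(i < n) F (i :: s).
Proof. by rewrite /= big_allpairs_dep; apply: eq_bigr => s _; rewrite big_enum. Qed.

Lemma psi_cons i s z : psi (i :: s) z = z i * psi s z.
Proof. by rewrite /psi big_cons. Qed.

(** The shape of the recursions below: a new first letter [i] contributes the factor [|z_i|^2], and
    an additional term only when [i = j]. *)
Lemma sum_split (X Y : R) z (F : 'I_n -> R) :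
  (forall i, F i = abs2 (z i) * X + (i == j)%:R * Y) -> \sum_(i < n) F i = normsq z * X + Y.
Proof.
move=> FE; rewrite (eq_bigr _ (fun i _ => FE i)) big_split /= -mulr_suml; congr (_ + _).
rewrite (bigD1 j) //= eqxx mul1r big1 ?addr0 // => i /negbTE ->.
by rewrite mul0r.
Qed.

Lemma words_psi m z : \sum_(s <- words m) abs2 (psi s z) = normsq z ^+ m.
Proof.
elim: m => [|m IH]; first by rewrite big_seq1 /psi big_nil abs2E cabs1 expr1n.
rewrite sum_words exprS -IH mulr_sumr; apply: eq_bigr => s _.
rewrite (@sum_split (abs2 (psi s z)) 0 z) ?addr0 // => i.
by rewrite psi_cons abs2M mulr0 addr0.
Qed.

Definition cross s z : R := complex.Re (cconj (z j) * psi s z * cconj (chi s z)).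

(** The derivative in [\bar z_j] of [sum_s |psi_s|^2 = |z|^(2m)], multiplied by [\bar z_j]; the
    proof is by induction on the length of words. *)
Lemma words_cross m z :
  \sum_(s <- words m) cross s z = m%:R * abs2 (z j) * normsq z ^+ m.-1.
Proof.
elim: m => [|m IH]; first by rewrite big_seq1 /cross ReM /= oppr0 !mulr0 subr0 !mul0r.
rewrite sum_words.
transitivity (\sum_(s <- words m) (normsq z * cross s z + abs2 (z j) * abs2 (psi s z))).
  apply: eq_bigr => s _; apply: sum_split => i; rewrite /cross psi_cons /=.
  case: eqVneq => [->|_].
    by case: (z j) (psi s z) (chi s z) => [? ?] [? ?] [? ?]; rewrite /abs2 /=; ring.
  by case: (z i) (z j) (psi s z) (chi s z) => [? ?] [? ?] [? ?] [? ?]; rewrite /abs2 /=; ring.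
rewrite big_split /= -!mulr_sumr IH words_psi.
by case: m {IH} => [|m] /=; rewrite ?exprS ?expr0 -?natr1; ring.
Qed.

(** The right-hand side is the mixed derivative of [|z|^(2m)] in [z_j] and [\bar z_j]. *)
Lemma words_chi m z : \sum_(s <- words m) abs2 (chi s z) =
  m%:R * normsq z ^+ m.-1 + m%:R * m.-1%:R * abs2 (z j) * normsq z ^+ m.-2.
Proof.
elim: m => [|m IH]; first by rewrite big_seq1 abs2E cabs0 expr0n !mul0r addr0.
rewrite sum_words.
transitivity (\sum_(s <- words m) (normsq z * abs2 (chi s z) + (2 * cross s z + abs2 (psi s z)))).
  apply: eq_bigr => s _; apply: sum_split => i; rewrite /cross /=.
  case: eqVneq => [->|_].
    by case: (z j) (psi s z) (chi s z) => [? ?] [? ?] [? ?]; rewrite /abs2 /=; ring.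
  by case: (z i) (z j) (psi s z) (chi s z) => [? ?] [? ?] [? ?] [? ?]; rewrite /abs2 /=; ring.
rewrite big_split /= big_split /= -!mulr_sumr IH words_psi words_cross.
by case: m {IH} => [|[|m]] /=; rewrite ?exprS ?expr0 -?natr1 -?natr1; ring.
Qed.

(** With [r = |z|^2] and [x = |z_j|^2] the expanded square sums to [x r^(m-2) (1 - r)^2 + (r^(m-1) -
    x r^(m-2)) / m]; the condition [1 < m] keeps these exponents honest. *)
Lemma words_defect m z : (1 < m)%N -> inB z ->
  \sum_(s <- words m) abs2 (cconj (z j) * psi s z - ((m%:R^-1 : R)%:C)%C * chi s z) <=
  (1 - normsq z) ^+ 2 + m%:R^-1.
Proof.
move=> m1 zB; set v : R := m%:R^-1; set r := normsq z; set x := abs2 (z j).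
have r0 : 0 <= r by apply: sumr_ge0 => i _; exact: abs2_ge0.
have r1 : r <= 1 by exact: ltW.
have x0 : 0 <= x by exact: abs2_ge0.
have xr : x <= r by rewrite /x abs2E; exact: cabs_le_normsq.
have -> : \sum_(s <- words m) abs2 (cconj (z j) * psi s z - (v%:C)%C * chi s z) =
    \sum_(s <- words m) (x * abs2 (psi s z) + (- (2 * v) * cross s z + v ^+ 2 * abs2 (chi s z))).
  apply: eq_bigr => s _; rewrite /cross /x.
  by case: (z j) (psi s z) (chi s z) => [? ?] [? ?] [? ?]; rewrite /abs2 /=; ring.
rewrite !big_split /= -!mulr_sumr words_psi words_cross words_chi -/r -/x.
case: m m1 @v => [|[|m]] // _ v; rewrite /= in v *.
have m0 : m.+2%:R != 0 :> R by rewrite pnatr_eq0.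
have v0 : 0 <= v by rewrite invr_ge0.
have -> : x * r ^+ m.+2 + (- (2 * v) * (m.+2%:R * x * r ^+ m.+1) +
    v ^+ 2 * (m.+2%:R * r ^+ m.+1 + m.+2%:R * m.+1%:R * x * r ^+ m)) =
    x * r ^+ m * (1 - r) ^+ 2 + (v * r ^+ m.+1 - v * (x * r ^+ m)).
  have -> : m.+1%:R = m.+2%:R - 1 :> R by rewrite -[m.+2%:R]natr1 addrK.
  by rewrite /v !exprS; move: (m.+2%:R) m0 (r ^+ m) => y y0 rm; field.
have rm1 : r ^+ m <= 1 by rewrite exprn_ile1.
have rm0 : 0 <= r ^+ m by rewrite exprn_ge0.
apply: lerD.
  by rewrite ler_piMl ?sqr_ge0 // mulr_ile1 // (le_trans xr).
rewrite (@le_trans _ _ (v * r ^+ m.+1)) //.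
  by rewrite gerBl !mulr_ge0.
by rewrite ler_piMr // exprn_ile1.
Qed.

Lemma bergman_psi s f : bergman f -> bergman (fun z => psi s z * f z).
Proof.
elim: s f => [|i s IH] f bf.
  by have := bf; congr bergman; apply/funext => z; rewrite /psi big_nil mul1r.
have := bergman_mulz i (IH f bf); congr bergman.
by apply/funext => z; rewrite /mulz psi_cons mulrA.
Qed.

Lemma bergman_chi s f : bergman f -> bergman (fun z => chi s z * f z).
Proof.
elim: s f => [|i s IH] f bf.
  by have := @bergman0 R n; congr bergman; apply/funext => z; rewrite mul0r.
have := bergmanD (bergman_mulz i (IH f bf)) (bergmanZ (i == j)%:R (bergman_psi s bf)); congr bergman.
by apply/funext => z; rewrite /mulz /=; ring.
Qed.

Lemma mBC_psi s : mBC (psi s).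
Proof.
elim: s => [|i s IH].
  by apply: eq_mBC (mBC_cst 1) => z _; rewrite /psi big_nil.
by apply: eq_mBC (mBCM (mBC_coord i) IH) => z _; rewrite psi_cons.
Qed.

Lemma mBC_chi s : mBC (chi s).
Proof.
elim: s => [|i s IH]; first exact: mBC_cst.
by apply: mBCD; apply: mBCM => //; [exact: mBC_coord|exact: mBC_cst|exact: mBC_psi].
Qed.

Lemma word_member m s : size s = m -> s \in words m.
Proof.
elim: s m => [|i s IH] [|m] // [sm]; apply/allpairsPdep.
by exists s, i; rewrite IH // mem_enum.
Qed.

Lemma psi_le1 s z : inB z -> abs2 (psi s z) <= 1.
Proof.
move=> zB; have r0 : 0 <= normsq z by apply: sumr_ge0 => i _; exact: abs2_ge0.
apply: (@le_trans _ _ (normsq z ^+ size s)); last by rewrite exprn_ile1 // ltW.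
rewrite -words_psi (big_rem s) ?word_member //= lerDl.
by apply: sumr_ge0 => s' _; exact: abs2_ge0.
Qed.

Lemma chi_le s z : inB z -> abs2 (chi s z) <= (size s)%:R + (size s)%:R * (size s)%:R.
Proof.
move=> zB; have r0 : 0 <= normsq z by apply: sumr_ge0 => i _; exact: abs2_ge0.
have rk k : normsq z ^+ k <= 1 by rewrite exprn_ile1 // ltW.
have rk0 k : 0 <= normsq z ^+ k by rewrite exprn_ge0.
have x1 : abs2 (z j) <= 1 by rewrite abs2E (le_trans (cabs_le_normsq z j)) // ltW.
apply: (@le_trans _ _ (\sum_(s' <- words (size s)) abs2 (chi s' z))).
  rewrite (big_rem s) ?word_member //= lerDl.
  by apply: sumr_ge0 => s' _; exact: abs2_ge0.
rewrite words_chi lerD ?ler_piMr // -!mulrA ler_wpM2l // (@le_trans _ _ (size s).-1%:R) //.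
  by rewrite ler_piMr // mulr_ile1 ?abs2_ge0.
by rewrite ler_nat leq_pred.
Qed.

Lemma abs2N (x : R[i]) : abs2 (- x) = abs2 x.
Proof. by rewrite !abs2E cabsN. Qed.

Lemma L2_psi s f : L2 f -> L2 (fun z => psi s z * f z).
Proof. by move=> Lf; apply: (L2_bound (mBC_psi s) (psi_le1 s) Lf).1. Qed.

Lemma L2_chi s f : L2 f -> L2 (fun z => chi s z * f z).
Proof. by move=> Lf; apply: (L2_bound (mBC_chi s) (chi_le s) Lf).1. Qed.

(* [psi f - chi d / m = psi (f - \bar z_j d) + (\bar z_j psi - chi / m) d] *)
Lemma words_estimate m f d : (1 < m)%N -> L2 f -> L2 d ->
  \sum_(s <- words m) nrm (fun z => psi s z * f z - ((m%:R^-1 : R)%:C)%C * (chi s z * d z)) <=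
  2 * nrm (fun z => conjz j d z - f z) + 2 * (nrm (defect d) + m%:R^-1 * nrm d).
Proof.
move=> m1 Lf Ld; set v : R := m%:R^-1.
pose h s z := psi s z * f z - (v%:C)%C * (chi s z * d z).
have Lh s : L2 (h s) by apply: L2B; [exact: L2_psi|apply: L2Z; exact: L2_chi].
have LX : L2 (fun z => conjz j d z - f z) by apply: L2B => //; exact: (L2_conjz j Ld).1.
have [iX iD id] := And3 (integ_abs2 LX) (integ_abs2 (L2_defect Ld).1) (integ_abs2 Ld).
rewrite -[leLHS]/(\sum_(s <- words m) Iv (fun z => abs2 (h s z))).
rewrite -(Iv_sum _ (fun s => integ_abs2 (Lh s))) /nrm.
rewrite -(IvZ 2 iX) -(IvZ v id) -(IvD iD (integZ v id)) -(IvZ 2 (integD iD (integZ v id))).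
rewrite -IvD; [|exact: integZ|by apply: integZ; apply: integD => //; exact: integZ].
apply: le_Iv.
- by apply: integ_sum => s; exact/integ_abs2.
- by apply: integD; [exact: integZ|apply: integZ; apply: integD => //; exact: integZ].
move=> z zB.
apply: (@le_trans _ _ (\sum_(s <- words m) (2 * abs2 (conjz j d z - f z) * abs2 (psi s z) +
    2 * abs2 (d z) * abs2 (cconj (z j) * psi s z - (v%:C)%C * chi s z)))).
  apply: ler_sum => s _.
  have -> : h s z = - (psi s z * (conjz j d z - f z)) + (cconj (z j) * psi s z - (v%:C)%C * chi s z) * d z.
    by rewrite /h /conjz; ring.
  rewrite (le_trans (abs2D_le _ _)) // abs2N !abs2M le_eqVlt; apply/orP; left; apply/eqP; ring.
rewrite big_split /= -!mulr_sumr words_psi.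
have r0 : 0 <= normsq z by apply: sumr_ge0 => i _; exact: abs2_ge0.
rewrite lerD //.
  by rewrite ler_piMr ?mulr_ge0 ?abs2_ge0 // exprn_ile1 // ltW.
rewrite (le_trans (ler_wpM2l _ (words_defect m1 zB))) ?mulr_ge0 ?abs2_ge0 //.
by rewrite /defect abs2M abs2_real -/v; lra.
Qed.

End WordFamily.

(** * Carleson estimate and essential normality *)

Section BorelMeasurability.
Context {R : realType} {n : nat}.
Local Notation T := (borelC R n).
Local Notation B := (ballB (n := n) : set T).
Implicit Types (f g : cpt R n -> R[i]).

Lemma copen_Re (i : 'I_n) (x : R) : copen [set z : cpt R n | x < complex.Re (z i)].
Proof.
move=> z /= h; exists ((complex.Re (z i) - x) ^+ 2); split; first by rewrite exprn_gt0 // subr_gt0.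
move=> w hw; have : cabs (w i - z i) < complex.Re (z i) - x.
  rewrite -(@ltr_pXn2r _ 2) ?nnegrE ?cabs_ge0 ?subr_ge0 ?(ltW h) //.
  exact: le_lt_trans (cabs_le_normsq (fun i => w i - z i) i) hw.
move=> /(le_lt_trans (normr_Re _)); rewrite ltr_norml => /andP[+ _].
by case: (w i) (z i) => [? ?] [? ?] /=; lra.
Qed.

Lemma copen_Im (i : 'I_n) (x : R) : copen [set z : cpt R n | x < complex.Im (z i)].
Proof.
move=> z /= h; exists ((complex.Im (z i) - x) ^+ 2); split; first by rewrite exprn_gt0 // subr_gt0.
move=> w hw; have : cabs (w i - z i) < complex.Im (z i) - x.
  rewrite -(@ltr_pXn2r _ 2) ?nnegrE ?cabs_ge0 ?subr_ge0 ?(ltW h) //.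
  exact: le_lt_trans (cabs_le_normsq (fun i => w i - z i) i) hw.
move=> /(le_lt_trans (normr_Im _)); rewrite ltr_norml => /andP[+ _].
by case: (w i) (z i) => [? ?] [? ?] /=; lra.
Qed.

Lemma measurable_open_rays (h : T -> R) : (forall x : R, copen [set z : cpt R n | x < h z]) ->
  measurable_fun [set: T] h.
Proof.
move=> H; apply: (measurability _ (RGenOInfty.measurableE R)) => //= _ [_ [x ->] <-].
rewrite setTI; apply: sub_sigma_algebra.
have -> : h @^-1` `]x, +oo[%classic = [set z : cpt R n | x < h z].
  by apply/seteqP; split=> z /=; rewrite in_itv /= andbT.
exact: H.
Qed.

(** The measure [mu] lives on the Borel sets of [cpt R n], the volume integral on cylinder sets of
    [nat -> R]; measurability is therefore established for each. *)
Definition mbC f := measurable_fun [set: T] (fun z : T => complex.Re (f z)) /\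
  measurable_fun [set: T] (fun z : T => complex.Im (f z)).

Lemma mbC_cst c : mbC (fun=> c).
Proof. by split; exact: measurable_cst. Qed.

Lemma mbC_coord (i : 'I_n) : mbC (fun z => z i).
Proof. by split; apply: measurable_open_rays => x; [exact: copen_Re|exact: copen_Im]. Qed.

Lemma mbCD f g : mbC f -> mbC g -> mbC (fun z => f z + g z).
Proof.
move=> [f1 f2] [g1 g2]; split.
  by under eq_fun do rewrite ReD; exact: measurable_funD.
by under eq_fun do rewrite ImD; exact: measurable_funD.
Qed.

Lemma mbCM f g : mbC f -> mbC g -> mbC (fun z => f z * g z).
Proof.
move=> [f1 f2] [g1 g2]; split.
  by under eq_fun do rewrite ReM; apply: measurable_funB; exact: measurable_funM.
by under eq_fun do rewrite ImM; apply: measurable_funD; exact: measurable_funM.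
Qed.

Lemma mbC_psum c K : mbC (psum c K).
Proof.
rewrite /psum; elim: (box K) => [|a s IH].
  by under eq_fun do rewrite big_nil; exact: mbC_cst.
under eq_fun do rewrite big_cons; apply: mbCD => //; apply: mbCM; first exact: mbC_cst.
rewrite /mpow; elim: (index_enum _) => [|i t IHt].
  by under eq_fun do rewrite big_nil; exact: mbC_cst.
under eq_fun do rewrite big_cons; apply: mbCM => //.
elim: (a i) => [|k IHk]; first by under eq_fun do rewrite expr0; exact: mbC_cst.
by under eq_fun do rewrite exprS; apply: mbCM => //; exact: mbC_coord.
Qed.

Lemma measurable_normsq_borel : measurable_fun [set: T] (fun z : T => normsq z).
Proof.
apply: measurable_sum => i; have [h1 h2] := mbC_coord i.
by apply: measurable_funD; exact: measurable_funX.
Qed.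

Lemma measurable_ballB : measurable B.
Proof.
rewrite -[B]setTI; have := measurable_fun_ltr measurable_normsq_borel (@measurable_cst _ _ T R setT 1).
by move=> /(_ measurableT [set true] I).
Qed.

Lemma measurable_abs2_series f A : series_of f A -> measurable_fun B (fun z : T => abs2 (f z)).
Proof.
move=> fA; have mp k : measurable_fun B (fun z : T => abs2 (psum A k z)).
  apply: measurable_funTS; have [h1 h2] := mbC_psum A k.
  by apply: measurable_funD; exact: measurable_funX.
by apply: (measurable_fun_cvg mp) => z zB; apply: ccvg_abs2; exact: series_ccvg.
Qed.

Lemma measurable_abs2_bergman f : bergman f -> measurable_fun B (fun z : T => (abs2 (f z))%:E).
Proof.
by move=> /bergman_series[A fA]; apply/measurable_EFinP; exact: measurable_abs2_series fA.
Qed.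

End BorelMeasurability.

(** * The Carleson estimate and the distance to [P] *)

Section CarlesonMeasure.
Context {R : realType} {n : nat}.
Local Notation T := (borelC R n).
Local Notation B := (ballB (n := n) : set T).
Variable M : set (cpt R n).
Hypothesis hM : M `<=` ballB (n := n).
Variable mu : {measure set T -> \bar R}.
Hypothesis mu_fin : (mu setT < +oo)%E.
Hypothesis mu_M : forall A : set T, measurable A -> A `&` M = set0 -> mu A = 0%E.
Variables C c : R.
Hypothesis C0 : 0 < C.
Hypothesis c0 : 0 < c.
(** [M] is an arbitrary subset and may fail to be Borel, so the integral runs over the ball; [mu_M]
    expresses that [mu] is carried by [M]. *)
Definition muint (f : cpt R n -> R[i]) : \bar R := (\int[mu]_(z in ballB (n := n)) (abs2 (f z))%:E)%E.
Hypothesis lower : forall f, inQ M f -> (c%:E * bnorm2 f <= muint f)%E.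
Hypothesis upper : forall f, inQ M f -> (muint f <= C%:E * bnorm2 f)%E.
Implicit Types (f g h : cpt R n -> R[i]).

(** The part of the ball where [f] and [g] differ is Borel and disjoint from [M], hence null. *)
Lemma muint_eq_on f g : bergman f -> bergman g -> (forall z, M z -> f z = g z) -> muint f = muint g.
Proof.
move=> bf bg fg; have bd := bergmanB bf bg.
apply: ge0_ae_eq_integral => //.
- exact: measurable_ballB.
- exact: measurable_abs2_bergman.
- exact: measurable_abs2_bergman.
- by move=> z _; rewrite lee_fin abs2_ge0.
- by move=> z _; rewrite lee_fin abs2_ge0.
exists (B `&` [set z : T | (abs2 (f z - g z))%:E != 0%E]); split.
- by apply: emeasurable_neq => //; [exact: measurable_ballB|exact: measurable_abs2_bergman].
- apply: mu_M.
    by apply: emeasurable_neq => //; [exact: measurable_ballB|exact: measurable_abs2_bergman].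
  apply/seteqP; split=> // z [[_ /=]] /negP nz zM; apply: nz.
  by rewrite fg // subrr abs2E cabs0 expr0n.
- move=> z /= /not_implyP[zB nz]; split=> //; apply/eqP => -[] /eqP.
  by rewrite abs2E sqrf_eq0 cabs_eq0 subr_eq0 => /eqP E; apply: nz; rewrite E.
Qed.

Lemma bergman_split h : bergman h -> exists p, [/\ inP M p, inQ M (fun z => h z - p z) &
  nrm (fun z => h z - p z) <= nrm h].
Proof.
move=> bh; have Lh := bergman_L2 bh.
have [p [hp orth]] := projection_exists hM Lh.
have Lq : L2 (fun z => h z - p z) by apply: L2B => //; exact: inP_L2 hp.
exists p; split=> //.
  split; first by apply: bergmanB => //; case: hp.
  by move=> f hf; exact: orthogonal_ip Lq orth hf.
have := orthogonal_distance Lh (inP0 M) hp orth.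
by rewrite (@eq_nrm _ _ (fun z => h z - 0) h) // => z _; rewrite subr0.
Qed.

(** Removing the component in [P] changes nothing on [M] and does not increase the norm, so the
    upper bound extends from [Q] to the whole Bergman space. *)
Lemma carleson h : bergman h -> (muint h <= (C * nrm h)%:E)%E.
Proof.
move=> bh; have [p [hp hq qh]] := bergman_split bh.
rewrite (@muint_eq_on h (fun z => h z - p z)) //; last 2 first.
- by case: hq.
- by move=> z zM; case: hp => _ ->; rewrite ?subr0.
rewrite (le_trans (upper hq)) // bnorm2_nrm; last by apply: bergman_L2; case: hq.
by rewrite -EFinM lee_fin ler_pM2l.
Qed.

Variable j : 'I_n.

Lemma muint_words (m : nat) f : bergman f ->
  (\int[mu]_(z in ballB (n := n)) (normsq z ^+ m * abs2 (f z))%:E)%E =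
  (\sum_(s <- words (n := n) m) muint (fun z => (psi s z * f z)%R))%E.
Proof.
move=> bf; rewrite /muint -ge0_integral_sum //.
- apply: eq_integral => z _; rewrite sumEFin; congr EFin.
  by rewrite -(words_psi j m (z : cpt R n)) mulr_suml; apply: eq_bigr => s _; rewrite abs2M.
- exact: measurable_ballB.
- by move=> s; apply: measurable_abs2_bergman; exact: bergman_psi.
- by move=> s z _; rewrite lee_fin abs2_ge0.
Qed.

(* As [d] vanishes on [M], [psi * G] may be replaced there by [psi * G - chi * d / m]. *)
Lemma muint_weighted m f d : (1 < m)%N -> bergman f -> inP M d ->
  (\int[mu]_(z in ballB (n := n)) (normsq z ^+ m * abs2 (f z))%:E <=
   (C * (2 * nrm (fun z => conjz j d z - f z) + 2 * (nrm (defect d) + m%:R^-1 * nrm d)))%:E)%E.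
Proof.
move=> m1 bf hd; have bd := hd.1; rewrite muint_words //.
have bh s : bergman (fun z => psi s z * f z - ((m%:R^-1 : R)%:C)%C * (chi j s z * d z)).
  by apply: bergmanB; [exact: bergman_psi|apply: bergmanZ; exact: bergman_chi].
apply: (@le_trans _ _ (\sum_(s <- words (n := n) m)
  (C * nrm (fun z => psi s z * f z - ((m%:R^-1 : R)%:C)%C * (chi j s z * d z)))%R%:E)%E).
  apply: lee_sum => s _; rewrite (@muint_eq_on _ _ _ (bh s)) ?carleson //; first exact: bergman_psi.
  by move=> z zM; rewrite hd.2 // !mulr0 subr0.
rewrite sumEFin lee_fin -mulr_sumr ler_pM2l //.
by apply: words_estimate => //; exact: bergman_L2.
Qed.

(** Where the weight is at least 1/2, [|f|^2] is at most twice the weighted square; elsewhere it is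
    at most [e], and [mu] has finite mass. *)
Lemma muint_split m f (e : R) : (0 < m)%N -> bergman f -> 0 <= e ->
  (forall z, normsq z ^+ m < 2^-1 -> abs2 (f z) <= e) ->
  (muint f <= 2%:E * \int[mu]_(z in ballB (n := n)) (normsq z ^+ m * abs2 (f z))%:E + (e * fine (mu setT))%:E)%E.
Proof.
move=> m0 bf e0 fe; have mf := measurable_abs2_bergman bf.
have mw : measurable_fun B (fun z : T => (normsq z ^+ m * abs2 (f z))%:E).
  apply/measurable_EFinP; apply: measurable_funM; last exact/measurable_EFinP.
  by apply: measurable_funTS; apply: measurable_funX; exact: measurable_normsq_borel.
have w0 (z : T) : 0 <= normsq z ^+ m * abs2 (f z).
  by rewrite mulr_ge0 ?abs2_ge0 // exprn_ge0 // normsq_ge0.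
have mB := @measurable_ballB R n.
apply: (@le_trans _ _ (\int[mu]_(z in ballB (n := n)) ((2 * (normsq z ^+ m * abs2 (f z)))%:E + e%:E))%E).
  apply: ge0_le_integral => //.
  - by move=> z _; rewrite lee_fin abs2_ge0.
  - apply: emeasurable_funD; last exact: measurable_cst.
    by under eq_fun do rewrite EFinM; apply: emeasurable_funM => //; exact: measurable_cst.
  - move=> z zB; rewrite -EFinD lee_fin.
    have [h|h] := ltP (normsq z ^+ m) 2^-1.
      by rewrite (le_trans (fe z h)) // lerDr mulr_ge0.
    have a0 := abs2_ge0 (f z).
    have : 2^-1 * abs2 (f z) <= normsq z ^+ m * abs2 (f z) by rewrite ler_wpM2r.
    by lra.
rewrite ge0_integralD //; last 2 first.
- by move=> z _; rewrite lee_fin mulr_ge0.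
- by under eq_fun do rewrite EFinM; apply: emeasurable_funM => //; exact: measurable_cst.
rewrite leeD //.
  under eq_integral do rewrite EFinM.
  by rewrite ge0_integralZl_EFin // => z _; rewrite lee_fin.
rewrite integral_cst // EFinM fineK ?ge0_fin_numE // lee_wpmul2l //.
by apply: le_measure; rewrite ?inE.
Qed.

(** By Bernoulli's inequality [(1 - 1/(2m))^m >= 1/2], so a weight below 1/2 confines [z] to a ball
    of radius less than 1. *)
Lemma weight_small_radius m (z : cpt R n) : (0 < m)%N -> normsq z ^+ m < 2^-1 ->
  normsq z <= Num.sqrt (1 - (2 * m%:R)^-1) ^+ 2.
Proof.
move=> m0 h; have m0' : 0 < m%:R :> R by rewrite ltr0n.
have x1 : (2 * m%:R)^-1 <= 1 :> R.
  by rewrite invf_le1 ?mulr_gt0 // -natrM ler1n muln_gt0.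
rewrite sqr_sqrtr ?subr_ge0 //; apply: contraTT h; rewrite -ltNge -leNgt => h.
have Bern k : 1 - k%:R * (2 * m%:R)^-1 <= (1 - (2 * m%:R)^-1) ^+ k :> R.
  elim: k => [|k IH]; first by rewrite mul0r subr0 expr0.
  rewrite exprS; set x := (2 * m%:R)^-1 in x1 IH *.
  have xx : 0 <= x by rewrite invr_ge0 mulr_ge0.
  apply: le_trans (ler_wpM2l _ IH); last by rewrite subr_ge0.
  rewrite -natr1; have : 0 <= k%:R * (x * x) by rewrite !mulr_ge0.
  lra.
apply: (le_trans _ (lerXn2r m _ _ (ltW h))); rewrite ?nnegrE ?subr_ge0 ?normsq_ge0 //.
apply: le_trans (Bern m); rewrite invfM mulrCA divff ?gt_eqF // mulr1; lra.
Qed.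

(** The order of choices matters: [m] depends on [C], [D] and [e] only and fixes the radius [t]; the
    index beyond which [k] must lie is chosen last. *)
Lemma hankel_mu_small (d g : nat -> cpt R n -> R[i]) (A : nat -> mindex n -> R[i]) (D e : R) :
  (forall k, inP M (d k)) -> (forall k, nrm (d k) <= D) -> (forall k, series_of (d k) (A k)) ->
  (forall a, ccvg (fun k => A k a) 0) ->
  (forall k, bergman (g k)) -> (forall k, series_of (g k) (hshift j (A k))) -> 0 < e ->
  exists N, forall k, (N <= k)%N ->
    (muint (g k) <= e%:E)%E /\ nrm (fun z => conjz j (d k) z - g k z) <= e.
Proof.
move=> dP dD dA A0 bg gA e0.
have D0 : 0 <= D by apply: le_trans (dD 0%N); exact: nrm_ge0.
have AD k K : csum (A k) K <= D.
  by rewrite (le_trans _ (dD k)) // csum_le_nrm //; exact: inP_L2 (dP k).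
have HD k K : csum (hshift j (A k)) K <= D by rewrite (le_trans (csum_hshift _ _ _)).
have H0 a : ccvg (fun k => hshift j (A k) a) 0.
  by have := ccvgZ (kap j (minc j a))%:C%C (A0 (minc j a)); rewrite mulr0.
pose V := fine (mu setT); have V0 : 0 <= V by rewrite fine_ge0.
(* Large enough for [4 * C * D / m <= e / 4]; the two successors also ensure [1 < m]. *)
pose m := (Num.truncn (16 * C * D / e)).+2.
have mD : 4 * C * (m%:R^-1 * D) <= e / 4.
  have h : 16 * C * D / e <= m%:R.
    by rewrite (le_trans (ltW (truncnS_gt _))) // ler_nat.
  have m0 : 0 < m%:R :> R by rewrite ltr0n.
  have : 16 * C * D <= e * m%:R by rewrite [e * _]mulrC -ler_pdivrMr.
  move=> h2; rewrite -(ler_pM2r m0).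
  have -> : 4 * C * (m%:R^-1 * D) * m%:R = 4 * C * D by field; rewrite gt_eqF.
  lra.
pose t := Num.sqrt (1 - (2 * m%:R)^-1 : R).
have x0 : 0 < (2 * m%:R)^-1 :> R by rewrite invr_gt0 mulr_gt0.
have x1 : (2 * m%:R)^-1 < 1 :> R.
  by rewrite invf_lt1 ?mulr_gt0 // -natrM ltr1n.
have t0 : 0 < t by rewrite sqrtr_gt0 subr_gt0.
have t1 : t < 1 by rewrite -[ltRHS]sqrtr1 ltr_sqrt // gtrBl.
have eV : 0 < e / (4 * (V + 1)) by rewrite divr_gt0 // mulr_gt0 // ltr_wpDl.
have [N1 HN1] := unif_decay HD gA H0 t0 t1 eV.
(* The norms of the Hankel error and of the defect each enter with factor [4 * C], so each takes a
   quarter of [e]; the [1/m] term and the inner region take the other two. *)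
pose w := Num.min e (e / (16 * C)).
have w0 : 0 < w by rewrite lt_min e0 divr_gt0 // mulr_gt0.
have [N2 HN2] := wsum_small AD A0 w0.
exists (maxn N1 N2) => k; rewrite geq_max => /andP[k1 k2].
have X := nrm_hankel_le (AD k) (dA k) (gA k) (HN2 k k2).
have Y := nrm_defect_le (dA k) (HN2 k k2).
split; last by rewrite (le_trans X) // ge_min lexx.
have S : (muint (g k) <= 2%:E * \int[mu]_(z in ballB (n := n)) (normsq z ^+ m * abs2 (g k z))%:E + (e / (4 * (V + 1)) * V)%:E)%E.
  apply: muint_split => //; first exact: ltW.
  by move=> z /(weight_small_radius (ltn0Sn _)) zt; exact: HN1.
apply: (le_trans S).
have W := muint_weighted (isT : (1 < m)%N) (bg k) (dP k).
apply: (le_trans (leeD (lee_wpmul2l _ W) (lexx _))); first by rewrite lee_fin.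
rewrite -EFinM -EFinD lee_fin.
have wC : 16 * C * w <= e.
  rewrite mulrC -ler_pdivlMr ?mulr_gt0 // ge_min lexx orbT //.
have vV : e / (4 * (V + 1)) * V <= e / 4.
  have V1 : 0 < V + 1 by rewrite ltr_wpDl.
  rewrite invfM mulrA -mulrA ler_piMr ?divr_ge0 ?(ltW e0) // mulrC ler_pdivrMr //.
  by rewrite mul1r lerDl.
have dm : m%:R^-1 * nrm (d k) <= m%:R^-1 * D by rewrite ler_wpM2l.
have CX : C * nrm (fun z => conjz j (d k) z - g k z) <= C * w by rewrite ler_pM2l.
have CY : C * nrm (defect (d k)) <= C * w by rewrite ler_pM2l.
have Cdm : C * (m%:R^-1 * nrm (d k)) <= C * (m%:R^-1 * D) by rewrite ler_pM2l.
lra.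
Qed.

Lemma conjz_near_inP (d : nat -> cpt R n -> R[i]) (D e : R) :
  (forall k, inP M (d k)) -> (forall k, nrm (d k) <= D) ->
  (forall z, inB z -> ccvg (fun k => d k z) 0) -> 0 < e ->
  exists N, forall k, (N <= k)%N -> exists p, inP M p /\ nrm (fun z => conjz j (d k) z - p z) <= e.
Proof.
move=> dP dD d0 e0.
have [A dA] := choice (fun k => bergman_series (dP k).1).
have AD k K : csum (A k) K <= D.
  by rewrite (le_trans _ (dD k)) // csum_le_nrm //; exact: inP_L2 (dP k).
have A0 := coef_decay AD dA d0.
have HD k K : csum (hshift j (A k)) K <= D by rewrite (le_trans (csum_hshift _ _ _)).
have [g Hg] := choice (fun k => bounded_series_bergman (HD k)).
have bg k : bergman (g k) by have [] := Hg k.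
have gA k : series_of (g k) (hshift j (A k)) by have [] := Hg k.
(* The lower bound divides by [c], and [nrmD_le] doubles each of the two resulting terms [e / 4]. *)
pose e' := Num.min (e / 4) (c * (e / 4)).
have e'0 : 0 < e' by rewrite lt_min divr_gt0 //= mulr_gt0 // divr_gt0.
have [N HN] := hankel_mu_small dP dD dA A0 bg gA e'0.
exists N => k /HN[mk gk]; have [p [hp hq _]] := bergman_split (bg k).
exists p; split=> //.
have q4 : nrm (fun z => g k z - p z) <= e / 4.
  rewrite -(ler_pM2l c0) -lee_fin EFinM -bnorm2_nrm; last by apply: bergman_L2; case: hq.
  rewrite (le_trans (lower hq)) // -(@muint_eq_on (g k)) //; last 2 first.
  - by case: hq.
  - by move=> z zM; case: hp => _ ->; rewrite ?subr0.
  by rewrite (le_trans mk) // lee_fin ge_min lexx orbT.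
have Lg := bergman_L2 (bg k); have Ld := inP_L2 (dP k); have Lp := inP_L2 hp.
have := nrmD_le (L2B (L2_conjz j Ld).1 Lg) (L2B Lg Lp).
rewrite (@eq_nrm _ _ _ (fun z => conjz j (d k) z - p z)) => [|z _]; last by ring.
move=> /le_trans; apply.
have : e' <= e / 4 by rewrite ge_min lexx.
lra.
Qed.

End CarlesonMeasure.

(** * From the distance estimate to compact commutators *)

Section EssentialNormality.
Context {R : realType} {n : nat}.
Variable M : set (cpt R n).
Hypothesis hM : M `<=` ballB (n := n).
Hypothesis near_inP : forall (j : 'I_n) (d : nat -> cpt R n -> R[i]) (D e : R),
  (forall k, inP M (d k)) -> (forall k, nrm (d k) <= D) ->
  (forall z, inB z -> ccvg (fun k => d k z) 0) -> 0 < e ->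
  exists N, forall k, (N <= k)%N -> exists p, inP M p /\ nrm (fun z => conjz j (d k) z - p z) <= e.
Implicit Types (f g h : cpt R n -> R[i]).

Definition projP F : cpt R n -> R[i] := xget (fun=> 0) [set p | inP M p /\
  forall h, inP M h -> rip (fun z => F z - p z) h = 0].

Lemma projPP F : L2 F -> inP M (projP F) /\
  forall h, inP M h -> rip (fun z => F z - projP F z) h = 0.
Proof.
move=> LF; apply: (@xgetPex _ (fun=> 0) [set p | inP M p /\
  forall h, inP M h -> rip (fun z => F z - p z) h = 0]).
by have [p hp] := projection_exists hM LF; exists p.
Qed.

(** Moving [z_j] across the inner product gives [\bar z_j f], and projecting it onto [P] does not
    affect pairings with elements of [P]. *)
Lemma adjoint_projP j : adjointP M j (fun f => projP (conjz j f)).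
Proof.
move=> f hf; have Lf := inP_L2 hf; have Lc := (L2_conjz j Lf).1.
have [hp orth] := projPP Lc; split=> // h hh; have Lh := inP_L2 hh; have Lp := inP_L2 hp.
have mulz_conjz (u : cpt R n -> R[i]) z : mulz j u z * cconj (f z) = u z * cconj (conjz j f z).
  by rewrite /mulz /conjz cconjM (_ : cconj (cconj (z j)) = z j); [ring|case: (z j) => a b; rewrite /cconj /= opprK].
have re u : inP M u -> ip_re (mulz j u) f = ip_re u (projP (conjz j f)).
  move=> hu; have Lu := inP_L2 hu.
  have -> : ip_re (mulz j u) f = ip_re u (conjz j f).
    by congr vint; apply/funext => z; rewrite mulz_conjz.
  rewrite !ip_re_rip //; congr EFin.
  have := orth u hu; rewrite rip_sym => E.
  rewrite rip_sym [RHS]rip_sym -[LHS]addr0 -[in LHS](oppr0) -[X in _ - X]E (rip_sym u).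
  have -> : rip (fun z => conjz j f z - projP (conjz j f) z) u =
      rip (conjz j f) u - rip (projP (conjz j f)) u.
    have := ripD Lc (L2Z (-1) Lp) Lu.
    have := ripZ (-1) Lp Lu; rewrite rmorphN1 mulN1r => -> <-.
    by apply: eq_Iv => z _; rewrite mulN1r.
  by ring.
split; first exact: re.
have -> : ip_im (mulz j h) f = ip_re (mulz j (fun z => - 'i%C * h z)) f.
  by rewrite ip_im_re; congr vint; apply/funext => z; rewrite /mulz mulrCA.
by rewrite ip_im_re; apply: re; exact: inPZ.
Qed.

(** A bounded sequence in [P] has a subsequence with a pointwise limit [v] in [P], and the
    commutator of [v] is the limit sought. The differences [d k] and [z_i d_k] are bounded in [P]
    and tend to 0 pointwise, so [near_inP] applies to both. *)
Lemma ess_normal : ess_normalP M.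
Proof.
move=> i j; pose A f := projP (conjz j f); exists A; split; first exact: adjoint_projP.
move=> u uP [B uB].
have Lu k : L2 (u k) by exact: inP_L2 (uP k).
have uB' k : nrm (u k) <= B by rewrite -lee_fin -bnorm2_nrm.
have [phi [phi_inc [v [vP vB uv]]]] := inP_montel hM uP uB'.
have Lv := inP_L2 vP.
exists phi; split=> //.
have AP f : inP M f -> inP M (A f) by move=> hf; have [] := projPP (L2_conjz j (inP_L2 hf)).1.
have zP f : inP M f -> inP M (mulz i f) by exact: inP_mulz.
exists (fun z => mulz i (A v) z - A (mulz i v) z); split.
  by apply: inPB; [exact/zP/AP|exact/AP/zP].
pose d k z := u (phi k) z - v z.
have dP k : inP M (d k) by exact: inPB.
have dD k : nrm (d k) <= 4 * B.
  by rewrite (le_trans (nrmB_le (Lu _) Lv)) //; have := uB' (phi k); lra.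
have d0 z : inB z -> ccvg (fun k => d k z) 0.
  by move=> /uv; have := ccvg_cst (v z) => h1 h2; have := ccvgD h2 (ccvgZ (-1) h1);
    rewrite mulN1r subrr; congr ccvg; apply/funext => k; rewrite mulN1r.
have zdD k : nrm (mulz i (d k)) <= 4 * B.
  by rewrite (le_trans (L2_coord i (inP_L2 (dP k))).2).
have zd0 z : inB z -> ccvg (fun k => mulz i (d k) z) 0.
  by move=> /d0 h; have := ccvgZ (z i) h; rewrite mulr0.
(* The commutator is a difference of two terms of squared norm at most [e / 8], each doubled by
   [nrmB_le]; the total [e / 2] is strictly below [e]. *)
move=> e e0; have e8 : 0 < e / 8 by rewrite divr_gt0.
have [N1 HN1] := near_inP j dP dD d0 e8.
have [N2 HN2] := near_inP j (fun k => zP _ (dP k)) zdD zd0 e8.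
exists (maxn N1 N2) => k; rewrite geq_max => /andP[/HN1[p1 [p1P p1e]] /HN2[p2 [p2P p2e]]].
(* the defect of [A] on a difference is orthogonal to P, hence dominated by the distance to P *)
have key f g p : inP M f -> inP M g -> inP M p ->
    nrm (fun z => conjz j (fun z => f z - g z) z - p z) <= e / 8 ->
    L2 (fun z => conjz j (fun z => f z - g z) z - (A f z - A g z)) /\
    nrm (fun z => conjz j (fun z => f z - g z) z - (A f z - A g z)) <= e / 8.
  move=> hf hg hp hd; have [Lf Lg] := (inP_L2 hf, inP_L2 hg).
  have [Lcf Lcg] := ((L2_conjz j Lf).1, (L2_conjz j Lg).1).
  have [[pf of_] [pg og]] := (projPP Lcf, projPP Lcg).
  have Lx : L2 (conjz j (fun z => f z - g z)) by exact: (L2_conjz j (inP_L2 (inPB hf hg))).1.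
  have hA := inPB (AP f hf) (AP g hg).
  split; first by apply: L2B => //; exact: inP_L2 hA.
  apply: le_trans hd; apply: (orthogonal_distance Lx hp hA) => h hh.
  have Lh := inP_L2 hh.
  have L1 : L2 (fun z => conjz j f z - A f z) by apply: L2B => //; exact: inP_L2 pf.
  have L2' : L2 (fun z => conjz j g z - A g z) by apply: L2B => //; exact: inP_L2 pg.
  have := ripD L1 (L2Z (-1) L2') Lh; have := ripZ (-1) L2' Lh.
  rewrite rmorphN1 of_ // og // mulr0 => -> E; rewrite addr0 in E.
  by apply: etrans E; apply: eq_Iv => z _; rewrite /conjz; congr (complex.Re (_ * _)); ring.
have [L1 k1] := key _ _ _ (uP (phi k)) vP p1P p1e.
have [|L2' k2] := key _ _ p2 (zP _ (uP (phi k))) (zP _ vP) p2P.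
  rewrite (@eq_nrm _ _ _ (fun z => conjz j (mulz i (d k)) z - p2 z)) // => z _.
  by rewrite /conjz /mulz /d; ring.
have [Lz1 z1] := L2_coord i L1.
have Lall : L2 (fun z => (mulz i (A (u (phi k))) z - A (mulz i (u (phi k))) z) - (mulz i (A v) z - A (mulz i v) z)).
  apply: L2B; apply: inP_L2; apply: inPB; (try exact/zP/AP); exact/AP/zP.
rewrite bnorm2_nrm // lte_fin.
rewrite (@eq_nrm _ _ _ (fun z => (conjz j (fun z => mulz i (u (phi k)) z - mulz i v z) z - (A (mulz i (u (phi k))) z - A (mulz i v) z))
   - mulz i (fun z => conjz j (fun z => u (phi k) z - v z) z - (A (u (phi k)) z - A v z)) z)) => [|z _]; last first.
  by rewrite /mulz /conjz; ring.
by apply: le_lt_trans (nrmB_le L2' Lz1) _; lra.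
Qed.

End EssentialNormality.

Theorem mainTheorem1 (R : realType) (n : nat) (hn : (0 < n)%N)
  (M : set (cpt R n)) (hM : M `<=` ballB (n:=n))
  (hmu : exists mu : {measure set (borelC R n) -> \bar R},
      (mu setT < +oo)%E /\
      (forall A : set (borelC R n), measurable A -> A `&` M = set0 -> mu A = 0%E) /\
      regular_measure mu /\
      exists C c : R, 0 < C /\ 0 < c /\
        forall f : cpt R n -> R[i], inQ M f ->
          (c%:E * bnorm2 f <= \int[mu]_(z in ballB (n:=n)) (abs2 (f z))%:E)%E /\
          (\int[mu]_(z in ballB (n:=n)) (abs2 (f z))%:E <= C%:E * bnorm2 f)%E) :
  ess_normalP M.
Proof.
have [mu [mu_fin [mu_M [_ [C [c [C0 [c0 H]]]]]]]] := hmu.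
apply: (ess_normal hM) => j d D e.
exact: (conjz_near_inP hM mu_fin mu_M C0 c0 (fun f hf => (H f hf).1) (fun f hf => (H f hf).2)).
Qed.
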